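(* Every infinite-dimensional weakly countably determined (WCD) real Banach space admits an equivalent norm which is average locally uniformly rotund (ALUR) and G\^ateaux smooth, but not locally uniformly rotund (LUR).
   Context: A Banach space $X$ is weakly countably determined (WCD) if there is a countable collection $\{K_n: n\in\mathbb N\}$ of $w^*$-compact subsets of $X^{**}$ such that for every $x\in X$ and $u\in X^{**}\setminus X$ there is $n_0\in\mathbb N$ with $x\in K_{n_0}$ and $u\notin K_{n_0}$. For a Banach space $(X,\|\cdot\|)$, $B_X$ and $S_X$ denote the closed unit ball and the unit sphere. A slice of $K\subset X$ is a set $\{y\in K: x^*(y)>\sup x^*(K)-\alpha\}$ with $\alpha>0$ and $x^*\in X^*\setminus\{0\}$ bounded above on $K$. A point $x\in S_X$ is a denting point of $B_X$ if for each norm neighbourhood $V$ of $x$ there is a slice $S$ of $B_X$ with $x\in S\subset V$. The norm is ALUR if every point of $S_X$ is a denting point of $B_X$. The norm is LUR if for every $x\in S_X$ one has $x_n\to x$ in norm whenever $(x_n)_n\subset X$ satisfies $\lim_n(2\|x\|^2+2\|x_n\|^2-\|x+x_n\|^2)=0$. The norm is G\^ateaux smooth if for all $x,y\in S_X$, $\lim_{h\to0}\frac{\|x+hy\|+\|x-hy\|-2}{h}=0$. *)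

(* Defs.v *)
From HB Require Import structures.
From mathcomp Require Import all_boot all_order all_algebra.
From mathcomp Require Import boolp classical_sets functions.
From mathcomp Require Import reals topology normedtype sequences.

Set Implicit Arguments.
Unset Strict Implicit.
Unset Printing Implicit Defensive.

Import Order.TTheory GRing.Theory Num.Theory.
Import numFieldNormedType.Exports.

Local Open Scope classical_set_scope.
Local Open Scope ring_scope.

Definition unit_ball (R : realType) (X : normedModType R) : set X :=
  [set x | `|x| <= 1].
Arguments unit_ball {R} X.

Definition unit_sphere (R : realType) (X : normedModType R) : set X :=
  [set x | `|x| = 1].
Arguments unit_sphere {R} X.

Definition infinite_dimensional (R : realType) (X : normedModType R) : Prop :=
  forall (n : nat) (b : 'I_n -> X),
    ~ (forall x : X, exists c : 'I_n -> R, x = \sum_(i < n) c i *: b i).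

Definition dual_pred (R : realType) (X : normedModType R) : {pred X -> R^o} :=
  mem [set f : X -> R^o | linear f /\ continuous f].
Arguments dual_pred {R} X.

Record topdual (R : realType) (X : normedModType R) := Dual {
  dual_fun :> X -> R^o;
  dual_funP : dual_fun \in dual_pred X }.

Section DualLmodule.
Context {R : realType} {X : normedModType R}.

HB.instance Definition _ := [isSub of topdual X for @dual_fun R X].
HB.instance Definition _ := [Choice of topdual X by <:].

Lemma dual_submod_closed : submod_closed (dual_pred X).
Proof.
split.
  apply: mem_set; split; last exact: cst_continuous.
  by move=> a x y; rewrite /= scaler0 addr0.
move=> a f g /set_mem[lf cf] /set_mem[lg cg]; apply: mem_set; split.
  move=> b x y; rewrite !fctE lf lg !scalerDr !scalerA [b * a]mulrC.
  by rewrite addrACA.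
move=> x; apply: (@continuousD _ _ _ (fun x => a *: f x) g); last exact: cg.
by apply: continuousZr; exact: cf.
Qed.

HB.instance Definition _ :=
  GRing.isSubmodClosed.Build R _ (dual_pred X) dual_submod_closed.
HB.instance Definition _ := [SubChoice_isSubLmodule of topdual X by <:].

End DualLmodule.

Section DualNorm.
Context {R : realType} {X : normedModType R}.
Implicit Types f g : topdual X.

Lemma dual_linear f : linear f.
Proof. by have /set_mem[] := dual_funP f. Qed.

Lemma dual_continuous f : continuous f.
Proof. by have /set_mem[] := dual_funP f. Qed.

HB.instance Definition _ f :=
  GRing.isLinear.Build R X R^o *:%R f (dual_linear f).

Definition dual_norm f : R := sup [set `|f x| | x in unit_ball X].

Lemma dual_bounded f : has_sup [set `|f x| | x in unit_ball X].
Proof.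
split; first by exists `|f 0|, 0 => //; rewrite /unit_ball/= normr0.
have /bounded_funP/(_ 1)[M fM] : bounded_near f (nbhs (0 : X)).
  by apply/linear_bounded_continuous; exact: dual_continuous.
by exists M => _ [x x1 <-]; exact: fM.
Qed.

Lemma dual_norm_ub f x : `|x| <= 1 -> `|f x| <= dual_norm f.
Proof. by move=> x1; apply: ub_le_sup; [case: (dual_bounded f)|exists x]. Qed.

Lemma dual_norm_ge0 f : 0 <= dual_norm f.
Proof.
by apply: le_trans (normr_ge0 (f 0)) _; apply: dual_norm_ub; rewrite normr0.
Qed.

Lemma dual_normP f x : `|f x| <= dual_norm f * `|x|.
Proof.
have [->|x0] := eqVneq x 0; first by rewrite linear0 !normr0 mulr0.
rewrite -ler_pdivrMr ?normr_gt0// mulrC.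
have -> : `|x|^-1 * `|f x| = `|f (`|x|^-1 *: x)|.
  by rewrite linearZ/= normrM normfV normr_id.
by apply: dual_norm_ub; rewrite normrZ normfV normr_id mulVf ?normr_eq0.
Qed.

Lemma dual_norm_le f M :
  (forall x, `|x| <= 1 -> `|f x| <= M) -> dual_norm f <= M.
Proof.
move=> fM; apply: ge_sup; first by case: (dual_bounded f).
by move=> _ [x x1 <-]; exact: fM.
Qed.

Lemma dual_normD f g : dual_norm (f + g) <= dual_norm f + dual_norm g.
Proof.
apply: dual_norm_le => x x1; apply: (le_trans (ler_normD _ _)).
by apply: lerD; exact: dual_norm_ub.
Qed.

Lemma dual_normZ (a : R) f : dual_norm (a *: f) = `|a| * dual_norm f.
Proof.
have leZ (b : R) g : dual_norm (b *: g) <= `|b| * dual_norm g.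
  apply: dual_norm_le => x x1; rewrite [_ x]/(b * g x) normrM ler_wpM2l//.
  exact: dual_norm_ub.
apply/eqP; rewrite eq_le leZ/=.
have [->|a0] := eqVneq a 0; first by rewrite normr0 mul0r dual_norm_ge0.
rewrite -ler_pdivlMl ?normr_gt0// -normfV.
by rewrite -{1}(scale1r f) -(mulVf a0) -scalerA leZ.
Qed.

Lemma dual_norm_eq0 f : dual_norm f = 0 -> f = 0.
Proof.
move=> f0; apply/val_inj/funext => x /=.
by apply/eqP; rewrite -normr_le0 (le_trans (dual_normP f x))// f0 mul0r.
Qed.

HB.instance Definition _ := Lmodule_isNormed.Build R (topdual X)
  dual_normD dual_normZ dual_norm_eq0.

End DualNorm.

Section Evaluation.
Context {R : realType} {X : normedModType R}.

Lemma evaluation_subproof (x : X) :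
  (fun f : topdual X => f x : R^o) \in dual_pred (topdual X).
Proof.
have lx : linear (fun f : topdual X => f x : R^o) by [].
apply: mem_set; split => //.
pose e : {linear topdual X -> R^o} := HB.pack (fun f : topdual X => f x : R^o)
  (GRing.isLinear.Build R (topdual X) R^o *:%R _ lx).
apply: (@bounded_linear_continuous _ _ _ e); apply/bounded_funP => r.
exists (r * `|x|) => f fr; apply: (le_trans (dual_normP f x)).
exact: ler_wpM2r.
Qed.

Definition evaluation (x : X) : topdual (topdual X) :=
  Dual (evaluation_subproof x).

End Evaluation.

(* The dual of X with its w*-topology, not that of the dual norm. *)
Definition weak_star (R : realType) (X : normedModType R) :=
  initial_topology (fun f : topdual X => (f : X -> R^o) : {ptws X -> R^o}).
Arguments weak_star {R} X.

(* X is identified with its image in the bidual under evaluation. *)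
Definition weakly_countably_determined (R : realType) (X : normedModType R) :
    Prop :=
  exists K : nat -> set (topdual (topdual X)),
    (forall n, compact (K n : set (weak_star (topdual X)))) /\
    (forall (x : X) (u : topdual (topdual X)), ~ range evaluation u ->
      exists n0, K n0 (evaluation x) /\ ~ K n0 u).

Definition slice (R : realType) (X : normedModType R) (K S : set X) : Prop :=
  exists (f : topdual X) (alpha : R),
    [/\ f <> 0, has_ubound (f @` K), 0 < alpha &
        S = [set y | K y /\ f y > sup (f @` K) - alpha]].

Definition denting_point (R : realType) (X : normedModType R) (x : X) : Prop :=
  unit_sphere X x /\
  forall V : set X, nbhs x V ->
    exists S : set X, [/\ slice (unit_ball X) S, S x & S `<=` V].

Definition ALUR (R : realType) (X : normedModType R) : Prop :=
  forall x : X, unit_sphere X x -> denting_point x.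
Arguments ALUR {R} X.

Definition LUR (R : realType) (X : normedModType R) : Prop :=
  forall x : X, unit_sphere X x -> forall x_ : nat -> X,
    (2 * `|x| ^+ 2 + 2 * `|x_ n| ^+ 2 - `|x + x_ n| ^+ 2) @[n --> \oo]
      --> (0 : R) ->
    x_ n @[n --> \oo] --> x.
Arguments LUR {R} X.

Definition gateaux_smooth (R : realType) (X : normedModType R) : Prop :=
  forall x y : X, unit_sphere X x -> unit_sphere X y ->
    (`|x + h *: y| + `|x - h *: y| - 2) / h @[h --> (0 : R)^'] --> (0 : R).
Arguments gateaux_smooth {R} X.

(* Definiteness of an equivalent norm follows from the lower estimate. *)
Record equivalent_norm (R : realType) (X : normedModType R) := EquivalentNorm {
  eqnorm :> X -> R;
  eqnormD : forall x y, eqnorm (x + y) <= eqnorm x + eqnorm y;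
  eqnormZ : forall (a : R) x, eqnorm (a *: x) = `|a| * eqnorm x;
  eqnorm_equiv : exists c C : R, [/\ 0 < c, 0 < C &
    forall x, c * `|x| <= eqnorm x <= C * `|x|] }.

(* Only the vector space structure of X is inherited: norm, topology and dual *)
(* of this alias are those given by N.                                        *)
Definition renormed (R : realType) (X : normedModType R)
  (N : equivalent_norm X) : Type := X.

Section Renormed.
Context {R : realType} {X : normedModType R} (N : equivalent_norm X).

Lemma eqnorm_eq0 (x : X) : N x = 0 -> x = 0.
Proof.
have [c [C [c0 _ /(_ x)/andP[cN _]]]] := eqnorm_equiv N.
by move=> N0; apply/eqP; rewrite -normr_le0 -(pmulr_rle0 _ c0) -N0.
Qed.

HB.instance Definition _ := GRing.Lmodule.copy (renormed N) X.
HB.instance Definition _ := Lmodule_isNormed.Build R (renormed N)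
  (eqnormD N) (eqnormZ N) eqnorm_eq0.

End Renormed.

(* Main.v *)
(* Weak countable determination enters through ultrafilters: the closure of a   *)
(* subset of X stable under countably many suitable operations is the range of  *)
(* a norm-one projection. Decomposing X by transfinite induction into countably *)
(* generated blocks yields a total, fundamental system of coordinates with c_0  *)
(* behaviour and Sokolov's splitting property. Weighted sums of suprema over    *)
(* finite sets of coordinates give a 2-homogeneous locally uniformly rotund     *)
(* (LUR) function p on X and a strictly convex function on the dual; infimal    *)
(* convolutions of p with multiples of the preconjugate of the latter are       *)
(* smooth, and a weighted sum of them is a smooth LUR function G.               *)
(*                                                                              *)
(* To spoil LUR at +-x0 only, take f0 with f0 x0 = |x0| = 1, P x = x - f0 x *:  *)
(* x0, and a pointwise null sequence of functionals g_n almost biorthogonal to  *)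
(* bounded y_n in ker f0. The functions lam_n = eps_n * huber (g_n / eps_n) +   *)
(* eps_n * G (P x) are smooth and LUR in P x, but nearly linear along y_n as    *)
(* eps_n -> 0. Let F x be the supremum of the sums of w_n * lam_n x over a      *)
(* strictly convex set of weights w: it is smooth because optimal weights are   *)
(* unique, and it inherits LUR in P x because near-optimal weights charge some  *)
(* index of a fixed finite set. The new norm is the gauge of the body huber (f0 *)
(* x) + F x <= 3/4. Off the axis R x0 the slices of a support functional are    *)
(* small by LUR of F; the points +-x0 are strongly exposed by +-f0; and the     *)
(* points (1 - F (y_k / 64)) *: x0 + y_k / 64 of the ball stay away from x0     *)
(* although their midpoints with x0 approach the sphere.                        *)

Require Import Defs.
From HB Require Import structures.
From mathcomp Require Import all_boot all_order all_algebra.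
From mathcomp Require Import finmap.
From mathcomp Require Import boolp classical_sets functions wochoice.
From mathcomp Require Import reals topology normedtype sequences.
From mathcomp Require Import ring lra.

Set Implicit Arguments.
Unset Strict Implicit.
Unset Printing Implicit Defensive.

Import Order.TTheory GRing.Theory Num.Theory.
Import numFieldNormedType.Exports.

Local Open Scope classical_set_scope.
Local Open Scope ring_scope.


(** * Sublinear functionals *)

(** Weak countable determination enters only through [wcd_determining]: a norm-bounded ultrafilter
    on $X$ that contains every [C i] through some fixed point converges weakly to a point of $X$.
    Applied to sets generated by countably many Skolem operations, this gives norm-one projections
    ([reflecting_ops], [projP]). Transfinite induction along a well-ordering then splits $X$ into
    mutually orthogonal blocks, each carrying a sequence of vectors and a sequence of functionals
    ([determining_decomposition]). After rescaling, the coordinates of every point lie in $c_0$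
    ([coord_c0]) and the vectors satisfy Sokolov's condition ([splitting]).

    From these coordinates comes a smooth LUR function. On $X$, [rotund] is LUR in the manner of
    Troyanski ([rotund_LUR]). On the dual, [dual_rotund] is strictly convex ([dual_rotund_strict]),
    so approximate subgradients of its preconjugate are essentially unique ([predual_deficit]). A
    subgradient of an infimal convolution is an approximate subgradient of the second summand, so
    the weighted sum [regular] of such convolutions is smooth ([smooth_regular]); it stays LUR
    because the convolutions approximate [rotund] ([regular_LUR]).

    LUR is then destroyed at $\pm x_0$ only. The new ball is $huber(f_0) + F \le 3/4$ with $F$ =
    [ridges], so near $x_0$ the sphere is the graph $f_0 = 1 - F$. Since $F$ is almost linear along
    segments of fixed size in the directions $y_k$, the sphere contains near $x_0$ almost-segments
    of fixed length, and LUR fails there ([renorming_not_LUR]). Nevertheless $F$ controls the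
    distance to the axis, so $\pm x_0$ are strongly exposed by $\pm f_0$ ([exposed_axis]). At any
    other point of the sphere $F$ is LUR in the component off the axis ([ridges_LUR]), and the
    slices of a support functional are small ([exposed_off_axis]). Smoothness survives the supremum
    defining $F$ by strict convexity of the set of weights ([flat_smooth]), and the passage to the
    gauge by [gauge_smooth]. *)

Section InfSup.
Context {R : realType} {T : Type}.
Implicit Types (D : set T) (f : T -> R).

Definition infr D f : R := inf (f @` D).
Definition supr D f : R := sup (f @` D).

Lemma infr_le D f M t : (forall t, D t -> M <= f t) -> D t -> infr D f <= f t.
Proof.
move=> fM Dt; apply: ge_inf; last by exists t.
by exists M => _ [u Du <-]; exact: fM.
Qed.

Lemma infr_ge D f c t0 : D t0 -> (forall t, D t -> c <= f t) -> c <= infr D f.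
Proof.
move=> Dt0 fc; apply: lb_le_inf; first by exists (f t0), t0.
by move=> _ [u Du <-]; exact: fc.
Qed.

Lemma infr_adh D f M t0 e : D t0 -> (forall t, D t -> M <= f t) -> 0 < e ->
  exists2 t, D t & f t < infr D f + e.
Proof.
move=> Dt0 fM e0.
have hi : has_inf (f @` D).
  split; first by exists (f t0), t0.
  by exists M => _ [u Du <-]; exact: fM.
by have [_ [t Dt <-] h] := inf_adherent e0 hi; exists t.
Qed.

Lemma supr_ge D f M t : (forall t, D t -> f t <= M) -> D t -> f t <= supr D f.
Proof.
move=> fM Dt; apply: ub_le_sup; last by exists t.
by exists M => _ [u Du <-]; exact: fM.
Qed.

Lemma supr_le D f c t0 : D t0 -> (forall t, D t -> f t <= c) -> supr D f <= c.
Proof.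
move=> Dt0 fc; apply: ge_sup; first by exists (f t0), t0.
by move=> _ [u Du <-]; exact: fc.
Qed.

Lemma supr_adh D f M t0 e : D t0 -> (forall t, D t -> f t <= M) -> 0 < e ->
  exists2 t, D t & supr D f - e < f t.
Proof.
move=> Dt0 fM e0.
have hi : has_sup (f @` D).
  split; first by exists (f t0), t0.
  by exists M => _ [u Du <-]; exact: fM.
by have [_ [t Dt <-] h] := sup_adherent e0 hi; exists t.
Qed.

End InfSup.

Section HahnBanach.
Context {R : realType} {X : lmodType R}.
Implicit Types (p q : X -> R).

Definition sublinear p :=
  (forall x y, p (x + y) <= p x + p y) /\
  (forall (a : R) x, 0 <= a -> p (a *: x) = a * p x).

Lemma sublinear0 p : sublinear p -> p 0 = 0.
Proof. by move=> [_ /(_ 0 0 (lexx 0))]; rewrite scale0r mul0r. Qed.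

Lemma sublinear_ge p x : sublinear p -> - p (- x) <= p x.
Proof.
by move=> hp; have := hp.1 (- x) x; rewrite addNr (sublinear0 hp); lra.
Qed.

(** For sublinear [p], the largest sublinear functional below [p] whose value at [- d] is at most
    [- p d]. A linear functional below it therefore agrees with [p] at [d]. *)
Definition push p d x : R := infr [set t : R | 0 <= t] (fun t => p (x + t *: d) - t * p d).

Lemma push_lb p d x t : sublinear p -> 0 <= t -> - p (- x) <= p (x + t *: d) - t * p d.
Proof.
move=> hp t0; have := hp.1 (x + t *: d) (- x).
by rewrite addrAC subrr add0r hp.2//; lra.
Qed.

Lemma push_le p d x t : sublinear p -> 0 <= t -> push p d x <= p (x + t *: d) - t * p d.
Proof.
move=> hp t0; apply: (@infr_le _ _ [set t : R | 0 <= t] _ (- p (- x)) t) => //.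
by move=> s s0; exact: push_lb.
Qed.

Lemma push_le0 p d x : sublinear p -> push p d x <= p x.
Proof.
by move=> hp; have := push_le d x hp (lexx 0); rewrite scale0r addr0 mul0r subr0.
Qed.

Lemma push_adh p d x e : sublinear p -> 0 < e ->
  exists2 t, 0 <= t & p (x + t *: d) - t * p d < push p d x + e.
Proof.
move=> hp e0; apply: (@infr_adh _ _ [set t : R | 0 <= t] _ (- p (- x)) 0) => //=.
by move=> t /= t0; exact: push_lb.
Qed.

Lemma push_sublinear p d : sublinear p -> sublinear (push p d).
Proof.
move=> hp; have addp x y : push p d (x + y) <= push p d x + push p d y.
  apply/ler_addgt0Pr => e e0; have e2 : 0 < e / 2 by lra.
  have [t t0 ht] := push_adh d x hp e2; have [s s0 hs] := push_adh d y hp e2.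
  have := push_le d (x + y) hp (addr_ge0 t0 s0); rewrite scalerDl addrACA.
  by have := hp.1 (x + t *: d) (y + s *: d); lra.
have pos (a : R) x : 0 < a -> push p d (a *: x) <= a * push p d x.
  move=> a0; apply/ler_addgt0Pr => e e0; have e2 : 0 < e / a by rewrite divr_gt0.
  have [t t0 ht] := push_adh d x hp e2.
  have at0 : 0 <= a * t by rewrite mulr_ge0// ltW.
  have := push_le d (a *: x) hp at0; rewrite -scalerA -scalerDr hp.2 ?(ltW a0)//.
  have ea : a * (e / a) = e by rewrite mulrCA divff ?gt_eqF ?mulr1.
  by move: ht; rewrite -(ltr_pM2l a0) [X in _ < X]mulrDr ea; lra.
split=> // a x; rewrite le_eqVlt => /orP[/eqP<-|a0].
  rewrite scale0r mul0r; apply/eqP; rewrite eq_le; apply/andP; split.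
    by have := push_le0 d 0 hp; rewrite (sublinear0 hp).
  apply: (infr_ge (t0 := 0)) => //= t t0.
  by rewrite add0r hp.2// subrr.
apply/eqP; rewrite eq_le pos//= -ler_pdivlMl//.
rewrite -{1}(scale1r x) -(mulVf (lt0r_neq0 a0)) -scalerA.
by apply: pos; rewrite invr_gt0.
Qed.

(* A pointwise minimal sublinear functional is linear: it coincides with each
   of its pushes. *)
Lemma hahn_banach p (d : X) : sublinear p ->
  exists f : X -> R, [/\ forall (a : R) x y, f (a *: x + y) = a * f x + f y,
    forall x, f x <= p x & f d = p d].
Proof.
move=> hp; pose p' := push p d; have hp' : sublinear p' by exact: push_sublinear.
pose T := {q : X -> R | sublinear q /\ forall x, q x <= p' x}.
(* The order is reversed, so that the maximal element given by Zorn's lemma is a pointwise minimal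
   functional. *)
pose le : rel T := fun q1 q2 : T => `[< forall x, sval q2 x <= sval q1 x >].
have q_ge (q : T) x : - p' (- x) <= sval q x.
  by case: q => q /= [hq qp]; have := sublinear_ge x hq; have := qp (- x); lra.
have [|||A tA|[f [hf fp]] fmin] := @Zorn T le.
- by move=> q; apply/asboolP.
- by move=> r q s /asboolP h1 /asboolP h2; apply/asboolP => x; exact: le_trans (h2 x) (h1 x).
- move=> [q hq] [r hr] /asboolP h1 /asboolP h2; apply: eq_exist; apply/funext => x.
  by apply/eqP; rewrite eq_le; apply/andP; split; [exact: h2|exact: h1].
- have [->|/set0P[q0 Aq0]] := eqVneq A set0.
    by exists (exist _ p' (conj hp' (fun x => lexx _))).
  (* The infimum of a chain is subadditive because two near-optimal members are comparable, and the
     smaller one serves both points. *)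
  pose r x := infr A (fun q : T => sval q x).
  have rle (q : T) x : A q -> r x <= sval q x.
    by move=> Aq; apply: (@infr_le _ _ A (fun q : T => sval q x) (- p' (- x)) q _ Aq) => s _; exact: q_ge.
  have radh x e : 0 < e -> exists2 q : T, A q & sval q x < r x + e.
    by move=> e0; apply: (infr_adh (M := - p' (- x)) Aq0) => // s _; exact: q_ge.
  have hr : sublinear r.
    split=> [x y|a x a0].
      apply/ler_addgt0Pr => e e0; have e2 : 0 < e / 2 by lra.
      have [q Aq hq] := radh x _ e2; have [s As hs] := radh y _ e2.
      have [/asboolP h|/asboolP h] := tA _ _ Aq As.
        have := rle s (x + y) As; have := (svalP s).1.1 x y; have := h x; lra.
      have := rle q (x + y) Aq; have := (svalP q).1.1 x y; have := h y; lra.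
    apply/eqP; rewrite eq_le; apply/andP; split; last first.
      apply: (infr_ge Aq0) => q Aq; rewrite (svalP q).1.2//.
      by apply: ler_wpM2l => //; exact: rle.
    move: a0; rewrite [X in is_true X -> _]le_eqVlt => /orP[/eqP<-|a0].
      rewrite scale0r mul0r; have := rle q0 0 Aq0.
      by rewrite (sublinear0 (svalP q0).1).
    rewrite mulrC -ler_pdivrMr//; apply: (infr_ge Aq0) => q Aq.
    rewrite ler_pdivrMr// mulrC -(svalP q).1.2 ?(ltW a0)//; exact: rle.
  have rp x : r x <= p' x by apply: le_trans (rle q0 x Aq0) _; exact: (svalP q0).2.
  by exists (exist _ r (conj hr rp)) => s As; apply/asboolP => x /=; exact: rle.
(* Minimality forces [push f e = f]; taking $t = 1$ in the infimum gives $f(x) + f(e) \le f(x +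
   e)$. *)
have fpush e x : f (x + e) = f x + f e.
  have pf y : push f e y <= p' y by apply: le_trans (push_le0 e y hf) (fp y).
  have /(f_equal sval)/= pfE := fmin
    (exist _ (push f e) (conj (push_sublinear e hf) pf)) (introT (asboolP _) (fun x => push_le0 e x hf)).
  have := push_le e x hf (@ler01 R); rewrite pfE scale1r mul1r.
  by have := hf.1 x e; lra.
have fN x : f (- x) = - f x.
  by have := fpush x (- x); rewrite addNr (sublinear0 hf); lra.
have fZ (a : R) x : f (a *: x) = a * f x.
  have [a0|a0] := leP 0 a; first exact: hf.2.
  by rewrite -[a]opprK scaleNr fN hf.2 ?mulNr// oppr_ge0 ltW.
have fle x : f x <= p x by apply: le_trans (fp x) _; exact: push_le0.
exists f; split=> [a x y|//|]; first by rewrite fpush fZ.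
apply/eqP; rewrite eq_le fle/= -lerN2 -fN.
apply: le_trans (fp _) _; have := push_le d (- d) hp ler01.
by rewrite scale1r mul1r addNr (sublinear0 hp) sub0r.
Qed.

End HahnBanach.

(** * Weak countable determination *)

Section Subspaces.
Context {R : realType} {X : normedModType R}.
Implicit Types (A V : set X) (f : topdual X).

Definition adherent A (x : X) := forall e : R, 0 < e -> exists2 a, A a & `|x - a| < e.

Definition closed_subspace V :=
  [/\ V 0, forall (a : R) x y, V x -> V y -> V (a *: x + y)
    & forall x, adherent V x -> V x].

Lemma adherent_sub A x : A x -> adherent A x.
Proof. by move=> Ax e e0; exists x; rewrite // subrr normr0. Qed.

Lemma adherentS A B x : A `<=` B -> adherent A x -> adherent B x.
Proof. by move=> AB Ax e /Ax[a Aa ?]; exists a => //; exact: AB. Qed.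

Lemma adherentK A x : adherent (adherent A) x -> adherent A x.
Proof.
move=> Ax e e0; have e2 : 0 < e / 2 by lra.
have [y /(_ _ e2)[a Aa ya] xy] := Ax _ e2; exists a => //.
by have := ler_distD y x a; lra.
Qed.

Lemma subspaceD V x y : closed_subspace V -> V x -> V y -> V (x + y).
Proof. by move=> [_ VD _] Vx Vy; rewrite -[x]scale1r; exact: VD. Qed.

Lemma subspaceZ V (a : R) x : closed_subspace V -> V x -> V (a *: x).
Proof. by move=> [V0 VD _] Vx; rewrite -[_ *: _]addr0; exact: VD. Qed.

Lemma subspaceB V x y : closed_subspace V -> V x -> V y -> V (x - y).
Proof. by move=> [_ VD _] Vx Vy; rewrite addrC -scaleN1r; exact: VD. Qed.

Lemma bounded_dual (f : X -> R) (C : R) :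
  (forall (a : R) x y, f (a *: x + y) = a * f x + f y) ->
  (forall x, `|f x| <= C * `|x|) -> exists F : topdual X, forall x, F x = f x.
Proof.
move=> lf fC; have lf' : linear (f : X -> R^o) by [].
pose e : {linear X -> R^o} := HB.pack (f : X -> R^o)
  (GRing.isLinear.Build R X R^o *:%R _ lf').
have cf : continuous (f : X -> R^o).
  apply: (@bounded_linear_continuous _ _ _ e); apply/bounded_funP => r.
  exists (`|C| * r) => x xr; apply: (le_trans (fC x)).
  apply: (@le_trans _ _ (`|C| * `|x|)); first by rewrite ler_wpM2r// ler_norm.
  by rewrite ler_wpM2l.
have fP : (f : X -> R^o) \in dual_pred X by apply: mem_set.
by exists (Dual fP).
Qed.

Lemma dualD f x y : f (x + y) = f x + f y.
Proof. by rewrite linearD. Qed.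
Lemma dualZ f (a : R) x : f (a *: x) = a * f x.
Proof. by rewrite linearZ. Qed.
Lemma dualB f x y : f (x - y) = f x - f y.
Proof. by rewrite linearB. Qed.
Lemma dualN f x : f (- x) = - f x.
Proof. by rewrite linearN. Qed.
Lemma dual0 f : f 0 = 0.
Proof. by rewrite linear0. Qed.

Lemma dual_dominated (p : X -> R) (C : R) d : sublinear p ->
  (forall x, p x <= C * `|x|) -> exists2 f : topdual X, forall x, f x <= p x & f d = p d.
Proof.
move=> hp pC; have [f [lf fp fd]] := hahn_banach d hp.
have [|F FE] := bounded_dual lf (C := C).
  move=> x; rewrite ler_norml; apply/andP; split; last exact: le_trans (fp x) (pC x).
  have : f (- x) <= C * `|- x| by apply: le_trans (fp _) (pC _).
  have := lf (-1) x 0; have := lf 1 0 0; rewrite normrN scaleN1r scale1r !addr0; lra.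
by exists F => [x|]; rewrite FE.
Qed.

Lemma norming_functional (x : X) :
  exists2 f : topdual X, f x = `|x| & forall z, `|f z| <= `|z|.
Proof.
have [||f fp fx] := @dual_dominated (fun z => `|z|) 1 x.
- by split=> [y z|a z a0]; [exact: ler_normD|rewrite normrZ ger0_norm].
- by move=> z; rewrite mul1r.
exists f => // z; rewrite ler_norml fp andbT.
by have := fp (- z); rewrite normrN dualN; lra.
Qed.

Definition seminorm (N : X -> R) :=
  (forall x y, N (x + y) <= N x + N y) /\ forall (a : R) x, N (a *: x) = `|a| * N x.

Lemma seminorm_sublinear N : seminorm N -> sublinear N.
Proof. by move=> [ND NZ]; split=> // a x a0; rewrite NZ ger0_norm. Qed.

Definition dist V z := infr V (fun v => `|z - v|).

Lemma dist_le V z v : V v -> dist V z <= `|z - v|.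
Proof. by move=> Vv; apply: (@infr_le _ _ _ (fun v => `|z - v|) 0). Qed.

Lemma dist_adh V z (e : R) : V 0 -> 0 < e -> exists2 v, V v & `|z - v| < dist V z + e.
Proof. by move=> V0 e0; apply: (infr_adh V0 (M := 0)). Qed.

Lemma dist_ge0 V z : V 0 -> 0 <= dist V z.
Proof. by move=> V0; apply: (infr_ge V0). Qed.

Lemma dist_seminorm V : V 0 -> (forall (a : R) x y, V x -> V y -> V (a *: x + y)) ->
  seminorm (dist V).
Proof.
move=> V0 VD; have VZ (a : R) v : V v -> V (a *: v).
  by move=> Vv; rewrite -[_ *: _]addr0; exact: VD.
split=> [y z|a z].
  apply/ler_addgt0Pr => e e0; have e2 : 0 < e / 2 by lra.
  have [u Vu hu] := dist_adh y V0 e2; have [v Vv hv] := dist_adh z V0 e2.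
  have Vuv : V (u + v) by rewrite -[u]scale1r; exact: VD.
  have := dist_le (y + z) Vuv; rewrite opprD addrACA.
  by have := ler_normD (y - u) (z - v); lra.
have [->|a0] := eqVneq a 0.
  rewrite scale0r normr0 mul0r; apply/eqP; rewrite eq_le dist_ge0// andbT.
  by have := dist_le 0 V0; rewrite subr0 normr0.
have a1 : 0 < `|a| by rewrite normr_gt0.
apply/eqP; rewrite eq_le; apply/andP; split.
  rewrite mulrC -ler_pdivrMr//; apply: (infr_ge V0) => v Vv.
  have -> : `|z - v| = `|a *: z - a *: v| / `|a|.
    by rewrite -scalerBr normrZ mulrAC divff ?mul1r// gt_eqF.
  by rewrite ler_pM2r ?invr_gt0//; apply: dist_le; exact: VZ.
apply: (infr_ge V0) => v Vv; rewrite -ler_pdivlMl//.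
have -> : `|a|^-1 * `|a *: z - v| = `|z - a^-1 *: v|.
  by rewrite -normfV -normrZ scalerBr scalerA mulVf// scale1r.
by apply: dist_le; exact: VZ.
Qed.

(** A functional dominated by the distance to [V] vanishes on [V], and it can be chosen to attain
    the distance at [x], which is positive because [V] is closed. *)
Lemma separating_functional V x : closed_subspace V -> ~ V x ->
  exists2 f : topdual X, forall v, V v -> f v = 0 & f x != 0.
Proof.
move=> [V0 VD Vcl] nVx.
have hp := dist_seminorm V0 VD.
have [|f fp fx] := @dual_dominated (dist V) 1 x (seminorm_sublinear hp).
  by move=> z; rewrite mul1r -[z in `|z|]subr0; exact: dist_le.
exists f => [v Vv|].
  have dv : dist V v <= 0 by have := dist_le v Vv; rewrite subrr normr0.
  have := fp v; have := fp (- v); rewrite -scaleN1r hp.2 normrN1 mul1r scaleN1r dualN.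
  by move=> h1 h2; apply/eqP; rewrite eq_le; apply/andP; split; lra.
rewrite fx; apply/eqP => p0; apply: nVx; apply: Vcl => e e0.
by have [v Vv] := dist_adh x V0 e0; rewrite p0 add0r => ?; exists v.
Qed.

End Subspaces.

(** * Weak limits along ultrafilters *)

Section WeakPoints.
Context {R : realType} {X : normedModType R}.

Definition weak_limit (U : set_system X) (y : X) :=
  forall (f : topdual X) (e : R), 0 < e -> U [set z | `|(f z : R) - f y| < e].

(* This is all that the renorming needs from weak countable determination. *)
Definition determining (C : nat -> set X) :=
  forall (x : X) (U : set_system X), UltraFilter U ->
    (exists B : R, U [set z | `|z| <= B]) -> (forall i, C i x -> U (C i)) ->
    exists y, weak_limit U y.

(** Compactness of $[-B, B]$ gives a cluster point, and an ultrafilter converges to its cluster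
    points. *)
Lemma ultra_limit (T : Type) (U : set_system T) (f : T -> R) (B : R) : UltraFilter U ->
  U [set z | `|f z| <= B] ->
  exists r : R, forall e : R, 0 < e -> U [set z | `|f z - r| < e].
Proof.
move=> UU fB.
have [r [_ rcl]] : `[- B, B] `&` cluster (f @ U) !=set0.
  have cB : compact (`[- B, B] : set R) by exact: segment_compact.
  apply: (cB (f @ U) _).
  suff: U (f @^-1` `[- B, B]) by [].
  by apply: (filterS _ fB) => z /=; rewrite in_itv/= -ler_norml.
exists r => e e0; have [//|nU] := in_ultra_setVsetC [set z | `|f z - r| < e] UU.
have [s [/= hs]] := rcl _ (ball r e)
  (nU : (f @ U) [set s | ~ `|s - r| < e]) (nbhsx_ballx r e e0).
by rewrite /ball/= distrC.
Qed.

(** The limits along [U] of all functionals define an element [v] of the bidual. It lies in every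
    [K n] that contains [x], by compactness, so the separation property of the [K n] leaves it no
    place outside $X$. *)
Lemma wcd_determining : weakly_countably_determined X ->
  exists C : nat -> set X, determining C.
Proof.
move=> [K [Kc Ksep]]; exists (fun n => evaluation @^-1` K n).
move=> x U UU [B UB] CU.
have /choice[u uP] : forall f : topdual X, exists r : R,
    forall e : R, 0 < e -> U [set z | `|f z - r| < e].
  move=> f; apply: (@ultra_limit _ _ _ (dual_norm f * B)).
  apply: filterS UB => z /= zB; apply: le_trans (dual_normP f z) _.
  by apply: ler_wpM2l => //; exact: dual_norm_ge0.
have uniq_lim (r s : R) : (forall e : R, 0 < e -> `|r - s| < e) -> r = s.
  move=> h; apply/eqP; rewrite -subr_eq0 -normr_le0; apply/ler_addgt0Pr => e /h.
  by rewrite add0r => /ltW.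
have lu (a : R) (f g : topdual X) : u (a *: f + g) = a * u f + u g.
  apply: uniq_lim => e e0.
  have a1 : 0 < `|a| + 1 by rewrite ltr_wpDl.
  have d0 : 0 < e / 3 / (`|a| + 1) by rewrite !divr_gt0.
  have e3 : 0 < e / 3 by lra.
  have [z [[/= h1 h2] h3]] := @filter_ex _ U _ _ (filterI (filterI (uP f _ d0)
    (uP g _ e3)) (uP (a *: f + g) _ e3)).
  have {}h1 : `|a| * `|f z - u f| <= e / 3.
    rewrite ltr_pdivlMr// in h1; apply: le_trans (ltW h1).
    by rewrite mulrC ler_wpM2l// lerDl.
  rewrite -normrM mulrBr in h1.
  have {}h3 : `|a * f z + g z - u (a *: f + g)| < e / 3 by exact: h3.
  have {}h2 : `|g z - u g| < e / 3 by exact: h2.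
  have -> : u (a *: f + g) - (a * u f + u g) = (a * f z - a * u f) + (g z - u g)
     - (a * f z + g z - u (a *: f + g)) by ring.
  apply: le_lt_trans (ler_normB _ _) _.
  by have := ler_normD (a * f z - a * u f) (g z - u g); lra.
have [|v vE] := bounded_dual lu (C := `|B|).
  move=> f; apply/ler_addgt0Pr => e e0.
  have [z [/= h1 h2]] := @filter_ex _ U _ _ (filterI (uP f _ e0) UB).
  have : `|f z| <= `|B| * `|f|.
    rewrite mulrC; apply: le_trans (dual_normP f z) _.
    apply: ler_wpM2l; first exact: dual_norm_ge0.
    exact: le_trans h2 (ler_norm _).
  have := ler_normD (f z) (u f - f z); rewrite addrC subrK distrC; lra.
(* The compact set [K n] contains a cluster point of [U] in the weak-star topology; since all
   functionals converge along [U], this point is [v]. *)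
have vK n : K n (evaluation x) -> K n v.
  move=> /CU UC.
  have [w [Kw wcl]] := Kc n (evaluation @ U) _ UC.
  suff -> : v = w by [].
  apply/val_inj/funext => f /=; rewrite vE; apply: uniq_lim => e e0.
  have e2 : 0 < e / 2 by lra.
  have nw : nbhs (w : weak_star (topdual X)) [set w' | `|w' f - w f| < e / 2].
    have cw : (fun w' : weak_star (topdual X) => (w' : topdual (topdual X)) f : R) @ w --> w f.
      apply: (@cvg_comp _ _ _ (fun w' : weak_star (topdual X) =>
        ((w' : topdual (topdual X)) : topdual X -> R^o) : {ptws topdual X -> R^o})
        (fun h : {ptws topdual X -> R^o} => h f)).
        exact: initial_continuous.
      exact: (@proj_continuous _ (fun=> R^o) f).
    apply: (cw [set r | `|r - w f| < e / 2]).
    by apply/nbhs_ballP; exists (e / 2) => //= r; rewrite /ball/= distrC.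
  have [w' [/= h1 h2]] := wcl _ _ (uP f _ e2 : (evaluation @ U) [set w' | `|w' f - u f| < e/2]) nw.
  by have := ler_distD (w' f) (u f) (w f); rewrite (distrC (u f) (w' f)); lra.
have [[y _ yv]|nv] := pselect (range evaluation v).
  exists y => f e e0; have := uP f _ e0.
  by rewrite -vE -yv.
by have [n [Kx nK]] := Ksep x v nv; case: nK; exact: vK.
Qed.

End WeakPoints.

(** * Norm-one projections *)

Section Auxiliary.
Context {R : realType}.

Lemma ex_invn (e : R) : 0 < e -> exists n, n.+1%:R^-1 < e.
Proof.
move=> e0; exists (Num.truncn e^-1).
by rewrite invf_plt ?posrE ?ltr0Sn// truncnS_gt.
Qed.

Lemma ex_natge (x : R) : exists n, x <= n%:R.
Proof. by exists (Num.truncn x).+1; rewrite ltW// truncnS_gt. Qed.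

Lemma ex_ratr (x e : R) : 0 < e -> exists q, `|x - ratr q| < e.
Proof.
move=> e0; have [|q] := @rat_in_itvoo R (x - e) (x + e); first by lra.
by rewrite in_itv/= => /andP[h1 h2]; exists q; rewrite ltr_norml; apply/andP; split; lra.
Qed.

Lemma eq_small (r s : R) : (forall e : R, 0 < e -> `|r - s| < e) -> r = s.
Proof.
move=> h; apply/eqP; rewrite -subr_eq0 -normr_le0; apply/ler_addgt0Pr => e /h.
by rewrite add0r => /ltW.
Qed.

Lemma ltr_dist (a b c d1 d2 : R) :
  `|b - a| < d1 -> `|b - c| < d2 -> `|a - c| < d1 + d2.
Proof. by move=> h1 h2; have := ler_distD b a c; rewrite (distrC a b); lra. Qed.

Lemma le0_small (r K : R) : 0 <= K -> (forall e : R, 0 < e -> r <= K * e) -> r <= 0.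
Proof.
move=> K0 h; apply/ler_addgt0Pr => e e0; rewrite add0r.
have K1 : 0 < K + 1 by lra.
apply: le_trans (h (e / (K + 1)) _) _; first exact: divr_gt0.
by rewrite mulrA ler_pdivrMr// mulrC ler_pM2l//; lra.
Qed.

End Auxiliary.

Section Projections.
Context {R : realType} {X : normedModType R}.
Implicit Types (M Z A V : set X).

(** Rational coefficients only, so that countably many operations generate such a set; the closure
    is a real subspace by [adherent_rational]. *)
Definition rational_subspace M :=
  M 0 /\ forall (r : rat) x y, M x -> M y -> M (ratr r *: x + y).

Lemma adherent_rational M : rational_subspace M -> closed_subspace (adherent M).
Proof.
move=> [M0 MD]; split; [exact: adherent_sub| |by move=> x; exact: adherentK].
move=> a x y Mx My e e0.
have x1 : 0 < `|x| + 1 by rewrite ltr_wpDl.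
have a1 : 0 < `|a| + 1 by rewrite ltr_wpDl.
have e3 : 0 < e / 3 by lra.
have [r hr] := ex_ratr a (divr_gt0 e3 x1).
have h1 : 0 < Num.min 1 (e / 3 / (`|a| + 1)) by rewrite lt_min ltr01 divr_gt0.
have [m Mm hm] := Mx _ h1; have [m' Mm' hm'] := My _ e3.
exists (ratr r *: m + m'); first exact: MD.
have -> : a *: x + y - (ratr r *: m + m') =
    a *: (x - m) + (a - ratr r) *: m + (y - m').
  by rewrite scalerBr scalerBl [X in _ = X + _]addrA subrK opprD addrACA.
rewrite lt_min in hm; case/andP: hm => hm1 hm2.
have h2 : `|a *: (x - m)| <= e / 3.
  rewrite normrZ; rewrite ltr_pdivlMr// mulrC in hm2; apply: le_trans (ltW hm2).
  by rewrite ler_wpM2r// lerDl.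
have h3 : `|(a - ratr r) *: m| <= e / 3.
  rewrite normrZ; rewrite ltr_pdivlMr// in hr; apply: le_trans (ltW hr).
  rewrite ler_wpM2l//; have := ler_normD x (m - x).
  by rewrite addrC subrK distrC; lra.
apply: le_lt_trans (ler_normD _ _) _.
by have := ler_normD (a *: (x - m)) ((a - ratr r) *: m); lra.
Qed.

Definition nu (x : X) : topdual X := s2val (cid2 (norming_functional x)).

Lemma nuE x : nu x x = `|x|.
Proof. by rewrite /nu; case: (cid2 _). Qed.

Lemma nu_le x z : `|nu x z| <= `|z|.
Proof. by rewrite /nu; case: (cid2 _). Qed.

Lemma norm_le_nu M x (c : R) : adherent M x ->
  (forall m, M m -> nu m x <= c) -> `|x| <= c.
Proof.
move=> Mx h; apply/ler_addgt0Pr => e e0; have e2 : 0 < e / 2 by lra.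
have [m Mm hm] := Mx _ e2.
have := nuE m; have := dualB (nu m) m x; have := ler_norm (nu m (m - x)).
have := nu_le m (m - x); rewrite distrC; have := h _ Mm.
by have := ler_normD m (x - m); rewrite addrC subrK; lra.
Qed.

Lemma nu_eq0 M x : adherent M x -> (forall m, M m -> nu m x = 0) -> x = 0.
Proof.
by move=> Mx h; apply/eqP; rewrite -normr_le0 (norm_le_nu Mx)// => m /h->.
Qed.

Variable C : nat -> set X.

(** A basic weak neighbourhood with rational centres: apart from the points listed in [ws], all data
    range over a countable set. *)
Definition proximity (ws : seq (X * rat)) n (l : seq nat) (b : nat) (z : X) :=
  [/\ forall p, p \in ws -> `|(nu p.1 z : R) - ratr p.2| < n.+1%:R^-1,
      forall i, i \in l -> C i z & `|z| <= b%:R].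

(** A closure condition in the style of Loewenheim and Skolem. It makes the closure of [M] the range
    of a norm-one projection defined on [Z]. *)
Definition reflecting Z M :=
  [/\ M `<=` Z, rational_subspace M & forall ws n l b,
    (forall p, p \in ws -> M p.1) -> (exists2 z, Z z & proximity ws n l b z) ->
    exists2 z, M z & proximity ws n l b z].

Definition proj M x := xget 0 [set y | adherent M y /\ forall m, M m -> nu m y = nu m x].

Hypothesis CX : determining C.

(** By reflection, [M] contains points of bounded norm that agree approximately with [x] on any
    finitely many [nu m] and lie in any finitely many of the sets [C i] containing [x]. An
    ultrafilter on such points has a weak limit because [C] is determining, and this limit is the
    projection of [x]. *)
Lemma projP Z M x : reflecting Z M -> Z x ->
  adherent M (proj M x) /\ forall m, M m -> nu m (proj M x) = nu m x.
Proof.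
move=> [MZ Ml hM] Zx.
suff [y hy] : exists y, adherent M y /\ forall m, M m -> nu m y = nu m x.
  exact: (@xgetI _ 0 [set y | adherent M y /\ forall m, M m -> nu m y = nu m x] y hy).
have [b xb] := ex_natge `|x|.
pose D : set (seq X * nat * seq nat) :=
  [set p : seq X * nat * seq nat | (forall m, m \in p.1.1 -> M m) /\ forall i, i \in p.2 -> C i x].
pose B (p : seq X * nat * seq nat) : set X :=
  [set z | [/\ M z, `|z| <= b%:R, forall m, m \in p.1.1 -> `|(nu m z : R) - nu m x| < p.1.2.+1%:R^-1
    & forall i, i \in p.2 -> C i z]].
have FF : ProperFilter (filter_from D B).
  apply: filter_from_proper.
    apply: filter_from_filter; first by exists ([::], 0%N, [::]).
    move=> [[ms n] l] [[ms' n'] l'] [/= h1 h2] [/= h3 h4].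
    exists (ms ++ ms', maxn n n', l ++ l').
      by split => /= [m|i]; rewrite mem_cat => /orP[]; auto.
    move=> z [/= Mz zb h5 h6].
    have lt_inv k k' (r : R) : (k <= k')%N -> r < k'.+1%:R^-1 -> r < k.+1%:R^-1.
      move=> kk h; apply: lt_le_trans h _.
      by rewrite lef_pV2 ?posrE ?ltr0Sn// ler_nat ltnS.
    split; split=> //= [m hm|i hi].
    - by apply: lt_inv (leq_maxl n n') _; apply: h5; rewrite mem_cat hm.
    - by apply: h6; rewrite mem_cat hi.
    - by apply: lt_inv (leq_maxr n n') _; apply: h5; rewrite mem_cat hm orbT.
    - by apply: h6; rewrite mem_cat hi orbT.
  move=> [[ms n] l] [/= msM lC].
  (* Half of the tolerance is spent on the rational centres and half on the proximity; the precision
     index [n + n.+1] used below corresponds to $2(n+1)$. *)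
  pose d : R := (n.+1 + n.+1)%:R^-1.
  have d0 : 0 < d by rewrite invr_gt0 ltr0n.
  have d2 : d + d = n.+1%:R^-1.
    have h2 : (2 : R)^-1 + 2^-1 = 1 by lra.
    have -> : d = n.+1%:R^-1 * 2^-1 by rewrite -invfM mulr_natr mulr2n -natrD.
    by rewrite -mulrDr h2 mulr1.
  have /choice[q hq] : forall m, exists q, `|nu m x - ratr q| < d.
    by move=> m; exact: ex_ratr.
  have [||z Mz [h1 h2 h3]] := hM [seq (m, q m) | m <- ms] (n + n.+1)%N l b.
  - by move=> _ /mapP[m hm ->]; exact: msM.
  - exists x => //; split=> // _ /mapP[m hm ->] /=.
    by rewrite -addSn; exact: hq.
  exists z; split=> //= m hm.
  have := h1 (m, q m) (map_f _ hm); rewrite /= -addSn -/d.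
  have := hq m; rewrite -d2 distrC => h4 h5.
  by have := ler_distD (ratr (q m)) (nu m z) (nu m x); lra.
have [U [UU FU]] := ultraFilterLemma FF.
have UB p : D p -> U (B p) by move=> Dp; apply: FU; exists p.
have D0 : D ([::], 0%N, [::]) by [].
have [||y hy] := @CX x U UU.
- by exists b%:R; apply: (@filterS _ U _ _ _ _ (UB _ D0)) => z [].
- move=> i Cix; have Di : D ([::], 0%N, [:: i]).
    by split=> // j /=; rewrite inE => /eqP->.
  by apply: (@filterS _ U _ _ _ _ (UB _ Di)) => z [_ _ _]; apply; rewrite inE.
exists y; split.
  (* A closed subspace contains the weak limits of its points, by Hahn-Banach. *)
  apply: contrapT => nMy.
  have [f f0 fy] := separating_functional (adherent_rational Ml) nMy.
  have fy0 : 0 < `|f y| by rewrite normr_gt0.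
  have [z [[Mz _ _ _] /=]] := @filter_ex _ U _ _ (filterI (UB _ D0) (hy f _ fy0)).
  by rewrite f0 ?sub0r ?normrN ?ltxx//; exact: adherent_sub.
move=> m Mm; apply: eq_small => e e0; have e2 : 0 < e / 2 by lra.
have [n hn] := ex_invn e2.
have Dm : D ([:: m], n, [::]) by split=> // m' /=; rewrite inE => /eqP->.
have [z [[_ _ /(_ m) h1 _] /= h2]] := @filter_ex _ U _ _ (filterI (UB _ Dm) (hy (nu m) _ e2)).
have := h1 (mem_head _ _); rewrite /=.
by move=> h3; rewrite [e]splitr; exact: ltr_dist h2 (lt_trans h3 hn).
Qed.

(** The functionals [nu m] norm the closure of [M], hence separate its points. Linearity of the
    projections and their compatibility for nested sets rest on this uniqueness. *)
Lemma proj_uniq Z M x y : reflecting Z M -> Z x -> adherent M y ->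
  (forall m, M m -> nu m y = nu m x) -> proj M x = y.
Proof.
move=> hM Zx My h; have [MP hP] := projP hM Zx.
have hV : closed_subspace (adherent M) by case: hM => _ /adherent_rational.
apply/eqP; rewrite -subr_eq0; apply/eqP; apply: (@nu_eq0 M).
  exact: (subspaceB hV MP My).
by move=> m Mm; rewrite dualB hP// h// subrr.
Qed.

Lemma proj_id Z M x : reflecting Z M -> Z x -> adherent M x -> proj M x = x.
Proof. by move=> hM Zx Mx; exact: proj_uniq hM Zx Mx _. Qed.

Lemma proj_in Z M x : closed_subspace Z -> reflecting Z M -> Z x -> Z (proj M x).
Proof.
move=> [_ _ hZ] hM Zx; apply: hZ; have [Mp _] := projP hM Zx.
by case: hM => MZ _ _; exact: adherentS Mp.
Qed.

Lemma projL Z M (a : R) x y : closed_subspace Z -> reflecting Z M -> Z x -> Z y ->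
  proj M (a *: x + y) = a *: proj M x + proj M y.
Proof.
move=> hZ hM Zx Zy; have [Mx nx] := projP hM Zx; have [My ny] := projP hM Zy.
have Zxy : Z (a *: x + y) by case: hZ => _ ZD _; exact: ZD.
apply: (proj_uniq hM Zxy).
  by case: hM => _ /adherent_rational[_ + _] _; apply.
by move=> m Mm; rewrite !dualD !dualZ nx// ny.
Qed.

Lemma proj_norm Z M x : reflecting Z M -> Z x -> `|proj M x| <= `|x|.
Proof.
move=> hM Zx; have [Mx nx] := projP hM Zx; apply: (norm_le_nu Mx) => m Mm.
by rewrite nx//; apply: le_trans (ler_norm _) (nu_le m x).
Qed.

Lemma projKl Z M M' x : closed_subspace Z -> reflecting Z M -> reflecting Z M' -> M `<=` M' -> Z x ->
  proj M (proj M' x) = proj M x.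
Proof.
move=> hZ hM hM' MM' Zx; have [Mx nx] := projP hM Zx; have [Mx' nx'] := projP hM' Zx.
apply: (proj_uniq hM _ Mx); first exact: proj_in.
by move=> m Mm; rewrite nx// nx'//; exact: MM'.
Qed.

Lemma projKr Z M M' x : closed_subspace Z -> reflecting Z M -> reflecting Z M' -> M `<=` M' -> Z x ->
  proj M' (proj M x) = proj M x.
Proof.
move=> hZ hM hM' MM' Zx; have [Mx nx] := projP hM Zx.
by apply: (proj_id hM'); [exact: proj_in|exact: adherentS Mx].
Qed.

(** The operations are Skolem functions: rational combinations, and a chosen solution in [Z] for
    each proximity requirement. Countably many suffice because the points occurring in a requirement
    are passed as arguments. The default value $0$ keeps them inside [Z]. *)
Lemma reflecting_ops Z : closed_subspace Z -> exists op : nat -> seq X -> X,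
  (forall c s, (forall x, x \in s -> Z x) -> Z (op c s)) /\
  (forall M, M `<=` Z -> (forall c s, (forall x, x \in s -> M x) -> M (op c s)) ->
    reflecting Z M).
Proof.
move=> hZ; have [Z0 ZD Zcl] := hZ.
pose code : countType := (rat + seq rat * nat * seq nat * nat)%type.
pose op (c : nat) (s : seq X) : X :=
  match @choice.unpickle code c with
  | Some (inl r) => ratr r *: nth 0 s 0 + nth 0 s 1
  | Some (inr (q, n, l, b)) => xget 0 [set z | Z z /\ proximity (zip s q) n l b z]
  | None => 0
  end.
have memn s P i : P 0 -> (forall x, x \in s -> P x) -> P (nth (0 : X) s i).
  move=> P0 h; have [hi|hi] := ltnP i (size s); first exact/h/mem_nth.
  by rewrite nth_default.
exists op; split=> [c s sZ|M MZ hM].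
  rewrite /op; case: choice.unpickle => [[r|[[[q n] l] b]]|//].
    by apply: ZD; exact: memn.
  by case: xgetP => [y _ []|].
have opl r s : op (@choice.pickle code (inl r)) s = ratr r *: nth 0 s 0 + nth 0 s 1.
  by rewrite /op (@choice.pickleK code).
have M0 : M 0.
  have : M (op (@choice.pickle code (inl 0)) [::]) by apply: hM.
  by rewrite opl /= scaler0 add0r.
split=> //.
  split=> // r x y Mx My.
  have : M (op (@choice.pickle code (inl r)) [:: x; y]).
    by apply: hM => z; rewrite !inE => /orP[]/eqP->.
  by rewrite opl.
move=> ws n l b wsM [z Zz hz].
exists (op (@choice.pickle code (inr (unzip2 ws, n, l, b))) (unzip1 ws)).
  by apply: hM => _ /mapP[p hp ->]; exact: wsM.
rewrite /op (@choice.pickleK code) zip_unzip.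
by have [] := xgetI 0 (conj Zz hz : [set z | Z z /\ proximity ws n l b z] z).
Qed.

End Projections.

(** * Decomposition into countably generated blocks *)

Section WellOrder.
Variable (W : eqType).

Lemma well_order_ex : exists le : rel W,
  [/\ reflexive le, antisymmetric le, transitive le, total le
    & well_founded (fun u v => ~~ le v u)].
Proof.
have [le wo] := well_ordering_principle W.
have pick2 u v : exists2 m, m = u \/ m = v & le m u /\ le m v.
  have [|m [[Am hm] _]] := wo [pred x | (x == u) || (x == v)].
    by exists u; rewrite inE eqxx.
  exists m; first by move: Am; rewrite inE => /orP[]/eqP; auto.
  by split; apply: hm; rewrite inE eqxx ?orbT.
have lexx : reflexive le by move=> u; have [m [->|->] []] := pick2 u u.
have lea : antisymmetric le.
  move=> u v /andP[uv vu].
  have [|m [_ mu]] := wo [pred x | (x == u) || (x == v)].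
    by exists u; rewrite inE eqxx.
  rewrite -(mu u) ?(mu v)//; split; rewrite ?inE ?eqxx ?orbT//.
    by move=> x; rewrite inE => /orP[]/eqP->.
  by move=> x; rewrite inE => /orP[]/eqP->.
have let_ : total le.
  by move=> u v; have [m [->|->] [h1 h2]] := pick2 u v; rewrite ?h1 ?h2 ?orbT.
exists le; split; [exact: lexx|exact: lea| |exact: let_|].
  move=> v u w uv vw.
  have [|m [[Am hm] _]] := wo [pred x | [|| x == u, x == v | x == w]].
    by exists u; rewrite inE eqxx.
  have mu : le m u by apply: hm; rewrite inE eqxx.
  have mv : le m v by apply: hm; rewrite inE eqxx orbT.
  have mw : le m w by apply: hm; rewrite inE eqxx !orbT.
  move: Am; rewrite inE => /or3P[]/eqP Em; subst m.
  - exact: mw.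
  - by have -> : u = v by apply: lea; apply/andP.
  - by have <- : v = w by apply: lea; apply/andP.
move=> u; apply: contrapT => nu.
have [|m [[Am hm] _]] := wo [pred x | `[< ~ Acc (fun u v => ~~ le v u) x >]].
  by exists u; apply/asboolP.
move: Am => /asboolP; apply; constructor => y.
by apply: contraNP => ny; apply: hm; apply/asboolP.
Qed.

End WellOrder.

(** * Finite trees as codes for generated points *)

Section Trees.
Variable (W : eqType).
Local Notation tree := (GenTree.tree W).

Lemma tree_induction (P : tree -> Prop) : (forall w, P (GenTree.Leaf w)) ->
  (forall n ts, (forall t, t \in ts -> P t) -> P (GenTree.Node n ts)) ->
  forall t, P t.
Proof.
move=> PL PN; apply: (GenTree.tree_ind PL) => n ts h; apply: PN.
elim: ts h => [|t ts IHts] /= h u; first by rewrite in_nil.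
by case: h => h1 h2; rewrite inE => /orP[/eqP->//|]; exact: IHts.
Qed.

Fixpoint leaves_in (J : pred W) (t : tree) : bool :=
  match t with
  | GenTree.Leaf w => J w
  | GenTree.Node _ ts => all (leaves_in J) ts
  end.

Lemma leaves_inS (J J' : pred W) t : (forall w, J w -> J' w) ->
  leaves_in J t -> leaves_in J' t.
Proof.
move=> JJ'; elim/tree_induction: t => [w|n ts IH] /=; first exact: JJ'.
by move=> /allP h; apply/allP => t hts; apply: IH => //; exact: h.
Qed.

(* Removes one leaf value at the price of shifting the node labels. *)
Fixpoint hide_leaf (v : W) (t : tree) : tree :=
  match t with
  | GenTree.Leaf w => if w == v then GenTree.Node 0 [::] else t
  | GenTree.Node n ts => GenTree.Node n.+1 (map (hide_leaf v) ts)
  end.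

Fixpoint show_leaf (v : W) (t : tree) : tree :=
  match t with
  | GenTree.Leaf w => t
  | GenTree.Node 0 _ => GenTree.Leaf v
  | GenTree.Node n.+1 ts => GenTree.Node n (map (show_leaf v) ts)
  end.

(** Trees over a label set enlarged by one label can be recoded as trees over the original set. This
    takes the place of cardinal arithmetic in the transfinite induction. *)
Lemma hide_leafK v : cancel (hide_leaf v) (show_leaf v).
Proof.
elim/tree_induction => [w|n ts IH] /=; first by case: eqP => [->|].
by rewrite -map_comp map_id_in.
Qed.

Lemma leaves_in_hide (J J' : pred W) v t : (forall w, J w -> w != v -> J' w) ->
  leaves_in J t -> leaves_in J' (hide_leaf v t).
Proof.
move=> JJ'; elim/tree_induction: t => [w|n ts IH] /=.
  by case: eqP => // /eqP wv Jw; apply: JJ'.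
move=> /allP h; apply/allP => _ /mapP[t hts ->]; apply: IH => //; exact: h.
Qed.

Lemma leaves_in_show (J J' : pred W) v t : (forall w, J w -> J' w) -> J' v ->
  leaves_in J t -> leaves_in J' (show_leaf v t).
Proof.
move=> JJ' J'v; elim/tree_induction: t => [w|n ts IH] /=; first exact: JJ'.
case: n => //= n /allP h; apply/allP => _ /mapP[t hts ->]; apply: IH => //; exact: h.
Qed.

Fixpoint erase_leaves (t : tree) : GenTree.tree unit :=
  match t with
  | GenTree.Leaf w => GenTree.Leaf tt
  | GenTree.Node n ts => GenTree.Node n (map erase_leaves ts)
  end.

Fixpoint drop_leaves (t : GenTree.tree unit) : tree :=
  match t with
  | GenTree.Leaf w => GenTree.Node 0 [::]
  | GenTree.Node n ts => GenTree.Node n (map drop_leaves ts)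
  end.

(** Trees without leaves are coded by trees over [unit], so there are countably many of them; this
    makes the initial block of the decomposition a sequence. *)
Lemma drop_leavesK t : leaves_in pred0 t -> drop_leaves (erase_leaves t) = t.
Proof.
elim/tree_induction: t => [w//|n ts IH] /= /allP h.
rewrite -map_comp map_id_in// => t hts /=; apply: IH => //; exact: h.
Qed.

End Trees.

Lemma leaves_in_drop (W : eqType) (J : pred W) t : leaves_in J (drop_leaves W t).
Proof.
elim/tree_induction: t => [//|n ts IH] /=; apply/allP => _ /mapP[t hts ->].
exact: IH.
Qed.


Section Generation.
Context {R : realType} {X : normedModType R}.
Variables (W : eqType) (op : nat -> seq X -> X) (phi : GenTree.tree W -> X).

Inductive gen (J : pred W) : X -> Prop :=
| gen_base t : leaves_in J t -> gen J (phi t)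
| gen_op c s : (forall x, x \in s -> gen J x) -> gen J (op c s).

(** Label [0] marks a base point and label [n.+1] the operation [op n]. Other trees get the default
    [op 0 [::]], which belongs to every generated set. *)
Fixpoint gen_eval (t : GenTree.tree W) : X :=
  match t with
  | GenTree.Leaf _ => op 0 [::]
  | GenTree.Node 0 ts => if ts is t' :: _ then phi t' else op 0 [::]
  | GenTree.Node n.+1 ts => op n (map gen_eval ts)
  end.

Lemma genS (J J' : pred W) x : (forall w, J w -> J' w) -> gen J x -> gen J' x.
Proof.
move=> JJ'; elim=> [t ht|c s _ IH]; first exact/gen_base/(leaves_inS JJ').
exact: gen_op.
Qed.

Lemma gen_evalP (J : pred W) t : leaves_in J t -> gen J (gen_eval t).
Proof.
elim/tree_induction: t => [w _|n ts IH] /=; first exact: gen_op.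
case: n => [|n] /allP h.
  case: ts h {IH} => [_|t ts h]; first exact: gen_op.
  by apply: gen_base; apply: h; rewrite mem_head.
by apply: gen_op => _ /mapP[t hts ->]; apply: IH => //; exact: h.
Qed.

Lemma gen_small (J : pred W) x : gen J x -> exists2 t, leaves_in J t & gen_eval t = x.
Proof.
elim=> [t ht|c s _ IH]; first by exists (GenTree.Node 0 [:: t]); rewrite /= ?ht.
have [ts [hts <-]] : exists ts, all (leaves_in J) ts /\ map gen_eval ts = s.
  elim: s IH => [|y s IHs] IH; first by exists [::].
  have [|ts [h1 h2]] := IHs; first by move=> z zs; apply: IH; rewrite inE zs orbT.
  have [t ht <-] := IH y (mem_head _ _).
  by exists (t :: ts); rewrite /= ht h1 h2.
by exists (GenTree.Node c.+1 ts).
Qed.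

Lemma gen_sub (J : pred W) (Z : set X) : (forall t, leaves_in J t -> Z (phi t)) ->
  (forall c s, (forall x, x \in s -> Z x) -> Z (op c s)) -> gen J `<=` Z.
Proof. by move=> h1 h2 x; elim=> [t /h1//|c s _ IH]; exact: h2. Qed.

Variable (le : rel W).
Hypotheses (wle_refl : reflexive le) (wle_trans : transitive le) (wle_total : total le).

Lemma tree_directed (J : pred W) t : leaves_in J t ->
  leaves_in pred0 t \/ exists2 v, J v & leaves_in (le^~ v) t.
Proof.
elim/tree_induction: t => [w|n ts IH] /=; first by right; exists w.
elim: ts IH => [|t ts IHts] IH /=; first by left.
move=> /andP[ht hts].
have [|h1|[v Jv hv]] := IHts _ hts; first by move=> u hu; apply: IH; rewrite inE hu orbT.
  have [h2|[v Jv hv]] := IH t (mem_head _ _) ht; first by left; rewrite h2.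
  right; exists v => //; rewrite hv/=; apply/allP => u hu.
  by move/allP: h1 => /(_ u hu); exact: leaves_inS.
right; have [h2|[u Ju hu]] := IH t (mem_head _ _) ht.
  by exists v => //; rewrite hv andbT; exact: leaves_inS h2.
have [uv|vu] := orP (wle_total u v).
  by exists v => //; rewrite hv andbT; apply: leaves_inS hu => w wu; exact: wle_trans wu uv.
exists u => //; rewrite hu/=; apply/allP => s hs.
move/allP: hv => /(_ s hs); apply: leaves_inS => w wv; exact: wle_trans wv vu.
Qed.

(** A generated point involves finitely many labels, so either none or a largest one. This expresses
    the continuity of the increasing chain of generated sets at limit stages. *)
Lemma gen_directed (J : pred W) x : gen J x ->
  gen pred0 x \/ exists2 v, J v & gen (le^~ v) x.
Proof.
move=> /gen_small[t /tree_directed[ht|[v Jv ht]] <-]; first by left; exact: gen_evalP.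
by right; exists v => //; exact: gen_evalP.
Qed.

End Generation.

(** * Transfinite decomposition into orthogonal blocks *)

Section OrthogonalBlocks.
Context {R : realType} {X : normedModType R}.

(** The functionals are mere functions on $X$, because they are built on subspaces of $X$ and are
    linear and bounded only there. *)
Definition block := ((nat -> X) * (nat -> X -> R))%type.

Definition linear_bounded_on (Z : set X) (f : X -> R) :=
  (forall (a : R) x y, Z x -> Z y -> f (a *: x + y) = a * f x + f y) /\
  exists K : R, forall x, Z x -> `|f x| <= K * `|x|.

Record decomposition (Z : set X) (B : set block) : Prop := Decomposition {
  dec_in : forall b n, B b -> Z (b.1 n);
  dec_lin : forall b n, B b -> linear_bounded_on Z (b.2 n);
  dec_orth : forall b b' n m, B b -> B b' -> b <> b' -> b.2 n (b'.1 m) = 0;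
  dec_fund : forall V, closed_subspace V -> (forall b n, B b -> V (b.1 n)) -> Z `<=` V;
  dec_total : forall x, Z x -> (forall b n, B b -> b.2 n x = 0) -> x = 0 }.

Variable C : nat -> set X.
Hypothesis CX : determining C.
Variables (W : eqType) (le : rel W).
Hypotheses (wle_refl : reflexive le) (le_anti : antisymmetric le)
  (wle_trans : transitive le) (wle_total : total le)
  (le_wf : well_founded (fun u v => ~~ le v u)).

(** A bound on the density character without cardinals: a dense subset of [Z] is indexed by the
    finite trees with leaves in [J]. *)
Definition small (J : pred W) (Z : set X) := exists phi : GenTree.tree W -> X,
  (forall t, leaves_in J t -> Z (phi t)) /\
  Z `<=` adherent [set phi t | t in [set t | leaves_in J t]].

Definition below v : pred W := fun u => ~~ le v u.
Definition upto v : pred W := fun u => le u v.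

Lemma upto_below v w : upto v w -> w != v -> below v w.
Proof.
rewrite /upto /below => wv; apply: contra => vw; apply/eqP/le_anti.
by rewrite wv vw.
Qed.

Lemma below_upto v w : below v w -> upto v w.
Proof. by rewrite /below /upto; case/orP: (wle_total v w) => ->. Qed.

Section Step.
Variables (J : pred W) (Z : set X).
Hypothesis J_down : forall u v, le u v -> J v -> J u.
Hypothesis IH : forall v Z', J v -> closed_subspace Z' -> small (below v) Z' ->
  exists B, decomposition Z' B.
Hypothesis hZ : closed_subspace Z.
Variables (op : nat -> seq X -> X) (phi : GenTree.tree W -> X).
Hypothesis opZ : forall c s, (forall x, x \in s -> Z x) -> Z (op c s).
Hypothesis opM : forall M, M `<=` Z ->
  (forall c s, (forall x, x \in s -> M x) -> M (op c s)) -> reflecting C Z M.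
Hypothesis phiZ : forall t, leaves_in J t -> Z (phi t).
Hypothesis phi_dense : Z `<=` adherent [set phi t | t in [set t | leaves_in J t]].

Let M (J' : pred W) := gen op phi J'.
Let P (J' : pred W) := proj (M J').
Let sub (J' : pred W) := forall w, J' w -> J w.

Let hM (J' : pred W) : sub J' -> reflecting C Z (M J').
Proof.
move=> J'J; apply: opM; last by move=> c s; exact: gen_op.
by apply: gen_sub => // t /(leaves_inS J'J); exact: phiZ.
Qed.

Let MS (J1 J2 : pred W) : (forall w, J1 w -> J2 w) -> M J1 `<=` M J2.
Proof. by move=> h x; exact: genS. Qed.

Let sub0 : sub pred0. Proof. by []. Qed.
Let sub_upto v : J v -> sub (upto v). Proof. by move=> Jv w /J_down; apply. Qed.
Let sub_below v : J v -> sub (below v).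
Proof. by move=> Jv w /below_upto; exact: sub_upto. Qed.

(** The difference of consecutive projections; [Zv v] is its range. *)
Let Q v x := P (upto v) x - P (below v) x.
Let Zv v := [set z | [/\ Z z, P (upto v) z = z & P (below v) z = 0]].

Let P_in J' x : sub J' -> Z x -> Z (P J' x).
Proof. by move=> h; exact: (proj_in CX hZ (hM h)). Qed.

Let P_adh J' x : sub J' -> Z x -> adherent (M J') (P J' x).
Proof. by move=> h Zx; case: (projP CX (hM h) Zx). Qed.

Let P_nu J' x m : sub J' -> Z x -> M J' m -> nu m (P J' x) = nu m x.
Proof. by move=> h Zx; case: (projP CX (hM h) Zx) => _; apply. Qed.

Let PL J' (a : R) x y : sub J' -> Z x -> Z y -> P J' (a *: x + y) = a *: P J' x + P J' y.
Proof. by move=> h; exact: (projL CX _ hZ (hM h)). Qed.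

Let P0 J' : sub J' -> P J' 0 = 0.
Proof.
move=> h; have Z0 : Z 0 by case: hZ.
by have := PL 1 h Z0 Z0; rewrite !scale1r addr0 => /eqP; rewrite -subr_eq0 opprD addrA subrr sub0r oppr_eq0 => /eqP.
Qed.

Let PB J' x y : sub J' -> Z x -> Z y -> P J' (x - y) = P J' x - P J' y.
Proof. by move=> h Zx Zy; rewrite addrC -scaleN1r PL// scaleN1r addrC. Qed.

Let P_norm J' x : sub J' -> Z x -> `|P J' x| <= `|x|.
Proof. by move=> h; exact: (proj_norm CX (hM h)). Qed.

Let P_id J' x : sub J' -> Z x -> adherent (M J') x -> P J' x = x.
Proof. by move=> h; exact: (proj_id CX (hM h)). Qed.

Let PKl (J1 J2 : pred W) x : sub J2 -> (forall w, J1 w -> J2 w) -> Z x -> P J1 (P J2 x) = P J1 x.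
Proof.
move=> h h12; apply: (projKl CX hZ _ (hM h) (MS h12)).
by apply: hM => w /h12/h.
Qed.

Let PKr (J1 J2 : pred W) x : sub J2 -> (forall w, J1 w -> J2 w) -> Z x -> P J2 (P J1 x) = P J1 x.
Proof.
move=> h h12; apply: (projKr CX hZ _ (hM h) (MS h12)).
by apply: hM => w /h12/h.
Qed.

Let Q_in v x : J v -> Z x -> Zv v (Q v x).
Proof.
move=> Jv Zx; have hu := sub_upto Jv; have hb := sub_below Jv.
have bu : forall w, below v w -> upto v w by exact: below_upto.
have Zu := P_in hu Zx; have Zb := P_in hb Zx.
split; first exact: subspaceB.
  by rewrite /Q PB// PKl// PKr.
by rewrite /Q PB// PKl// (@PKl (below v) (below v))// subrr.
Qed.

Let Q_id v x : Zv v x -> Q v x = x.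
Proof. by move=> [_ h1 h2]; rewrite /Q h1 h2 subr0. Qed.

Let QL v (a : R) x y : J v -> Z x -> Z y -> Q v (a *: x + y) = a *: Q v x + Q v y.
Proof.
move=> Jv Zx Zy; rewrite /Q PL ?PL//; [|exact: sub_below|exact: sub_upto].
by rewrite opprD scalerBr addrACA.
Qed.

Let Q_norm v x : J v -> Z x -> `|Q v x| <= 2 * `|x|.
Proof.
move=> Jv Zx; apply: le_trans (ler_normB _ _) _.
by rewrite mulr_natl mulr2n lerD// P_norm//; [exact: sub_upto|exact: sub_below].
Qed.

Let Zv_closed v : J v -> closed_subspace (Zv v).
Proof.
move=> Jv; have hu := sub_upto Jv; have hb := sub_below Jv; split.
- by split; [case: hZ|exact: P0|exact: P0].
- move=> a x y [Zx h1 h2] [Zy h3 h4]; split.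
  + by case: hZ => _ ZD _; exact: ZD.
  + by rewrite PL// h1 h3.
  + by rewrite PL// h2 h4 scaler0 addr0.
move=> x hx; have Zx : Z x.
  by case: hZ => _ _; apply; apply: adherentS hx => y [].
have key J' : sub J' -> forall y, Z y -> `|P J' x - P J' y| <= `|x - y|.
  by move=> h y Zy; rewrite -PB//; apply: P_norm => //; exact: subspaceB.
split=> //.
  apply/eqP; rewrite -subr_eq0 -normr_le0; apply: (@le0_small _ _ 2) => // e e0.
  have [y [Zy h1 h2] hy] := hx _ e0.
  have := key _ hu y Zy; rewrite h1 => h3.
  have := ler_distD y (P (upto v) x) x; rewrite (distrC y x); lra.
apply/eqP; rewrite -normr_le0; apply: (@le0_small _ _ 1) => // e e0.
have [y [Zy h1 h2] hy] := hx _ e0.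
by have := key _ hb y Zy; rewrite h2 subr0; lra.
Qed.

(** The points [Q v m], with [m] generated by the labels up to [v], are dense in the range of [Q v].
    Recoding their trees with [hide_leaf] eliminates the label [v], so that the induction hypothesis
    at [v] applies to this range. *)
Let Zv_small v : J v -> small (below v) (Zv v).
Proof.
move=> Jv; exists (fun t => Q v (gen_eval op phi (show_leaf v t))).
have tM t : leaves_in (below v) t -> M (upto v) (gen_eval op phi (show_leaf v t)).
  move=> ht; apply: gen_evalP; apply: leaves_in_show ht; first exact: below_upto.
  exact: wle_refl.
have hu := sub_upto Jv; have [MZ _ _] := hM hu.
split=> [t /tM/MZ Zt|x Zx e e0]; first exact: Q_in.
have [Zxx h1 h2] := Zx.
have e2 : 0 < e / 2 by lra.
have [m Mm xm] := P_adh hu Zxx e2; rewrite h1 in xm.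
have [t ht tm] := gen_small Mm.
exists (Q v m); last first.
  rewrite -{1}(Q_id Zx) -[Q v x - _]addrC -scaleN1r -QL//; last exact: MZ.
  rewrite scaleN1r addrC; apply: le_lt_trans (Q_norm Jv _) _; last by lra.
  exact: (subspaceB hZ Zxx (MZ _ Mm)).
exists (hide_leaf v t); last by rewrite hide_leafK tm.
by apply: leaves_in_hide ht; exact: upto_below.
Qed.

(** The blocks are those of the subspaces [Zv v], with functionals composed with [Q v], together
    with one initial block for the countable set [M pred0]. Orthogonality comes from $Q_v Q_u = 0$
    for distinct [u] and [v]. *)
Lemma decomposition_step : exists B, decomposition Z B.
Proof.
have /choice[B hB] : forall v, exists B, J v -> decomposition (Zv v) B.
  move=> v; have [Jv|nJv] := pselect (J v); last by exists set0.
  by have [B hB] := IH Jv (Zv_closed Jv) (Zv_small Jv); exists B.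
pose lift v (b : block) : block := (b.1, fun n z => b.2 n (Q v z)).
pose d0 n := gen_eval op phi
  (drop_leaves W (odflt (GenTree.Leaf tt) (choice.unpickle n))).
pose b0 : block := (d0, fun n x => nu (d0 n) x).
have d0M n : M pred0 (d0 n) by apply: gen_evalP; exact: leaves_in_drop.
have Md0 m : M pred0 m -> exists n, d0 n = m.
  move=> /gen_small[t ht <-]; exists (choice.pickle (erase_leaves t)).
  by rewrite /d0 choice.pickleK /= drop_leavesK.
have [MZ0 _ _] := hM sub0.
have ZvZ v : Zv v `<=` Z by move=> x [].
exists [set b | b = b0 \/ exists v b', [/\ J v, B v b' & b = lift v b']].
have Q0 v m : J v -> M (below v) m -> Q v m = 0.
  move=> Jv Mm; have Mm' := MS (@below_upto v) Mm.
  have [MZ _ _] := hM (sub_upto Jv).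
  have E1 : P (upto v) m = m.
    by apply: P_id; [exact: sub_upto|exact: MZ|exact: adherent_sub].
  have E2 : P (below v) m = m.
    by apply: P_id; [exact: sub_below|exact: MZ|exact: adherent_sub].
  by rewrite /Q E1 E2 subrr.
have f0 v b n : J v -> B v b -> b.2 n 0 = 0.
  move=> Jv Bb; have [lf _] := dec_lin (hB _ Jv) n Bb.
  have Z0 : Zv v 0 by case: (Zv_closed Jv).
  by have := lf 1 0 0 Z0 Z0; rewrite scale1r addr0; lra.
have Qlt u v x : J v -> below v u -> Zv u x -> Q v x = 0.
  move=> Jv uv [Zx h1 _]; have uu w : upto u w -> below v w.
    rewrite /upto => wu; move: uv; apply: contra => vw; exact: wle_trans vw wu.
  have uu' w : upto u w -> upto v w by move=> /uu/below_upto.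
  by rewrite /Q -h1 !PKr// ?subrr//; [exact: sub_below|exact: sub_upto].
have Qgt u v x : J v -> below v u -> Zv v x -> Q u x = 0.
  move=> Jv uv [Zx h1 h2]; have uu w : upto u w -> below v w.
    rewrite /upto => wu; move: uv; apply: contra => vw; exact: wle_trans vw wu.
  have uu' w : below u w -> below v w by move=> /below_upto/uu.
  have sb := sub_below Jv.
  have su : sub (upto u) by move=> w /uu/sb.
  have sbu : sub (below u) by move=> w /uu'/sb.
  by rewrite /Q -(@PKl (upto u) (below v))// -(@PKl (below u) (below v))// h2 !P0// subrr.
split.
- move=> b n [->|[v [b' [Jv Bb' ->]]]]; first exact/MZ0/d0M.
  by case: (dec_in (hB _ Jv) n Bb').
- move=> b n [->|[v [b' [Jv Bb' ->]]]].
    split; first by move=> a x y _ _ /=; rewrite dualD dualZ.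
    by exists 1 => x _; rewrite mul1r; exact: (nu_le (d0 n) x).
  have [lf [K fK]] := dec_lin (hB _ Jv) n Bb'.
  split=> [a x y Zx Zy|] /=; first by rewrite QL// lf//; exact: Q_in.
  exists (`|K| * 2) => x Zx; apply: le_trans (fK _ (Q_in Jv Zx)) _.
  rewrite -mulrA; apply: (@le_trans _ _ (`|K| * `|Q v x|)).
    by rewrite ler_wpM2r// ler_norm.
  by rewrite ler_wpM2l// Q_norm.
- move=> b b' n m [->|[v [c [Jv Bc ->]]]] [->|[v' [c' [Jv' Bc' ->]]]] //= bb'.
  + have [Zd h1 h2] := dec_in (hB _ Jv') m Bc'.
    have s0 : forall w, (@pred0 W) w -> below v' w by [].
    have sb := sub_below Jv'.
    rewrite -(P_nu sb Zd); last by apply: MS s0 _ (d0M n).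
    by rewrite h2 dual0.
  + by rewrite Q0 ?(f0 v)//; apply: MS (d0M m).
  + have [vv'|nv] := eqVneq v v'.
      subst v'; rewrite Q_id; last exact: (dec_in (hB _ Jv)).
      by apply: (dec_orth (hB _ Jv)) => // cc; apply: bb'; rewrite cc.
    have [v'v|vv'] := boolP (below v v').
      by rewrite (Qlt v') ?(f0 v)//; exact: (dec_in (hB _ Jv')).
    rewrite (@Qgt v v') ?(f0 v)//; last exact: (dec_in (hB _ Jv')).
    by apply: upto_below nv; move: vv'; rewrite /below /upto negbK.
- move=> V hV VB.
  have V0 : M pred0 `<=` V by move=> m /Md0[n <-]; apply: (VB b0); left.
  have [_ _ Vcl] := hV.
  have adhV A : A `<=` V -> adherent A `<=` V.
    by move=> AV x /(adherentS AV); exact: Vcl.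
  have dir J' : sub J' -> (forall u, J' u -> M (upto u) `<=` V) -> M J' `<=` V.
    by move=> _ h m /(gen_directed wle_refl wle_trans wle_total)[/V0//|[u Ju]]; exact: h.
  (* Write $m = P_{<v} m + Q_v m$: the first term is in the closure of the earlier stages, the
     second in a subspace spanned by its own blocks. *)
  have upV v : J v -> M (upto v) `<=` V.
    elim/(well_founded_ind le_wf): v => v IHv Jv m Mm.
    have sb := sub_below Jv; have su := sub_upto Jv.
    have MbV : M (below v) `<=` V.
      by apply: dir => // u uv; apply: IHv => //; exact: sb.
    have [MZ _ _] := hM su.
    have -> : m = P (below v) m + Q v m.
      by rewrite /Q addrC subrK P_id//; [exact: MZ|exact: adherent_sub].
    apply: subspaceD => //; first by apply: (adhV _ MbV); apply: P_adh => //; exact: MZ.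
    apply: (dec_fund (hB _ Jv) hV) (Q_in Jv (MZ _ Mm)) => b n Bb.
    by apply: (VB (lift v b)); right; exists v, b.
  have MJV : M J `<=` V by apply: dir => // u Ju; exact: upV.
  move=> z /phi_dense; apply: adhV => _ [t ht <-]; apply: MJV; exact: gen_base.
- move=> x Zx hx.
  have nu0 m : M pred0 m -> nu m x = 0.
    by move=> /Md0[n <-]; apply: (hx b0); left.
  (* Dually, if all earlier stages annihilate [x] then $P_{<v} x = 0$, and $Q_v x = 0$ by totality
     on [Zv v]; hence $P_{\le v} x = 0$. *)
  have upx v : J v -> forall m, M (upto v) m -> nu m x = 0.
    elim/(well_founded_ind le_wf): v => v IHv Jv m Mm.
    have sb := sub_below Jv; have su := sub_upto Jv.
    have b0x : P (below v) x = 0.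
      apply: (nu_eq0 (P_adh sb Zx)) => m' Mm'; rewrite P_nu//.
      have [/nu0//|[u uv Mu]] := gen_directed wle_refl wle_trans wle_total Mm'.
      by apply: (IHv u) => //; exact: sb.
    have Qx : Q v x = 0.
      apply: (dec_total (hB _ Jv)); first exact: Q_in.
      by move=> b n Bb; apply: (hx (lift v b)); right; exists v, b.
    by move: Qx; rewrite -(P_nu su Zx Mm) /Q b0x subr0 => ->; rewrite dual0.
  apply: (@nu_eq0 _ _ (M J)).
    by apply: adherentS (phi_dense Zx) => _ [t ht <-]; exact: gen_base.
  move=> m /(gen_directed wle_refl wle_trans wle_total)[/nu0//|[u Ju]]; exact: upx.
Qed.

End Step.

Lemma small_decomposition (J : pred W) (Z : set X) :
  (forall u v, le u v -> J v -> J u) ->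
  (forall v Z', J v -> closed_subspace Z' -> small (below v) Z' -> exists B, decomposition Z' B) ->
  closed_subspace Z -> small J Z -> exists B, decomposition Z B.
Proof.
move=> J_down IH hZ [phi [phiZ phid]].
have [op [opZ opM]] := reflecting_ops C hZ.
exact: (decomposition_step J_down IH hZ opZ opM phiZ phid).
Qed.

Lemma below_decomposition v Z : closed_subspace Z -> small (below v) Z ->
  exists B, decomposition Z B.
Proof.
elim/(well_founded_ind le_wf): v Z => v IHv Z hZ sZ.
apply: small_decomposition (hZ) sZ => [u w uw|u Z' uv]; last exact: IHv.
by rewrite /below; apply: contra => vu; exact: wle_trans vu uw.
Qed.

End OrthogonalBlocks.

Lemma determining_decomposition (R : realType) (X : normedModType R)
  (C : nat -> set X) : determining C -> exists B, @decomposition R X setT B.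
Proof.
move=> CX; have [le [h1 h2 h3 h4 h5]] := well_order_ex X.
apply: (small_decomposition CX h1 h2 h3 h4 h5 (J := predT)) => //.
- by move=> v Z' _; exact: (below_decomposition CX h1 h2 h3 h4 h5).
- exists (fun t => if t is GenTree.Leaf x then x else 0); split=> // x _.
  by apply: adherent_sub; exists (GenTree.Leaf x).
Qed.

(** * Coordinate systems *)

Section Coordinates.
Context {R : realType} {X : normedModType R}.
Variable C : nat -> set X.
Hypothesis CX : determining C.

(** The factor $1/(n+1)$ makes the coordinates inside one block tend to $0$. Blocks outside [B]
    carry zero vectors and zero functionals, so that the index type can be the type of all
    blocks. *)
Lemma coordinates_ex : exists (A : choiceType) (d : A -> nat -> X) (f : A -> nat -> topdual X),
  [/\ forall a n, `|d a n| <= 1,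
      forall a n x, `|f a n x| <= n.+1%:R^-1 * `|x|,
      forall a b n m, a <> b -> f a n (d b m) = 0,
      forall V, closed_subspace V -> (forall a n, V (d a n)) -> forall x, V x
    & forall x, (forall a n, f a n x = 0) -> x = 0].
Proof.
have [B [_ hlin horth hfund htot]] := determining_decomposition CX.
pose A : choiceType := {classic (@block R X)}.
have scal (x : X) : `|(1 + `|x|)^-1 *: x| <= 1.
  have x1 : 0 < 1 + `|x| by rewrite ltr_wpDr.
  by rewrite normrZ gtr0_norm ?invr_gt0// mulrC ler_pdivrMr// mul1r lerDr.
have /choice[F hF] : forall p : A * nat, exists f : topdual X,
    (forall x, `|f x| <= p.2.+1%:R^-1 * `|x|) /\
    exists c : R, [/\ c != 0, forall x, B p.1 -> f x = c * p.1.2 p.2 x &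
      forall x, ~ B p.1 -> f x = 0].
  move=> [b n] /=; have [Bb|nBb] := pselect (B b); last first.
    exists 0; split=> [x|]; last by exists 1; split=> //; exact: oner_neq0.
    have -> : (0 : topdual X) x = 0 :> R by [].
    by rewrite normr0 mulr_ge0// invr_ge0.
  have [lf [K fK]] := hlin b n Bb.
  have K1 : 0 < 1 + `|K| by rewrite ltr_wpDr.
  pose c : R := n.+1%:R^-1 * (1 + `|K|)^-1.
  have c0 : 0 < c by rewrite mulr_gt0 ?invr_gt0.
  have fc x : `|c * b.2 n x| <= n.+1%:R^-1 * `|x|.
    rewrite normrM (gtr0_norm c0) /c -mulrA ler_wpM2l ?invr_ge0//.
    rewrite mulrC ler_pdivrMr//; apply: le_trans (fK x I) _.
    by rewrite mulrC ler_wpM2l//; have := ler_norm K; lra.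
  have [|f fE] := @bounded_dual _ _ (fun x => c * b.2 n x) n.+1%:R^-1 _ fc.
    by move=> a x y /=; rewrite lf//; ring.
  exists f; split=> [x|]; first by rewrite fE; exact: fc.
  by exists c; split=> [|x _|x /(_ Bb)//]; rewrite ?fE// gt_eqF.
pose D (b : A) n : X := if `[< B b >] then (1 + `|b.1 n|)^-1 *: b.1 n else 0.
exists A, D, (fun b n => F (b, n)); split.
- by move=> b n; rewrite /D; case: ifP; rewrite ?normr0 ?ler01.
- by move=> b n x; case: (hF (b, n)).
- move=> b b' n m bb'; rewrite /D; case: asboolP => [Bb'|]; last by rewrite dual0.
  have [_ [c [_ cE c0]]] := hF (b, n); have [Bb|nBb] := pselect (B b).
    by rewrite dualZ (cE _ Bb) horth// !mulr0.
  by rewrite dualZ (c0 _ nBb) mulr0.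
- move=> V hV VD x; apply: (hfund V hV) => // b n Bb.
  have := VD b n; rewrite /D; case: asboolP => // _ /(subspaceZ (1 + `|b.1 n|) hV).
  by rewrite scalerA divff ?scale1r// gt_eqF// ltr_wpDr.
- move=> x hx; apply: htot => // b n Bb; have [_ [c [c0 cE _]]] := hF (b, n).
  by have := hx b n; rewrite (cE _ Bb) => /eqP; rewrite mulf_eq0 (negPf c0) => /eqP.
Qed.

End Coordinates.

(** * Decay of coordinates, splitting and dense witnesses *)

Section CoordinateSystem.
Context {R : realType} {X : normedModType R}.
Variable C : nat -> set X.
Hypothesis CX : determining C.
Variables (A : choiceType) (d : A -> nat -> X) (f : A -> nat -> topdual X).
Hypothesis d_le : forall a n, `|d a n| <= 1.
Hypothesis f_le : forall a n x, `|f a n x| <= n.+1%:R^-1 * `|x|.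
Hypothesis fd0 : forall a b n m, a <> b -> f a n (d b m) = 0.
Hypothesis d_fund : forall V, closed_subspace V -> (forall a n, V (d a n)) -> forall x, V x.
Hypothesis f_total : forall x, (forall a n, f a n x = 0) -> x = 0.

Local Notation Gamma := (A * nat)%type.
Definition coord (g : Gamma) (x : X) : R := f g.1 g.2 x.

Lemma coordD g x y : coord g (x + y) = coord g x + coord g y.
Proof. exact: dualD. Qed.
Lemma coordZ g (a : R) x : coord g (a *: x) = a * coord g x.
Proof. exact: dualZ. Qed.
Lemma coordB g x y : coord g (x - y) = coord g x - coord g y.
Proof. exact: dualB. Qed.

Lemma coord_le g x : `|coord g x| <= `|x|.
Proof.
apply: le_trans (f_le _ _ x) _; rewrite -[X in _ <= X]mul1r ler_wpM2r//.
by rewrite invf_le1 ?ltr0Sn// ler1n.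
Qed.

Lemma coord_total x : (forall g, coord g x = 0) -> x = 0.
Proof. by move=> h; apply: f_total => a n; exact: (h (a, n)). Qed.

(** The points with this property form a closed subspace. It contains [d a n], whose coordinates
    vanish off the block [a] and are at most $1/(k+1)$ inside it. *)
Lemma coord_c0 x (e : R) : 0 < e ->
  exists s : seq Gamma, forall g, g \notin s -> `|coord g x| <= e.
Proof.
pose V x := forall e : R, 0 < e ->
  exists s : seq Gamma, forall g, g \notin s -> `|coord g x| <= e.
suff h : V x by exact: h.
apply: d_fund => {x e}.
  split.
  - by move=> e e0; exists [::] => g _; rewrite /coord dual0 normr0 ltW.
  - move=> a x y Vx Vy e e0.
    have a1 : 0 < `|a| + 1 by rewrite ltr_wpDl.
    have e2 : 0 < e / 2 by lra.
    have [s hs] := Vx _ (divr_gt0 e2 a1); have [t ht] := Vy _ e2.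
    exists (s ++ t) => g; rewrite mem_cat negb_or => /andP[/hs h1 /ht h2].
    rewrite coordD coordZ; apply: le_trans (ler_normD _ _) _.
    have : `|a * coord g x| <= e / 2; last by lra.
    rewrite normrM; rewrite ler_pdivlMr// mulrC in h1; apply: le_trans h1.
    by rewrite ler_wpM2r// lerDl.
  - move=> x hx e e0; have e2 : 0 < e / 2 by lra.
    have [y Vy xy] := hx _ e2; have [s hs] := Vy _ e2.
    exists s => g /hs h; have := coord_le g (x - y); rewrite coordB.
    by have := ler_normD (coord g x - coord g y) (coord g y); rewrite subrK; lra.
move=> a n e e0; have [N hN] := ex_invn e0.
exists [seq (a, k) | k <- iota 0 N] => -[b k] hg.
have [ab|ab] := eqVneq b a; last first.
  by rewrite /coord fd0 ?normr0 ?ltW//; exact/eqP.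
have Nk : (N <= k)%N.
  rewrite leqNgt; apply: contra hg => kN; apply/mapP; exists k; last by rewrite ab.
  by rewrite mem_iota.
rewrite /coord/=; apply: le_trans (f_le _ _ _) _.
apply: (@le_trans _ _ (k.+1%:R^-1 * 1)); first by rewrite ler_wpM2l// invr_ge0.
rewrite mulr1; apply: le_trans (ltW hN).
by rewrite lef_pV2 ?posrE ?ltr0Sn// ler_nat ltnS.
Qed.

(* Sokolov's splitting condition. *)
Lemma splitting (g : topdual X) (a0 : A) (m : nat) (e : R) : 0 < e ->
  exists l : seq nat, (forall i, i \in l -> C i (d a0 m)) /\
    exists s : seq A, forall a, a \notin s -> (forall i, i \in l -> C i (d a m)) ->
      `|g (d a m)| <= e.
Proof.
move=> e0; apply: contrapT => hn.
pose B (p : nat * seq A) : set X := [set z | exists2 a, a \notin p.2 & [/\ z = d a m,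
  forall i, (i < p.1)%N -> C i (d a0 m) -> C i z & e < `|g z|]].
have FF : ProperFilter (filter_from setT B).
  apply: filter_from_proper.
    apply: filter_from_filter; first by exists (0%N, [::]).
    move=> [k s] [k' s'] _ _; exists (maxn k k', s ++ s') => // z [a /=].
    rewrite mem_cat negb_or => /andP[h1 h2] [h3 h4 h5].
    by split; exists a => //; split=> // i ik; apply: h4; rewrite leq_max ik ?orbT.
  move=> [k s] _; apply: contrapT => nz; apply: hn.
  exists [seq i <- iota 0 k | `[< C i (d a0 m) >]]; split.
    by move=> i; rewrite mem_filter => /andP[/asboolP].
  exists s => a /= as_ ha; rewrite leNgt; apply/negP => ga; apply: nz.
  exists (d a m); exists a => //; split=> // i ik Ci; apply: ha.
  by rewrite mem_filter mem_iota add0n ik /= andbT; exact/asboolP.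
have [U [UU FU]] := ultraFilterLemma FF.
have UB p : U (B p) by apply: FU; exists p.
have [||y hy] := @CX (d a0 m) U UU.
- exists 1; apply: (@filterS _ U _ _ _ _ (UB (0%N, [::]))) => z [a _ [-> _ _]].
  exact: d_le.
- move=> i Ci; apply: (@filterS _ U _ _ _ _ (UB (i.+1, [::]))) => z [a _ [_ h _]].
  exact: h.
(* The indices met by the ultrafilter leave every finite set, so by orthogonality each functional
   [f a n] tends to $0$ along it; totality then identifies the weak limit. *)
have y0 : y = 0.
  apply: f_total => a n; apply: eq_small => r r0.
  have [z [[b /= ab [-> _ _]] h]] := @filter_ex _ U _ _
    (filterI (UB (0%N, [:: a])) (hy (f a n) _ r0)).
  have ab' : a <> b by move=> E; move: ab; rewrite E inE eqxx.
  by move: h; rewrite /= fd0// sub0r normrN subr0.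
have [z [[b /= _ [_ _ h1]] /= h2]] := @filter_ex _ U _ _ (filterI (UB (0%N, [::])) (hy g _ e0)).
by move: h2; rewrite y0 dual0 subr0 ltNge ltW.
Qed.

Definition top_set (x : X) (t : R) (F : {fset Gamma}) :=
  0 < t /\ forall g, (g \in F) = (t <= `|coord g x|).

Lemma top_set_ex x (t : R) : 0 < t -> exists F, top_set x t F.
Proof.
move=> t0; have t2 : 0 < t / 2 by lra.
have [s hs] := coord_c0 x t2.
exists [fset g | g in s & t <= `|coord g x|]%fset; split=> // g.
rewrite !inE /=; have [//|/hs h] := boolP (g \in s).
by apply/esym/negbTE; rewrite -ltNge; lra.
Qed.

Lemma top_setS x t u F G : top_set x t F -> top_set x u G -> u <= t -> (F `<=` G)%fset.
Proof.
by move=> [_ hF] [_ hG] ut; apply/fsubsetP => g; rewrite hF hG; exact: le_trans.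
Qed.

(** Only finitely many coordinates exceed $t/2$, so those below $t$ stay away from $t$. *)
Lemma top_set_gap x t F : top_set x t F ->
  exists2 u, 0 <= u < t & forall g, g \notin F -> `|coord g x| <= u.
Proof.
move=> [t0 hF]; have t2 : 0 < t / 2 by lra.
have [s hs] := coord_c0 x t2.
have : exists2 u, t / 2 <= u < t & forall g, g \in s -> g \notin F -> `|coord g x| <= u.
  elim: s {hs} => [|g s [u /andP[u2 ut] hu]]; first by exists (t / 2); rewrite // lexx; lra.
  have [gF|gF] := boolP (g \in F).
    exists u; first by rewrite u2.
    by move=> h; rewrite inE => /orP[/eqP->|/hu//]; rewrite gF.
  exists (Num.max u `|coord g x|).
    by rewrite le_max u2/= gt_max ut/= ltNge -hF.
  move=> h; rewrite inE le_max => /orP[/eqP->|/hu hs] hF'; first by rewrite lexx orbT.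
  by rewrite hs.
move=> [u /andP[u2 ut] hu]; exists u; first by rewrite ut andbT; lra.
move=> g gF; have [gs|gs] := boolP (g \in s); first exact: hu.
by apply: le_trans (hs _ gs) u2.
Qed.

Definition pattern_code : countType := (seq rat * nat * seq nat * nat)%type.

Definition pattern (F : {fset Gamma}) (c : pattern_code) : set X :=
  let: (q, n, l, b) := c in
  [set z | [/\ forall g, g \in F -> `|coord g z - ratr (nth 0 q (index g F))| <= n.+1%:R^-1,
    forall g, g \notin F -> `|coord g z| <= n.+1%:R^-1,
    forall i, i \in l -> C i z & `|z| <= b%:R]].

Definition witness F (c : pattern_code) : X := xget 0 (pattern F c).

Definition combination_code : countType := seq (rat * nat * pattern_code)%type.

(** For a fixed [F], the rational combinations of witnesses of subsets of [F] are countably many.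
    Numbering them by [j] lets a countable family of functions reach all of them. *)
Definition combination (F : {fset Gamma}) (j : nat) : X :=
  \sum_(p <- odflt [::] (@choice.unpickle combination_code j))
    ratr p.1.1 *: witness (nth fset0 (fpowerset F) p.1.2) p.2.

Definition witness_span (F : {fset Gamma}) : set X :=
  [set x | exists c : seq (rat * {fset Gamma} * pattern_code),
    (forall p, p \in c -> (p.1.2 `<=` F)%fset) /\
    x = \sum_(p <- c) ratr p.1.1 *: witness p.1.2 p.2].

Lemma witness_span_combination F x : witness_span F x -> exists j, combination F j = x.
Proof.
move=> [c [cF ->]].
pose c' : combination_code := [seq (p.1.1, index p.1.2 (fpowerset F), p.2) | p <- c].
exists (choice.pickle c'); rewrite /combination choice.pickleK /= big_map.
rewrite big_seq [RHS]big_seq; apply: eq_bigr => p pc /=.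
by rewrite nth_index// fpowersetE; exact: cF.
Qed.

Lemma witness_spanS F G : (F `<=` G)%fset -> witness_span F `<=` witness_span G.
Proof.
move=> FG x [c [cF ->]]; exists c; split=> // p /cF; by move/fsubset_trans; apply.
Qed.

Lemma witness_spanD F (r : rat) x y : witness_span F x -> witness_span F y ->
  witness_span F (ratr r *: x + y).
Proof.
move=> [c [cF ->]] [c' [cF' ->]].
exists ([seq (r * p.1.1, p.1.2, p.2) | p <- c] ++ c'); split.
  by move=> p; rewrite mem_cat => /orP[/mapP[q /cF qF ->]//|/cF'].
rewrite big_cat/= big_map scaler_sumr; congr (_ + _).
by apply: eq_bigr => p _; rewrite /= rmorphM scalerA.
Qed.

Lemma witness_span0 F : witness_span F 0.
Proof. by exists [::]; rewrite big_nil. Qed.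

(** Otherwise some functional [h] vanishes on all these combinations but not at [x]. The witnesses
    [z n] for finer and finer patterns of [x] itself converge to [x] in every coordinate and
    eventually lie in each [C i] through [x]; along an ultrafilter they converge weakly to [x],
    which contradicts $h(x) \ne 0$. *)
Lemma witness_dense x (t0 e : R) : 0 < t0 -> 0 < e ->
  exists t F, [/\ t <= t0, top_set x t F & exists j, `|x - combination F j| < e].
Proof.
move=> t0_gt0 e0.
pose W := [set z | exists t F, [/\ t <= t0, top_set x t F & witness_span F z]].
suff /(_ _ e0)[z [t [F [tt0 hF /witness_span_combination[j <-]]]] xz] : adherent W x.
  by exists t, F; split=> //; exists j.
have Wq : rational_subspace W.
  split; first by have [F hF] := top_set_ex x t0_gt0; exists t0, F; split=> //; exact: witness_span0.
  move=> r z z' [t [F [tt0 hF Fz]]] [t' [F' [tt0' hF' Fz']]].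
  have [tt'|/ltW tt'] := leP t t'.
    exists t, F; split=> //; apply: witness_spanD => //.
    by apply: witness_spanS Fz'; exact: top_setS hF' hF tt'.
  exists t', F'; split=> //; apply: witness_spanD => //.
  by apply: witness_spanS Fz; exact: top_setS hF hF' tt'.
apply: contrapT => nWx.
have [h h0 hx] := separating_functional (adherent_rational Wq) nWx.
have [b xb] := ex_natge `|x|.
pose t n : R := Num.min t0 n.+1%:R^-1.
have tgt0 n : 0 < t n by rewrite lt_min t0_gt0 invr_gt0 ltr0Sn.
have /choice[F hF] : forall n, exists F, top_set x (t n) F by move=> n; exact: top_set_ex.
have /choice[q hq] : forall p : Gamma * nat, exists r : rat,
    `|coord p.1 x - ratr r| < p.2.+1%:R^-1.
  by move=> p; apply: ex_ratr; rewrite invr_gt0.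
pose c n : pattern_code := ([seq q (g, n) | g <- enum_fset (F n)], n,
  [seq i <- iota 0 n | `[< C i x >]], b).
pose z n := witness (F n) (c n).
have zP n : pattern (F n) (c n) (z n).
  apply: (@xgetI _ 0 _ x); split=> //.
  - move=> g gF; rewrite (nth_map (g, n).1) ?index_mem// nth_index//.
    exact: ltW (hq (g, n)).
  - move=> g; rewrite (hF n).2 -ltNge => /ltW h1; apply: le_trans h1 _.
    by rewrite ge_min lexx orbT.
  - by move=> i; rewrite mem_filter => /andP[/asboolP].
have zW n : W (z n).
  exists (t n), (F n); split; [by rewrite ge_min lexx|exact: hF|].
  exists [:: (1, F n, c n)]; split; first by move=> p; rewrite inE => /eqP->.
  by rewrite big_seq1 /= rmorph1 scale1r.
have zx n g : `|coord g (z n) - coord g x| <= 2 * n.+1%:R^-1.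
  have [h1 h2 _ _] := zP n; have [gF|gF] := boolP (g \in F n).
    have := h1 g gF; rewrite (nth_map (g, n).1) ?index_mem// nth_index//.
    have := hq (g, n); rewrite /= => h3 h4.
    apply: le_trans (ler_distD (ratr (q (g, n))) _ _) _.
    by rewrite mulr_natl mulr2n lerD// distrC ltW.
  apply: le_trans (ler_normB _ _) _; rewrite mulr_natl mulr2n lerD//; first exact: h2.
  by move: gF; rewrite (hF n).2 -ltNge => /ltW h3; apply: le_trans h3 _; rewrite ge_min lexx orbT.
pose B k := [set y | exists2 n, (k <= n)%N & y = z n].
have FF : ProperFilter (filter_from setT B).
  apply: filter_from_proper; last by move=> k _; exists (z k), k.
  apply: filter_from_filter; first by exists 0%N.
  move=> k k' _ _; exists (maxn k k') => // y [n]; rewrite geq_max => /andP[kn kn'] ->.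
  by split; exists n.
have [U [UU FU]] := ultraFilterLemma FF.
have UB p : U (B p) by apply: FU; exists p.
have [||y hy] := @CX x U UU.
- exists b%:R; apply: (@filterS _ U _ _ _ _ (UB 0%N)) => _ [n _ ->].
  by have [] := zP n.
- move=> i Ci; apply: (@filterS _ U _ _ _ _ (UB i.+1)) => _ [n ni ->].
  have [_ _ h1 _] := zP n; apply: h1; rewrite mem_filter mem_iota add0n ni /= andbT.
  exact/asboolP.
have yx : y = x.
  apply/eqP; rewrite -subr_eq0; apply/eqP; apply: coord_total => g.
  rewrite coordB; apply/eqP; rewrite subr_eq0; apply/eqP.
  apply: eq_small => r r0; have r2 : 0 < r / 4 by lra.
  have [k hk] := ex_invn r2.
  have [_ [[n kn ->] /=]] := @filter_ex _ U _ _ (filterI (UB k) (hy (f g.1 g.2) _ r2)).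
  rewrite -/(coord g (z n)) -/(coord g y) => h1.
  have h2 : `|coord g (z n) - coord g x| < r / 2.
    apply: le_lt_trans (zx n g) _.
    have -> : r / 2 = 2 * (r / 4) by field.
    rewrite ltr_pM2l//; apply: le_lt_trans hk.
    by rewrite lef_pV2 ?posrE ?ltr0Sn// ler_nat ltnS.
  by apply: lt_trans (ltr_dist h1 h2) _; lra.
have hx0 : 0 < `|h x| by rewrite normr_gt0.
have [_ [[n _ ->] /=]] := @filter_ex _ U _ _ (filterI (UB 0%N) (hy h _ hx0)).
by rewrite yx h0 ?sub0r ?normrN ?ltxx//; exact: adherent_sub.
Qed.

End CoordinateSystem.

(** * Quadratic functions *)

Section QuadraticFunctions.
Context {R : realType} {V : lmodType R}.
Implicit Types (q : V -> R) (x y z : V).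

(** These are the squares of seminorms, in a form that is stable under weighted sums and suprema. *)
Record quadratic q : Prop := Quadratic {
  quad_ge0 : forall x, 0 <= q x;
  quadZ : forall (a : R) x, q (a *: x) = a ^+ 2 * q x;
  quad_convex : forall (t : R) x y, 0 <= t <= 1 ->
    q (t *: x + (1 - t) *: y) <= t * q x + (1 - t) * q y }.

Definition midpoint x z : V := 2^-1 *: (x + z).

(** Local uniform rotundity is expressed throughout by this midpoint defect of convexity. *)
Definition deficit q x z : R := (q x + q z) / 2 - q (midpoint x z).

Lemma midpointE x z : midpoint x z = 2^-1 *: x + (1 - 2^-1) *: z.
Proof. by rewrite /midpoint scalerDr; congr (_ + _ *: _); lra. Qed.

Lemma quad0 q : quadratic q -> q 0 = 0.
Proof. by move=> hq; have := quadZ hq 0 0; rewrite scale0r expr0n mul0r. Qed.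

Lemma quadN q x : quadratic q -> q (- x) = q x.
Proof. by move=> hq; rewrite -scaleN1r (quadZ hq) sqrrN expr1n mul1r. Qed.

Lemma deficit_ge0 q x z : quadratic q -> 0 <= deficit q x z.
Proof.
move=> hq; rewrite /deficit midpointE; have := quad_convex hq (t := 2^-1) x z.
by rewrite subr_ge0 => /(_ _); lra.
Qed.

Lemma quadraticD q r : quadratic q -> quadratic r -> quadratic (fun x => q x + r x).
Proof.
move=> hq hr; split=> [x|a x|t x y t01].
- by rewrite addr_ge0// quad_ge0.
- by rewrite (quadZ hq) (quadZ hr) mulrDr.
- by have := quad_convex hq x y t01; have := quad_convex hr x y t01; lra.
Qed.

Lemma quadraticZ q (c : R) : 0 <= c -> quadratic q -> quadratic (fun x => c * q x).
Proof.
move=> c0 hq; split=> [x|a x|t x y t01].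
- by rewrite mulr_ge0// quad_ge0.
- by rewrite (quadZ hq) mulrCA.
- by have /(ler_wpM2l c0) := quad_convex hq x y t01; lra.
Qed.

Lemma quadratic_sum (I : eqType) (s : seq I) (q : I -> V -> R) :
  (forall i, quadratic (q i)) -> quadratic (fun x => \sum_(i <- s) q i x).
Proof.
move=> hq; elim: s => [|i s IH].
  by split=> [x|a x|t x y _]; rewrite !big_nil ?mulr0 ?addr0.
have -> : (fun x => \sum_(i <- i :: s) q i x) = (fun x => q i x + \sum_(i <- s) q i x).
  by apply/funext => x; rewrite big_cons.
exact: quadraticD.
Qed.

Lemma quadratic_supr (I : Type) (D : set I) (q : I -> V -> R) (B : V -> R) i0 : D i0 ->
  (forall i, D i -> quadratic (q i)) -> (forall i x, D i -> q i x <= B x) ->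
  quadratic (fun x => supr D (fun i => q i x)).
Proof.
move=> Di0 hq qB.
have ub i x : D i -> q i x <= supr D (fun i => q i x).
  by move=> Di; apply: (@supr_ge _ _ D (fun i => q i x) (B x) i _ Di) => j Dj; exact: qB.
have ge0 x : 0 <= supr D (fun i => q i x).
  by apply: le_trans (ub _ x Di0); exact: (quad_ge0 (hq _ Di0)).
have leZ (a : R) x : supr D (fun i => q i (a *: x)) <= a ^+ 2 * supr D (fun i => q i x).
  apply: (supr_le Di0) => i Di; rewrite (quadZ (hq _ Di)).
  by rewrite ler_wpM2l ?sqr_ge0// ub.
split=> // [a x|t x y /[dup] t01 /andP[t0 t1]].
  apply/eqP; rewrite eq_le leZ/=; have [->|a0] := eqVneq a 0.
    by rewrite expr0n mul0r ge0.
  rewrite -ler_pdivlMl ?exprn_even_gt0// -exprVn.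
  by have := leZ a^-1 (a *: x); rewrite scalerA mulVf// scale1r.
apply: (supr_le Di0) => i Di; apply: le_trans (quad_convex (hq _ Di) x y t01) _.
by rewrite lerD// ler_wpM2l ?ub// subr_ge0.
Qed.

Lemma quadratic_limit (q : V -> R) (r : nat -> V -> R) (e : nat -> V -> R) :
  (forall n, quadratic (r n)) -> (forall n x, r n x <= q x <= r n x + e n x) ->
  (forall x y z (d : R), 0 < d -> exists n, [/\ e n x < d, e n y < d & e n z < d]) ->
  quadratic q.
Proof.
move=> hr rq ed; split=> [x|a x|t x y /[dup] t01 /andP[t0 t1]].
- by have /andP[h _] := rq 0%N x; apply: le_trans h; exact: quad_ge0.
- apply: eq_small => d d0; have a1 : 0 < a ^+ 2 + 1 by rewrite ltr_wpDl ?sqr_ge0.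
  have d2 : 0 < Num.min (d / 2) (d / 2 / (a ^+ 2 + 1)) by rewrite lt_min !divr_gt0.
  have [n [h1 h2 _]] := ed (a *: x) x x _ d2.
  have /andP[h3 h4] := rq n x; have /andP[h5 h6] := rq n (a *: x).
  move: h1 h2; rewrite !lt_min => /andP[h1 _] /andP[_]; rewrite ltr_pdivlMr// => h2.
  rewrite (quadZ (hr n)) in h5 h6.
  have := ler_wpM2l (sqr_ge0 a) h3; have := ler_wpM2l (sqr_ge0 a) h4.
  have e0 : 0 <= e n x by lra.
  by rewrite ltr_norml => h7 h8; apply/andP; split; nra.
apply/ler_addgt0Pr => d d0.
have d2 : 0 < d by [].
have [n [h1 _ _]] := ed (t *: x + (1 - t) *: y) x x _ d2.
have /andP[_ h3] := rq n (t *: x + (1 - t) *: y).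
have /andP[h4 _] := rq n x; have /andP[h5 _] := rq n y.
have := quad_convex (hr n) x y t01.
have := ler_wpM2l t0 h4; have := ler_wpM2l (_ : 0 <= 1 - t) h5.
by rewrite subr_ge0 => /(_ t1); lra.
Qed.

End QuadraticFunctions.

Section SeminormSquare.
Context {R : realType} {X : normedModType R}.

Lemma seminorm_ge0 (N : X -> R) x : seminorm N -> 0 <= N x.
Proof.
move=> [ND NZ]; have := ND x (-1 *: x); rewrite scaleN1r subrr -(scale0r 0) NZ.
by rewrite -scaleN1r NZ normrN1 normr0; lra.
Qed.

Lemma quadratic_sqr (N : X -> R) : seminorm N -> quadratic (fun x => N x ^+ 2).
Proof.
move=> hN; have N0 x := seminorm_ge0 x hN; split=> [x|a x|t x y /andP[t0 t1]].
- exact: sqr_ge0.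
- by rewrite hN.2 exprMn real_normK// num_real.
have h : N (t *: x + (1 - t) *: y) <= t * N x + (1 - t) * N y.
  apply: le_trans (hN.1 _ _) _; rewrite !hN.2 !ger0_norm ?subr_ge0//.
apply: le_trans (_ : (t * N x + (1 - t) * N y) ^+ 2 <= _).
  by rewrite ler_sqr ?nnegrE// addr_ge0// mulr_ge0// subr_ge0.
have : 0 <= t * (1 - t) * (N x - N y) ^+ 2.
  by rewrite mulr_ge0 ?sqr_ge0// mulr_ge0// subr_ge0.
by nra.
Qed.

Lemma deficit_sqr (N : X -> R) x z : seminorm N ->
  ((N x - N z) / 2) ^+ 2 <= deficit (fun x => N x ^+ 2) x z.
Proof.
move=> hN; rewrite /deficit /midpoint hN.2 gtr0_norm ?invr_gt0//.
have := hN.1 x z; have := seminorm_ge0 x hN; have := seminorm_ge0 z hN.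
have := seminorm_ge0 (x + z) hN; set a := N x; set b := N z; set c := N (x + z).
by move=> c0 b0 a0 cab; nra.
Qed.

Lemma seminorm_norm : seminorm (fun x : X => `|x|).
Proof. by split; [exact: ler_normD|exact: normrZ]. Qed.

Lemma seminorm_dual (f : topdual X) : seminorm (fun x : X => `|f x : R|).
Proof.
by split=> [x y|a x]; rewrite ?dualD ?dualZ ?normrM//; exact: ler_normD.
Qed.

End SeminormSquare.

(** * Dyadically weighted series *)

Section WeightedSums.
Context {R : realType}.
Implicit Types (a : nat -> R).

Definition partial_sum n a : R := \sum_(k < n) 2^-1 ^+ k.+1 * a k.
Definition wsum a : R := supr setT (fun n => partial_sum n a).

Lemma half_small (e : R) : 0 < e -> exists n, 2^-1 ^+ n < e.
Proof.
move=> /ex_invn[n hn]; exists n; apply: le_lt_trans hn.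
rewrite exprVn lef_pV2 ?posrE ?exprn_gt0//.
by rewrite -natrX ler_nat ltn_expl.
Qed.

Lemma half_le (x y K : R) : (forall n, x <= y + K * 2^-1 ^+ n) -> x <= y.
Proof.
move=> h; apply/ler_addgt0Pr => e e0.
have K1 : 0 < `|K| + 1 by rewrite ltr_wpDl.
have [n hn] := half_small (divr_gt0 e0 K1); rewrite ltr_pdivlMr// in hn.
apply: le_trans (h n) _; rewrite lerD2l; apply: le_trans (ltW hn).
rewrite mulrC ler_wpM2l// ?exprn_ge0// ?invr_ge0//; have := ler_norm K; lra.
Qed.

Lemma half_gt0 n : 0 < (2^-1 : R) ^+ n.
Proof. by rewrite exprn_gt0// invr_gt0. Qed.

Variables (a : nat -> R) (B : R).
Hypothesis aB : forall k, 0 <= a k <= B.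

Lemma partial_sumS n : partial_sum n.+1 a = partial_sum n a + 2^-1 ^+ n.+1 * a n.
Proof. by rewrite /partial_sum big_ord_recr. Qed.

Lemma partial_sum_tail n m :
  partial_sum n a <= partial_sum (m + n) a <= partial_sum n a + B * (2^-1 ^+ n - 2^-1 ^+ (m + n)).
Proof.
elim: m => [|m /andP[h1 h2]]; first by rewrite add0n subrr mulr0 addr0 lexx.
rewrite addSn partial_sumS; have /andP[a0 ab] := aB (m + n)%N.
have w0 := half_gt0 (m + n).+1; have wS : (2^-1 : R) ^+ (m + n) = 2 * 2^-1 ^+ (m + n).+1.
  by rewrite [in RHS]exprS mulVKf ?pnatr_eq0.
rewrite wS in h2 *; apply/andP; split; first by nra.
by have := ler_wpM2l (ltW w0) ab; lra.
Qed.

Lemma wsum_approx n : partial_sum n a <= wsum a <= partial_sum n a + B * 2^-1 ^+ n.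
Proof.
have B0 : 0 <= B by have := aB 0; lra.
have ub m : partial_sum m a <= partial_sum n a + B * 2^-1 ^+ n.
  have [nm|/ltnW mn] := leqP n m.
    have /andP[_ h] := partial_sum_tail n (m - n); rewrite subnK// in h.
    apply: le_trans h _; rewrite lerD2l ler_wpM2l// lerBlDr lerDl.
    exact: ltW (half_gt0 _).
  have /andP[h _] := partial_sum_tail m (n - m); rewrite subnK// in h.
  apply: le_trans h _; rewrite lerDl mulr_ge0//; exact: ltW (half_gt0 _).
apply/andP; split.
  by apply: (@supr_ge _ _ setT (fun n => partial_sum n a) _ n (fun m _ => ub m)).
by apply: (@supr_le _ _ setT (fun n => partial_sum n a) _ 0%N) => // m _.
Qed.

Lemma wsum_bounds : 0 <= wsum a <= B.
Proof.
have := wsum_approx 0; rewrite /partial_sum big_ord0 expr0 mulr1 add0r => /andP[-> h].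
by [].
Qed.

End WeightedSums.

Section WeightedQuadratic.
Context {R : realType} {V : lmodType R}.
Variables (q : nat -> V -> R) (B : V -> R).
Hypothesis hq : forall k, quadratic (q k).
Hypothesis qB : forall k x, q k x <= B x.

Let qb x k : 0 <= q k x <= B x.
Proof. by rewrite (quad_ge0 (hq k)) qB. Qed.

Lemma quadratic_wsum : quadratic (fun x => wsum (q^~ x)).
Proof.
apply: (@quadratic_limit _ _ _ (fun n x => partial_sum n (q^~ x)) (fun n x => B x * 2^-1 ^+ n)).
- move=> n; rewrite /partial_sum.
  have -> : (fun x => \sum_(k < n) 2^-1 ^+ k.+1 * q k x) =
      (fun x => \sum_(k <- index_enum 'I_n) 2^-1 ^+ k.+1 * q k x) by [].
  apply: (quadratic_sum _ (q := fun (k : 'I_n) x => 2^-1 ^+ k.+1 * q k x)) => k.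
  by apply: quadraticZ => //; exact: ltW (half_gt0 _).
- by move=> n x; exact: wsum_approx.
move=> x y z d d0; pose K := `|B x| + `|B y| + `|B z| + 1.
have K0 : 0 < K by rewrite ltr_wpDl// !addr_ge0.
have [n hn] := half_small (divr_gt0 d0 K0); rewrite ltr_pdivlMr// in hn.
exists n; have w := half_gt0 (R := R) n.
have := ler_norm (B x); have := ler_norm (B y); have := ler_norm (B z).
have := normr_ge0 (B x); have := normr_ge0 (B y); have := normr_ge0 (B z).
move=> h1 h2 h3 h4 h5 h6; rewrite /K in hn.
by split; apply: le_lt_trans hn; rewrite mulrC ler_wpM2l ?ltW//; lra.
Qed.

(** The convexity gaps of all terms are nonnegative, so the gap of the sum dominates each of them;
    [half_le] removes the truncation error. *)
Lemma wsum_convex_gap (t : R) x z k : 0 <= t <= 1 ->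
  2^-1 ^+ k.+1 * (t * q k x + (1 - t) * q k z - q k (t *: x + (1 - t) *: z)) <=
  t * wsum (q^~ x) + (1 - t) * wsum (q^~ z) - wsum (q^~ (t *: x + (1 - t) *: z)).
Proof.
move=> /[dup] t01 /andP[t0 t1]; set m := t *: x + (1 - t) *: z.
apply: (@half_le _ _ _ (B m)) => n.
have {}t1 : 0 <= 1 - t by lra.
have gap j : 0 <= t * q j x + (1 - t) * q j z - q j m.
  by rewrite subr_ge0; exact: quad_convex.
pose N := (n + k.+1)%N.
have /andP[hx _] := wsum_approx (qb x) N; have /andP[hz _] := wsum_approx (qb z) N.
have /andP[_ hm] := wsum_approx (qb m) N.
have Bm : 0 <= B m by apply: le_trans (qB 0 m); exact: quad_ge0.
have hN : B m * 2^-1 ^+ N <= B m * 2^-1 ^+ n.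
  have hk : (2^-1 : R) ^+ k.+1 <= 1 by apply: exprn_ile1; lra.
  by rewrite ler_wpM2l// /N exprD ler_piMr// ltW// half_gt0.
have key : 2^-1 ^+ k.+1 * (t * q k x + (1 - t) * q k z - q k m) <=
    t * partial_sum N (q^~ x) + (1 - t) * partial_sum N (q^~ z) - partial_sum N (q^~ m).
  rewrite /partial_sum !mulr_sumr -big_split/= -sumrB.
  have kN : (k < N)%N by rewrite /N addnS ltnS leq_addl.
  rewrite (bigD1 (Ordinal kN))//=; apply: (@le_trans _ _ (t * (2^-1 ^+ k.+1 * q k x)
      + (1 - t) * (2^-1 ^+ k.+1 * q k z) - 2^-1 ^+ k.+1 * q k m)); first by lra.
  rewrite lerDl; apply: sumr_ge0 => i _.
  have := mulr_ge0 (ltW (half_gt0 (R := R) i.+1)) (gap i); lra.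
have := ler_wpM2l t0 hx; have := ler_wpM2l t1 hz; lra.
Qed.

Lemma deficit_wsum x z k :
  2^-1 ^+ k.+1 * deficit (q k) x z <= deficit (fun x => wsum (q^~ x)) x z.
Proof.
have h : 0 <= (2^-1 : R) <= 1 by rewrite invr_ge0 ler0n invf_le1// ler1n.
have := wsum_convex_gap x z k h; rewrite /deficit !midpointE; lra.
Qed.

End WeightedQuadratic.

Section TopSums.
Context {R : realType} {T : eqType}.

(** After cancelling common elements, [s] keeps at least as many terms as [s'], each at least [hi]
    against at most [lo]. *)
Lemma top_sum (u : T -> R) (s s' : seq T) (lo hi : R) : uniq s -> uniq s' ->
  0 <= lo <= hi -> (forall g, g \in s -> hi <= u g) ->
  (forall g, g \in s' -> g \notin s -> u g <= lo) -> (size s' <= size s)%N ->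
  (has [predC s'] s -> \sum_(g <- s') u g <= \sum_(g <- s) u g - (hi - lo)) /\
  \sum_(g <- s') u g <= \sum_(g <- s) u g.
Proof.
move=> us us' /andP[lo0 lohi] hu hl ss.
have common : \sum_(g <- s | g \in s') u g = \sum_(g <- s' | g \in s) u g.
  rewrite -big_filter -[RHS]big_filter; apply: perm_big; apply: uniq_perm.
  - exact: filter_uniq.
  - exact: filter_uniq.
  - by move=> g; rewrite !mem_filter andbC.
pose n := count [predC s'] s; pose m := count [predC s] s'.
have nm : (m <= n)%N.
  have h1 := count_predC (mem s') s; have h2 := count_predC (mem s) s'.
  have h3 : count (mem s') s = count (mem s) s'.
    rewrite -!size_filter; apply: perm_size; apply: uniq_perm.
    - exact: filter_uniq.
    - exact: filter_uniq.
    - by move=> g; rewrite !mem_filter andbC.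
  have -> : m = (size s' - count (mem s) s')%N by rewrite -h2 addKn.
  have -> : n = (size s - count (mem s') s)%N by rewrite -h1 addKn.
  by rewrite h3 leq_sub2r.
have low : hi *+ n <= \sum_(g <- s | g \notin s') u g.
  have -> : hi *+ n = \sum_(g <- s | g \notin s') hi.
    by rewrite big_const_seq iter_addr_0.
  rewrite big_seq_cond [leRHS]big_seq_cond.
  by apply: ler_sum => g /andP[gs _]; exact: hu.
have upp : \sum_(g <- s' | g \notin s) u g <= lo *+ m.
  have -> : lo *+ m = \sum_(g <- s' | g \notin s) lo.
    by rewrite big_const_seq iter_addr_0.
  rewrite big_seq_cond [leRHS]big_seq_cond.
  by apply: ler_sum => g /andP[gs gs']; exact: hl.
have E : \sum_(g <- s) u g = \sum_(g <- s' | g \in s) u g + \sum_(g <- s | g \notin s') u g.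
  by rewrite -common (bigID (mem s')).
have E' : \sum_(g <- s') u g = \sum_(g <- s' | g \in s) u g + \sum_(g <- s' | g \notin s) u g.
  by rewrite (bigID (mem s)).
have hnm : lo *+ m <= lo *+ n by rewrite ler_wpMn2l.
have hln : lo *+ n <= hi *+ n by rewrite lerMn2r lohi orbT.
split; last by rewrite E E'; lra.
rewrite has_count -/n => n0.
suff : lo *+ n <= hi *+ n - (hi - lo) by rewrite E E'; lra.
by case: n n0 {nm low hnm hln} => // n _; rewrite !mulrS; have : lo *+ n <= hi *+ n; [rewrite lerMn2r lohi orbT|lra].
Qed.

End TopSums.

(** * A locally uniformly rotund function *)

Section RotundFunction.
Context {R : realType} {X : normedModType R}.
Variables (Gamma : choiceType) (a : Gamma -> topdual X) (v : {fset Gamma} -> nat -> X).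
Hypothesis a_le : forall g x, `|a g x : R| <= `|x|.
Hypothesis a_total : forall x, (forall g, a g x = 0) -> x = 0.
Hypothesis v_dense : forall (x : X) (t0 e : R), 0 < t0 -> 0 < e ->
  exists (t u : R) (F : {fset Gamma}), [/\ t <= t0, 0 <= u < t,
    forall g, (g \in F) = (t <= `|a g x : R|),
    forall g, g \notin F -> `|a g x : R| <= u & exists j, `|x - v F j| < e].

Definition line (w : X) : set X := [set s *: w | s in [set: R]].

Lemma line0 w : line w 0.
Proof. by exists 0; rewrite ?scale0r. Qed.

Lemma line_dist w : seminorm (dist (line w)).
Proof.
apply: dist_seminorm; first exact: line0.
move=> b x y [s _ <-] [t _ <-]; exists (b * s + t) => //.
by rewrite scalerDl scalerA.
Qed.

Definition squares (F : {fset Gamma}) (x : X) : R := \sum_(g <- F) `|a g x : R| ^+ 2.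

(** A building block of Troyanski type: for large [kappa] the squares single out the finite set of
    large coordinates of [x], and the distance to the line through a nearby vector then recovers
    [x]. *)
Definition anchored (j kappa : nat) (F : {fset Gamma}) (x : X) : R :=
  kappa%:R * squares F x + dist (line (v F j)) x ^+ 2.

Definition small_sets n : set {fset Gamma} := [set F | (#|` F| <= n)%N].

Definition anchored_sup n j kappa x : R := supr (small_sets n) (fun F => anchored j kappa F x).

Lemma quadratic_squares F : quadratic (squares F).
Proof.
by apply: quadratic_sum => g; apply: (quadratic_sqr (seminorm_dual (a g))).
Qed.

Lemma quadratic_anchored j kappa F : quadratic (anchored j kappa F).
Proof.
apply: quadraticD; first by apply: quadraticZ => //; exact: quadratic_squares.
exact: quadratic_sqr (line_dist _).
Qed.

Lemma small_sets0 n : small_sets n fset0.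
Proof. by rewrite /small_sets /mkset cardfs0. Qed.

Lemma anchored_le n j kappa F x : small_sets n F ->
  anchored j kappa F x <= (kappa * n + 1)%:R * `|x| ^+ 2.
Proof.
move=> hF; rewrite natrD mulrDl mul1r natrM -mulrA lerD//.
  rewrite ler_wpM2l// /squares; apply: (@le_trans _ _ (#|` F|%:R * `|x| ^+ 2)).
    have -> : #|` F|%:R * `|x| ^+ 2 = \sum_(g <- F) `|x| ^+ 2.
      by rewrite big_const_seq iter_addr_0 count_predT mulr_natl.
    by apply: ler_sum => g _; rewrite ler_sqr ?nnegrE.
  by rewrite ler_wpM2r ?sqr_ge0// ler_nat.
have h := dist_le x (line0 (v F j)); rewrite subr0 in h.
by rewrite ler_sqr ?nnegrE// dist_ge0//; exact: line0.
Qed.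

Lemma quadratic_anchored_sup n j kappa : quadratic (anchored_sup n j kappa).
Proof.
apply: (quadratic_supr (B := fun x => (kappa * n + 1)%:R * `|x| ^+ 2) (small_sets0 n)) => [F _|F x hF]; first exact: quadratic_anchored.
exact: anchored_le.
Qed.

Definition level (k : nat) (x : X) : R :=
  let: (n, j, kappa) := odflt (0, 0, 0)%N (@choice.unpickle (nat * nat * nat)%type k) in
  (kappa * n + 1)%:R^-1 * anchored_sup n j kappa x.

Lemma quadratic_level k : quadratic (level k).
Proof.
rewrite /level; case: (odflt _ _) => [[n j] kappa].
by apply: quadraticZ; [rewrite invr_ge0|exact: quadratic_anchored_sup].
Qed.

Lemma level_le k x : level k x <= `|x| ^+ 2.
Proof.
rewrite /level; case: (odflt _ _) => [[n j] kappa].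
rewrite mulrC ler_pdivrMr ?ltr0n ?addn1// mulrC -addn1.
by apply: (supr_le (small_sets0 n)) => F hF; exact: anchored_le.
Qed.

Definition rotund (x : X) : R := `|x| ^+ 2 + wsum (level^~ x).

Lemma quadratic_rotund : quadratic rotund.
Proof.
apply: quadraticD; first exact: quadratic_sqr (@seminorm_norm _ X).
exact: (quadratic_wsum quadratic_level level_le).
Qed.

Lemma rotund_bounds x : `|x| ^+ 2 <= rotund x <= 2 * `|x| ^+ 2.
Proof.
have h k : 0 <= level k x <= `|x| ^+ 2.
  by rewrite level_le (quad_ge0 (quadratic_level k)).
by have := wsum_bounds h; rewrite /rotund; lra.
Qed.

Lemma deficit_rotund_norm x z : ((`|x| - `|z|) / 2) ^+ 2 <= deficit rotund x z.
Proof.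
have h := deficit_sqr x z (@seminorm_norm _ X).
have := deficit_ge0 x z (quadratic_wsum quadratic_level level_le).
by move: h; rewrite /deficit /rotund; lra.
Qed.

Lemma deficit_rotund_sup n j kappa x z :
  2^-1 ^+ (@choice.pickle (nat * nat * nat)%type (n, j, kappa)).+1 *
    ((kappa * n + 1)%:R^-1 * deficit (anchored_sup n j kappa) x z) <= deficit rotund x z.
Proof.
set k := choice.pickle _.
have h := deficit_wsum quadratic_level level_le x z k.
have E : deficit (level k) x z = (kappa * n + 1)%:R^-1 * deficit (anchored_sup n j kappa) x z.
  by rewrite /deficit /level /k choice.pickleK/=; ring.
rewrite E in h; apply: le_trans h _.
have := deficit_ge0 x z (quadratic_sqr (@seminorm_norm _ X)).
by rewrite /deficit /rotund; lra.
Qed.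

(** A set [G] nearly optimal at the midpoint must be [F]: any other one loses $1$ at [x], while the
    deficit permits a loss of at most $4\,th < 1$. *)
Lemma deficit_dominant n j kappa F x z (th : R) : small_sets n F ->
  (forall G, small_sets n G -> G != F -> anchored j kappa G x <= anchored j kappa F x - 1) ->
  0 < th -> th < 4^-1 -> deficit (anchored_sup n j kappa) x z <= th ->
  deficit (anchored j kappa F) x z <= 2 * th.
Proof.
move=> hF hG th0 th4 hd.
have ub G y : small_sets n G -> anchored j kappa G y <= anchored_sup n j kappa y.
  move=> nG; apply: (@supr_ge _ _ _ (fun F => anchored j kappa F y)) nG => F' hF'.
  exact: (anchored_le j kappa y hF').
have [G nG Gm] := @supr_adh _ _ (small_sets n) (fun F => anchored j kappa F (midpoint x z))
  ((kappa * n + 1)%:R * `|midpoint x z| ^+ 2) _ th (small_sets0 n)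
  (fun F' hF' => anchored_le j kappa _ hF') th0.
have h1 := ub G x nG; have h2 := ub G z nG.
have := deficit_ge0 x z (quadratic_anchored j kappa G).
move: hd Gm; rewrite /deficit -/(anchored_sup n j kappa (midpoint x z)) => hd Gm h3.
have [GF|GF] := eqVneq G F; first by subst G; lra.
have := hG G nG GF; have := ub F x hF; lra.
Qed.

Lemma squares_gap (F G : {fset Gamma}) x (t u : R) : 0 <= u < t ->
  (forall g, (g \in F) = (t <= `|a g x : R|)) ->
  (forall g, g \notin F -> `|a g x : R| <= u) -> (#|` G| <= #|` F|)%N -> G != F ->
  squares G x <= squares F x - (t ^+ 2 - u ^+ 2).
Proof.
move=> /andP[u0 ut] hF hu GF neq.
have [||||||h _] := @top_sum R Gamma (fun g => `|a g x : R| ^+ 2) F G (u ^+ 2) (t ^+ 2).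
- exact: fset_uniq.
- exact: fset_uniq.
- by rewrite sqr_ge0/= ler_sqr ?nnegrE//; lra.
- by move=> g; rewrite hF => h; rewrite ler_sqr ?nnegrE//; lra.
- by move=> g _ /hu h; rewrite ler_sqr ?nnegrE.
- by [].
apply: h; apply/hasP; apply: contrapT => nex; move/negP: neq; apply.
rewrite eq_sym eqEfcard GF andbT; apply/fsubsetP => g gF.
by apply: contrapT => gG; apply: nex; exists g => //=; exact/negP.
Qed.

(** Once [kappa] is large, the top set [F] of [x] dominates and the deficit passes to
    [anchored j kappa F]. Then [z] is close to the line through [V = v F j] and nearly shares with
    [x] the nonzero coordinate [g0], which fixes its position on that line. *)
Lemma rotund_LUR x (e : R) : 0 < e -> exists2 eta : R, 0 < eta &
  forall z, deficit rotund x z <= eta -> `|x - z| <= e.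
Proof.
move=> e0; have [->|x0] := eqVneq x 0.
  exists (e ^+ 2 / 4); first by rewrite divr_gt0// exprn_gt0.
  move=> z h; have := le_trans (deficit_rotund_norm 0 z) h.
  rewrite sub0r normrN normr0 => h1; have h2 : `|z| ^+ 2 <= e ^+ 2 by lra.
  by rewrite -ler_sqr ?nnegrE// ltW.
have [g0 g0x] : exists g, a g x != 0 :> R.
  apply: contrapT => hn; move/negP: x0; apply; apply/eqP/a_total => g.
  by apply/eqP; apply: contrapT => h; apply: hn; exists g; exact/negP.
pose c := `|a g0 x : R|; have c0 : 0 < c by rewrite normr_gt0.
have nx0 := normr_ge0 x.
(* The final estimate is $|x - z| \le ep + (8\,ep/c)(|x| + 1) + 2\,ep$, the terms bounding $|x -
   V|$, $|(1-s)V|$ and $|z - sV|$. *)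
pose ep : R := Num.min (Num.min (c / 2) 1) (e / (3 + 8 * (`|x| + 1) / c)).
have K0 : 0 < 3 + 8 * (`|x| + 1) / c by rewrite addr_gt0// divr_gt0//; lra.
have ep0 : 0 < ep by rewrite !lt_min !divr_gt0// ltr01.
have [t [u [F [tc ut hF hu [j xv]]]]] := v_dense x c0 ep0.
have [t2u2 t0] : 0 < t ^+ 2 - u ^+ 2 /\ 0 < t by have /andP[u0 ut'] := ut; split; nra.
have [kappa hk] := ex_natge ((`|x| ^+ 2 + 1) / (t ^+ 2 - u ^+ 2)).
rewrite ler_pdivrMr// in hk.
have k1 : 1 <= kappa%:R :> R.
  have : (0 < kappa)%N.
    by rewrite lt0n; apply/eqP => k0; move: hk; rewrite k0 mul0r; nra.
  by rewrite ler1n.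
pose n := #|` F|.
have nF : small_sets n F by rewrite /small_sets/=.
have dx y w : 0 <= dist (line w) y by apply: dist_ge0; exact: line0.
have dom G : small_sets n G -> G != F -> anchored j kappa G x <= anchored j kappa F x - 1.
  move=> nG GF; have := squares_gap ut hF hu nG GF.
  have := dist_le x (line0 (v G j)); rewrite subr0 => h1 h2.
  have h3 : dist (line (v G j)) x ^+ 2 <= `|x| ^+ 2 by rewrite ler_sqr ?nnegrE.
  have := sqr_ge0 (dist (line (v F j)) x); rewrite /anchored.
  have k0 : 0 <= kappa%:R :> R by [].
  by have := ler_wpM2l k0 h2; lra.
pose th : R := Num.min (ep ^+ 2 / 8) 8^-1.
have ep2 : 0 < ep ^+ 2 by exact: exprn_gt0.
have th0 : 0 < th by rewrite lt_min; apply/andP; split; lra.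
have th8 : th <= ep ^+ 2 / 8 by rewrite ge_min lexx.
have th4 : th < 4^-1 by apply: (@le_lt_trans _ _ 8^-1); [rewrite ge_min lexx orbT|lra].
pose w : R := 2^-1 ^+ (@choice.pickle (nat * nat * nat)%type (n, j, kappa)).+1 * (kappa * n + 1)%:R^-1.
have w0 : 0 < w by apply: mulr_gt0; [rewrite exprn_gt0// invr_gt0|rewrite invr_gt0 ltr0n addn1].
exists (w * th); first exact: mulr_gt0.
move=> z hz.
have hd : deficit (anchored_sup n j kappa) x z <= th.
  by rewrite -(ler_pM2l w0); apply: le_trans hz; rewrite -mulrA; exact: deficit_rotund_sup.
have hA := deficit_dominant nF dom th0 th4 hd.
have dS := deficit_ge0 x z (quadratic_squares F).
have dD := deficit_sqr x z (line_dist (v F j)).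
have dD0 := deficit_ge0 x z (quadratic_sqr (line_dist (v F j))).
have EA : deficit (anchored j kappa F) x z =
    kappa%:R * deficit (squares F) x z + deficit (fun x => dist (line (v F j)) x ^+ 2) x z.
  by rewrite /deficit /anchored; ring.
have g0F : g0 \in F by rewrite hF.
have hsq : ((a g0 x - a g0 z : R) / 2) ^+ 2 <= deficit (squares F) x z.
  have -> : deficit (squares F) x z = \sum_(g <- F) ((a g x - a g z : R) / 2) ^+ 2.
    rewrite /deficit /squares -big_split/= mulr_suml -sumrB; apply: eq_bigr => g _.
    by rewrite /midpoint dualZ dualD !real_normK ?num_real//; field.
  rewrite (big_fsetD1 g0)//= lerDl; apply: sumr_ge0 => g _; exact: sqr_ge0.
have e2 : 2 * th <= (ep / 2) ^+ 2 by rewrite expr_div_n; lra.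
have sq_le (r : R) : (r / 2) ^+ 2 <= 2 * th -> `|r| <= ep.
  move=> h; have h1 : r ^+ 2 <= ep ^+ 2 by have := le_trans h e2; lra.
  by rewrite -ler_sqr ?nnegrE ?(ltW ep0)// real_normK ?num_real.
have hg : `|a g0 x - a g0 z : R| <= ep.
  by apply: sq_le; apply: le_trans hsq _; nra.
have hD : `|dist (line (v F j)) x - dist (line (v F j)) z| <= ep.
  by apply: sq_le; apply: le_trans dD _; nra.
have Dx : dist (line (v F j)) x < ep.
  by apply: le_lt_trans xv; apply: dist_le; exists 1; rewrite ?scale1r.
have Dz : dist (line (v F j)) z < 2 * ep by move: hD; rewrite ler_norml; lra.
have r0 : 0 < 2 * ep - dist (line (v F j)) z by lra.
have [_ [s _ <-] zs] := dist_adh z (line0 (v F j)) r0.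
rewrite [X in _ < X]addrC subrK in zs.
set V := v F j in xv zs *.
have epc : ep <= c / 2 by rewrite !ge_min lexx.
have ep1 : ep <= 1 by rewrite !ge_min lexx !orbT.
have epe : ep * (3 + 8 * (`|x| + 1) / c) <= e.
  by rewrite -ler_pdivlMr// ge_min lexx orbT.
have aV : c / 2 <= `|a g0 V : R|.
  have h : `|(a g0 x : R) - a g0 V| <= `|x - V| by rewrite -dualB.
  have h2 : c <= `|(a g0 x : R) - a g0 V| + `|a g0 V : R|.
    by rewrite -[X in `|X| <= _](subrK (a g0 V : R)) ler_normD.
  by lra.
have hs : `|s - 1| * `|a g0 V : R| <= 4 * ep.
  rewrite -normrM.
  have -> : (s - 1) * a g0 V = - (a g0 (z - s *: V)) + - (a g0 x - a g0 z) + a g0 (x - V) :> R.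
    by rewrite !dualB dualZ; ring.
  have := a_le g0 (z - s *: V); have := a_le g0 (x - V).
  move=> h1 h2; apply: le_trans (ler_normD _ _) _.
  apply: le_trans (lerD (ler_normD _ _) (lexx _)) _; rewrite !normrN; lra.
have hs1 : `|s - 1| <= 8 * ep / c.
  rewrite ler_pdivlMr//; have := normr_ge0 (s - 1); nra.
have nV : `|V| <= `|x| + 1.
  by have := ler_normD (V - x) x; rewrite subrK distrC; lra.
have -> : x - z = (x - V) + (1 - s) *: V - (z - s *: V).
  by rewrite scalerBl scale1r opprB !addrA subrK subrK.
have h3 : `|(1 - s) *: V| <= 8 * ep / c * (`|x| + 1).
  by rewrite normrZ distrC; apply: ler_pM.
apply: le_trans (ler_normB _ _) _; have := ler_normD (x - V) ((1 - s) *: V).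
move: epe; have -> : ep * (3 + 8 * (`|x| + 1) / c) = 3 * ep + 8 * ep / c * (`|x| + 1) by ring.
lra.
Qed.

End RotundFunction.

(** * A strictly convex function on the dual *)

Section AffineArithmetic.
Context {R : realType}.

Lemma half_itv : 0 < (2^-1 : R) < 1. Proof. by lra. Qed.

Lemma two_thirds_itv : 0 < (2 / 3 : R) < 1. Proof. by lra. Qed.

Lemma half_average (a b : R) : 2^-1 * a + (1 - 2^-1) * b = (a + b) / 2.
Proof. by lra. Qed.

Lemma affine_coincide (a b : R) : 2^-1 * a + (1 - 2^-1) * b = 0 ->
  2 / 3 * a + (1 - 2 / 3) * b = 0 -> a = b.
Proof. by move=> h1 h2; apply/eqP; rewrite eq_le; apply/andP; split; lra. Qed.

(** Equality in convexity at the midpoint propagates along the segment. A second point matters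
    because [dual_rotund_flat] is silent where the combination vanishes; if it vanishes at both
    points, [affine_coincide] concludes. *)
Lemma two_thirds_flat (V : lmodType R) (q : V -> R) x y : quadratic q ->
  2^-1 * q x + (1 - 2^-1) * q y <= q (2^-1 *: x + (1 - 2^-1) *: y) ->
  2 / 3 * q x + (1 - 2 / 3) * q y <= q ((2 / 3) *: x + (1 - 2 / 3) *: y).
Proof.
move=> hq; set w := (2 / 3) *: x + (1 - 2 / 3) *: y.
have h34 : 0 <= (3 / 4 : R) <= 1 by lra.
have := quad_convex hq w y h34.
have -> : (3 / 4) *: w + (1 - 3 / 4) *: y = 2^-1 *: x + (1 - 2^-1) *: y.
  have c1 : 3 / 4 * (2 / 3) = 2^-1 :> R by lra.
  have c2 : 3 / 4 * (1 - 2 / 3) + (1 - 3 / 4) = 1 - 2^-1 :> R by lra.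
  by rewrite /w scalerDr !scalerA -addrA -scalerDl c1 c2.
lra.
Qed.

End AffineArithmetic.

Section DualFunction.
Context {R : realType} {X : normedModType R}.
Variable C : nat -> set X.
Variables (A : choiceType) (d : A -> nat -> X).
Hypothesis d_le : forall a n, `|d a n| <= 1.
Hypothesis d_fund : forall V, closed_subspace V -> (forall a n, V (d a n)) -> forall x, V x.
Hypothesis d_split : forall (g : topdual X) (a0 : A) (m : nat) (e : R), 0 < e ->
  exists l : seq nat, (forall i, i \in l -> C i (d a0 m)) /\
    exists s : seq A, forall a, a \notin s -> (forall i, i \in l -> C i (d a m)) ->
      `|g (d a m) : R| <= e.

Implicit Types (f g : topdual X).

Lemma dual_val_le f x : `|f x : R| <= `|f| * `|x|.
Proof. exact: dual_normP. Qed.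

Lemma dual_combE (a b : R) f g x : (a *: f + b *: g) x = a * f x + b * g x :> R.
Proof. by []. Qed.

Lemma dual_midE f g x : (midpoint f g) x = (f x + g x) / 2 :> R.
Proof. by have -> : (midpoint f g) x = 2^-1 * (f x + g x) :> R by []; rewrite mulrC. Qed.

Lemma seminorm_eval x : seminorm (fun f : topdual X => `|f x : R|).
Proof.
by split=> [f g|a f]; [exact: (ler_normD (f x : R) (g x))|exact: (normrM a (f x : R))].
Qed.

Definition dual_squares m (F : {fset A}) f : R := \sum_(a <- F) `|f (d a m) : R| ^+ 2.

(** By Sokolov's condition a suitable list [l] leaves only finitely many indices where a given
    functional is large, so the supremum below is attained at an explicit finite set. *)
Definition admissible m (l : seq nat) n : set {fset A} :=
  [set F | (#|` F| <= n)%N /\ forall a, a \in F -> forall i, i \in l -> C i (d a m)].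

Definition dual_sup m l n f : R := supr (admissible m l n) (fun F => dual_squares m F f).

Lemma admissible0 m l n : admissible m l n fset0.
Proof. by split=> [|a]; rewrite ?cardfs0// inE. Qed.

Lemma quadratic_dual_squares m F : quadratic (dual_squares m F).
Proof. by apply: quadratic_sum => a; exact: quadratic_sqr (seminorm_eval _). Qed.

Lemma dual_squares_le m l n F f : admissible m l n F ->
  dual_squares m F f <= n.+1%:R * `|f| ^+ 2.
Proof.
move=> [Fn _]; apply: (@le_trans _ _ (\sum_(a <- F) `|f| ^+ 2)).
  apply: ler_sum => a _; rewrite ler_sqr ?nnegrE//.
  apply: le_trans (dual_val_le f (d a m)) _.
  by rewrite -[leRHS]mulr1 ler_wpM2l.
rewrite big_const_seq iter_addr_0 count_predT mulr_natl.
by rewrite ler_wpMn2l ?sqr_ge0// leqW.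
Qed.

Lemma quadratic_dual_sup m l n : quadratic (dual_sup m l n).
Proof.
apply: (quadratic_supr (B := fun f => n.+1%:R * `|f| ^+ 2) (admissible0 m l n)) => [F _|F f hF].
  exact: quadratic_dual_squares.
exact: dual_squares_le hF.
Qed.

Definition dual_level (k : nat) f : R :=
  let: (m, l, n) := odflt (0, [::], 0)%N (@choice.unpickle (nat * seq nat * nat)%type k) in
  n.+1%:R^-1 * dual_sup m l n f.

Lemma quadratic_dual_level k : quadratic (dual_level k).
Proof.
rewrite /dual_level; case: (odflt _ _) => [[m l] n].
by apply: quadraticZ; [rewrite invr_ge0|exact: quadratic_dual_sup].
Qed.

Lemma dual_level_le k f : dual_level k f <= `|f| ^+ 2.
Proof.
rewrite /dual_level; case: (odflt _ _) => [[m l] n].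
rewrite mulrC ler_pdivrMr ?ltr0n// mulrC.
by apply: (supr_le (admissible0 m l n)) => F hF; exact: dual_squares_le hF.
Qed.

Definition dual_rotund f : R := `|f| ^+ 2 + wsum (dual_level^~ f).

Let hw := quadratic_wsum quadratic_dual_level dual_level_le.
Let hn := quadratic_sqr (@seminorm_norm _ (topdual X)).

Lemma quadratic_dual_rotund : quadratic dual_rotund.
Proof. exact: quadraticD hn hw. Qed.

Lemma dual_level_bounds f k : 0 <= dual_level k f <= `|f| ^+ 2.
Proof. by rewrite dual_level_le (quad_ge0 (quadratic_dual_level k)). Qed.

Lemma dual_rotund_bounds f : `|f| ^+ 2 <= dual_rotund f <= 2 * `|f| ^+ 2.
Proof. by have := wsum_bounds (dual_level_bounds f); rewrite /dual_rotund; lra. Qed.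

(** Let [F] collect the indices, within the sets given by the splitting, where [w] is at least $c =
    |w(d_{a_0 m})|$ in modulus. It attains the supremum at [w] among admissible sets of its size.
    Equality in convexity descends to this level and then to [F], where strict convexity of the
    square gives agreement at [a0]. *)
Lemma dual_rotund_flat (t : R) l1 l2 a0 m : 0 < t < 1 ->
  t * dual_rotund l1 + (1 - t) * dual_rotund l2 <= dual_rotund (t *: l1 + (1 - t) *: l2) ->
  (t *: l1 + (1 - t) *: l2) (d a0 m) != 0 :> R -> l1 (d a0 m) = l2 (d a0 m).
Proof.
set w := t *: l1 + (1 - t) *: l2 => /andP[t0 t1] flat w0.
have t01 : 0 <= t <= 1 by lra.
pose c := `|w (d a0 m) : R|; have c0 : 0 < c by rewrite normr_gt0.
have c2 : 0 < c / 2 by lra.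
have [l [hl [s hs]]] := d_split w a0 m c2.
pose F := [fset a in s | `[< forall i, i \in l -> C i (d a m) >] && (c <= `|w (d a m) : R|)]%fset.
have FE a : (a \in F) = [&& a \in s, `[< forall i, i \in l -> C i (d a m) >] & c <= `|w (d a m) : R|].
  by rewrite !inE.
have a0F : a0 \in F.
  rewrite FE lexx andbT; apply/andP; split; last exact/asboolP.
  by apply: contrapT => /negP /hs /(_ hl); rewrite -/c; lra.
pose n := #|` F|.
have aF : admissible m l n F.
  by split=> [|a]; [exact: leqnn|rewrite FE => /and3P[_ /asboolP]].
have c2_0 : 0 <= c ^+ 2 <= c ^+ 2 by rewrite lexx sqr_ge0.
have topF G : admissible m l n G -> dual_squares m G w <= dual_squares m F w.
  move=> [Gn Gl]; have [|||||| _] := @top_sum R A (fun a => `|w (d a m) : R| ^+ 2) F G (c ^+ 2) (c ^+ 2).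
  - exact: fset_uniq.
  - exact: fset_uniq.
  - exact: c2_0.
  - by move=> a; rewrite FE => /and3P[_ _ h]; rewrite ler_sqr ?nnegrE// ltW.
  - move=> a aG; rewrite FE => h; rewrite ler_sqr ?nnegrE ?(ltW c0)//.
    have Ca := Gl a aG; have [as_|as_] := boolP (a \in s).
      by move: h; rewrite as_/= negb_and => /orP[/asboolP//|]; rewrite -ltNge => /ltW.
    by apply: le_trans (hs _ as_ Ca) _; lra.
  - exact: Gn.
  - by [].
have ub l' G : admissible m l n G -> dual_squares m G l' <= dual_sup m l n l'.
  move=> hG; apply: (@supr_ge _ _ _ (fun F => dual_squares m F l')) hG => F' hF'.
  exact: (dual_squares_le l' hF').
have supw : dual_sup m l n w <= dual_squares m F w by exact: supr_le aF topF.
pose k := @choice.pickle (nat * seq nat * nat)%type (m, l, n).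
have := wsum_convex_gap quadratic_dual_level dual_level_le l1 l2 k t01; rewrite -/w => gap.
have ngap : `|w| ^+ 2 <= t * `|l1| ^+ 2 + (1 - t) * `|l2| ^+ 2 by exact: (quad_convex hn l1 l2 t01).
have {}gap : 2^-1 ^+ k.+1 * (t * dual_level k l1 + (1 - t) * dual_level k l2 - dual_level k w) <= 0.
  apply: le_trans gap _.
  by move: flat; rewrite /dual_rotund; lra.
have lev l' : dual_level k l' = n.+1%:R^-1 * dual_sup m l n l'.
  by rewrite /dual_level /k choice.pickleK.
rewrite !lev pmulr_rle0 in gap; last by rewrite exprn_gt0// invr_gt0.
have {}gap : t * dual_sup m l n l1 + (1 - t) * dual_sup m l n l2 - dual_sup m l n w <= 0.
  have n0 : 0 < (n.+1%:R^-1 : R) by rewrite invr_gt0.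
  rewrite -(pmulr_rle0 _ n0); apply: le_trans gap.
  by rewrite mulrBr mulrDr (mulrCA _ t) (mulrCA _ (1 - t)).
have h1 := ub l1 F aF; have h2 := ub l2 F aF.
have E : t * dual_squares m F l1 + (1 - t) * dual_squares m F l2 - dual_squares m F w =
    t * (1 - t) * \sum_(a <- F) (l1 (d a m) - l2 (d a m) : R) ^+ 2.
  rewrite /dual_squares !mulr_sumr -big_split -sumrB/=; apply: eq_bigr => a _.
  rewrite !real_normK ?num_real//; set p : R := l1 _; set q : R := l2 _.
  suff : t * p ^+ 2 + (1 - t) * q ^+ 2 - (t * p + (1 - t) * q) ^+ 2 =
    t * (1 - t) * (p - q) ^+ 2 by [].
  by ring.
have tt0 : 0 < t * (1 - t) by rewrite mulr_gt0//; lra.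
have ge0 : 0 <= 1 - t by lra.
have := ler_wpM2l (ltW t0) h1; have := ler_wpM2l ge0 h2 => h4 h3.
have sum0 : \sum_(a <- F) (l1 (d a m) - l2 (d a m) : R) ^+ 2 <= 0.
  by rewrite -(pmulr_rle0 _ tt0) -E; lra.
move: sum0; rewrite (big_fsetD1 a0)//= => sum0.
have r0 : 0 <= \sum_(a <- (F `\ a0)%fset) (l1 (d a m) - l2 (d a m) : R) ^+ 2.
  by apply: sumr_ge0 => a _; exact: sqr_ge0.
have : (l1 (d a0 m) - l2 (d a0 m) : R) ^+ 2 <= 0 by lra.
by rewrite le_eqVlt ltNge sqr_ge0 orbF sqrf_eq0 subr_eq0 => /eqP.
Qed.

Lemma dual_rotund_strict l1 l2 : deficit dual_rotund l1 l2 <= 0 -> l1 = l2.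
Proof.
move=> hd; have hq := quadratic_dual_rotund.
suff h a m : l1 (d a m) = l2 (d a m).
  apply/val_inj/funext => x /=; apply/eqP; rewrite -subr_eq0; apply/eqP.
  pose V x := (l1 x - l2 x : R) = 0; suff : V x by [].
  apply: d_fund => [|a n]; last by rewrite /V h subrr.
  split=> [|b y z Vy Vz|y hy]; first by rewrite /V !dual0 subrr.
    rewrite /V !dualD !dualZ.
    have -> : b * l1 y + l1 z - (b * l2 y + l2 z) = b * (l1 y - l2 y) + (l1 z - l2 z) :> R by ring.
    by rewrite Vy Vz mulr0 addr0.
  apply: eq_small => e e0; have K0 : 0 < `|l1 - l2| + 1 by rewrite ltr_wpDl.
  have [z Vz yz] := hy _ (divr_gt0 e0 K0); rewrite ltr_pdivlMr// in yz.
  have -> : l1 y - l2 y - 0 = (l1 - l2) (y - z) :> R.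
    have -> : (l1 - l2) (y - z) = l1 (y - z) - l2 (y - z) :> R by [].
    rewrite !dualB subr0; have -> : l1 z = l2 z by apply/eqP; rewrite -subr_eq0; apply/eqP.
    by ring.
  apply: le_lt_trans (dual_val_le _ _) _; apply: le_lt_trans yz.
  by rewrite mulrC ler_wpM2l// lerDl.
have flat (t : R) : 0 < t < 1 ->
    t * dual_rotund l1 + (1 - t) * dual_rotund l2 <= dual_rotund (t *: l1 + (1 - t) *: l2) ->
    (t *: l1 + (1 - t) *: l2) (d a m) = 0 :> R \/ l1 (d a m) = l2 (d a m).
  move=> t01 ht; have [->|h0] := eqVneq ((t *: l1 + (1 - t) *: l2) (d a m) : R) 0; first by left.
  by right; exact: dual_rotund_flat t01 ht h0.
have hd' : (dual_rotund l1 + dual_rotund l2) / 2 <= dual_rotund (midpoint l1 l2).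
  by move: hd; rewrite /deficit subr_le0.
have {}hd : 2^-1 * dual_rotund l1 + (1 - 2^-1) * dual_rotund l2 <=
    dual_rotund (2^-1 *: l1 + (1 - 2^-1) *: l2).
  by rewrite -midpointE; apply: le_trans hd'; rewrite half_average.
have [e1|e1] := flat _ half_itv hd; last exact: e1.
have [e2|e2] := flat _ two_thirds_itv (two_thirds_flat hq hd); last exact: e2.
by rewrite !dual_combE in e1 e2; exact: affine_coincide e1 e2.
Qed.

(** A substitute for weak-star lower semicontinuity: [Phi] is a supremum of finite positive
    combinations of squared evaluations at points of $X$. *)
Definition finitely_approximable (Phi : topdual X -> R) := forall l (eta : R), 0 < eta ->
  exists L : seq (R * X), [/\ forall p, p \in L -> 0 <= p.1,
    forall f, \sum_(p <- L) p.1 * (f p.2 : R) ^+ 2 <= Phi f &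
    Phi l <= \sum_(p <- L) p.1 * (l p.2 : R) ^+ 2 + eta].

Lemma fin_eval x : finitely_approximable (fun f => `|f x : R| ^+ 2).
Proof.
move=> l eta eta0; exists [:: (1, x)]; split=> [p|f|].
- by rewrite inE => /eqP->.
- by rewrite big_seq1 mul1r real_normK ?num_real.
- by rewrite big_seq1 mul1r real_normK ?num_real// lerDl ltW.
Qed.

Lemma fin_norm : finitely_approximable (fun f => `|f| ^+ 2).
Proof.
move=> l eta eta0; have N0 := normr_ge0 l.
have K0 : 0 < 2 * `|l| + 1 by lra.
have [_ [x x1 <-] hx] := sup_adherent (divr_gt0 eta0 K0) (dual_bounded l).
have {}hx : `|l| - eta / (2 * `|l| + 1) < `|l x : R| by exact: hx.
have lx : `|l x : R| <= `|l| by exact: dual_norm_ub.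
exists [:: (1, x)]; split=> [p|f|].
- by rewrite inE => /eqP->.
- rewrite big_seq1 mul1r -[f x ^+ 2]real_normK ?num_real// ler_sqr ?nnegrE//.
  exact: dual_norm_ub.
rewrite big_seq1 mul1r -[(l x : R) ^+ 2]real_normK ?num_real//.
set u := `|l x : R| in hx lx *; set N := `|l| in N0 K0 hx lx *.
have u0 : 0 <= u by exact: normr_ge0.
have e1 : eta / (2 * N + 1) * (2 * N + 1) = eta by rewrite divfK// gt_eqF.
set q := eta / _ in hx e1; nra.
Qed.

Lemma fin_add Phi Psi : finitely_approximable Phi -> finitely_approximable Psi ->
  finitely_approximable (fun f => Phi f + Psi f).
Proof.
move=> h1 h2 l eta eta0; have e2 : 0 < eta / 2 by lra.
have [L [L0 LP Ll]] := h1 l _ e2; have [M [M0 MP Ml]] := h2 l _ e2.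
exists (L ++ M); split=> [p|f|]; first by rewrite mem_cat => /orP[/L0|/M0].
  by rewrite big_cat/= lerD.
by rewrite big_cat/=; lra.
Qed.

Lemma fin_scale (c : R) Phi : 0 <= c -> finitely_approximable Phi ->
  finitely_approximable (fun f => c * Phi f).
Proof.
move=> c0 h l eta eta0; have c1 : 0 < c + 1 by lra.
have [L [L0 LP Ll]] := h l _ (divr_gt0 eta0 c1).
have E f : \sum_(p <- [seq (c * p.1, p.2) | p <- L]) p.1 * (f p.2 : R) ^+ 2 =
    c * \sum_(p <- L) p.1 * (f p.2 : R) ^+ 2.
  by rewrite big_map mulr_sumr; apply: eq_bigr => p _; rewrite mulrA.
exists [seq (c * p.1, p.2) | p <- L]; split=> [_ /mapP[p /L0 p0 ->]|f|].
- exact: mulr_ge0.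
- by rewrite E ler_wpM2l.
rewrite E; apply: le_trans (ler_wpM2l c0 Ll) _.
rewrite mulrDr lerD2l mulrA ler_pdivrMr// mulrC ler_wpM2l ?ltW//; lra.
Qed.

Lemma fin_sum (I : Type) (s : seq I) (Phi : I -> topdual X -> R) :
  (forall i, finitely_approximable (Phi i)) ->
  finitely_approximable (fun f => \sum_(i <- s) Phi i f).
Proof.
move=> h; elim: s => [|i s IH].
  move=> l eta eta0; exists [::]; split=> [//|f|]; first by rewrite !big_nil.
  by rewrite !big_nil add0r ltW.
have -> : (fun f => \sum_(i <- i :: s) Phi i f) = (fun f => Phi i f + \sum_(i <- s) Phi i f).
  by apply/funext => f; rewrite big_cons.
exact: fin_add.
Qed.

Lemma fin_sup (I : Type) (D : set I) (Phi : I -> topdual X -> R) (B : topdual X -> R) i0 :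
  D i0 -> (forall i, D i -> finitely_approximable (Phi i)) ->
  (forall i f, D i -> Phi i f <= B f) ->
  finitely_approximable (fun f => supr D (fun i => Phi i f)).
Proof.
move=> Di0 h PB l eta eta0; have e2 : 0 < eta / 2 by lra.
have [i Di hi] := @supr_adh _ _ D (fun i => Phi i l) (B l) i0 _ Di0 (fun i => PB i l) e2.
have [L [L0 LP Ll]] := h i Di l _ e2; exists L; split=> // [f|]; last by lra.
apply: le_trans (LP f) _.
exact: (@supr_ge _ _ D (fun i => Phi i f) (B f) i (fun i => PB i f) Di).
Qed.

Lemma fin_dual_rotund : finitely_approximable dual_rotund.
Proof.
have flev k : finitely_approximable (dual_level k).
  rewrite /dual_level; case: (odflt _ _) => [[m l] n].
  apply: fin_scale; first by rewrite invr_ge0.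
  apply: (fin_sup (B := fun f => n.+1%:R * `|f| ^+ 2) (admissible0 m l n)) => [F _|F f hF].
    by apply: fin_sum => a; exact: fin_eval.
  exact: dual_squares_le hF.
apply: fin_add; first exact: fin_norm.
move=> l eta eta0; have e2 : 0 < eta / 2 by lra.
have K0 : 0 < `|l| ^+ 2 + 1 by rewrite ltr_wpDl// sqr_ge0.
have [n hnn] := half_small (divr_gt0 e2 K0); rewrite ltr_pdivlMr// in hnn.
have : finitely_approximable (fun f => partial_sum n (dual_level^~ f)).
  rewrite /partial_sum.
  apply: (fin_sum _ (Phi := fun (k : 'I_n) f => 2^-1 ^+ k.+1 * dual_level k f)) => k.
  by apply: fin_scale => //; rewrite exprn_ge0// invr_ge0.
move=> /(_ l _ e2)[L [L0 LP Ll]]; exists L; split=> // [f|].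
  apply: le_trans (LP f) _; by have /andP[] := wsum_approx (dual_level_bounds f) n.
have /andP[_ h] := wsum_approx (dual_level_bounds l) n.
have h2 : `|l| ^+ 2 * 2^-1 ^+ n <= eta / 2.
  apply: le_trans (ltW hnn); rewrite mulrC ler_wpM2l// ?lerDl//.
  by rewrite exprn_ge0// invr_ge0.
lra.
Qed.

(** The Fenchel preconjugate of half of [dual_rotund]. *)
Definition predual (x : X) : R := supr setT (fun f : topdual X => f x - dual_rotund f / 2).

Lemma predual_bound f x : f x - dual_rotund f / 2 <= `|x| ^+ 2 / 2.
Proof.
have /andP[h _] := dual_rotund_bounds f; have := dual_val_le f x.
have := ler_norm (f x : R); have := normr_ge0 f; have := normr_ge0 x.
have := sqr_ge0 (`|f| - `|x|); nra.
Qed.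

Lemma predual_ge f x : f x - dual_rotund f / 2 <= predual x.
Proof.
apply: (@supr_ge _ _ setT (fun f : topdual X => f x - dual_rotund f / 2) (`|x| ^+ 2 / 2) f _ I).
by move=> g _; exact: predual_bound.
Qed.

Lemma predual_le x (c : R) : (forall f, f x - dual_rotund f / 2 <= c) -> predual x <= c.
Proof. by move=> h; apply: (@supr_le _ _ setT _ c 0 I) => f _; exact: h. Qed.

Lemma predual_bounds x : `|x| ^+ 2 / 4 <= predual x <= `|x| ^+ 2 / 2.
Proof.
apply/andP; split; last by apply: predual_le => f; exact: predual_bound.
pose f : topdual X := (`|x| / 2) *: nu x.
have nu1 : `|nu x| <= 1.
  by apply: dual_norm_le => z z1; apply: le_trans (nu_le x z) z1.
have fn : `|f| <= `|x| / 2.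
  by rewrite normrZ ger0_norm ?divr_ge0// -[leRHS]mulr1 ler_wpM2l// divr_ge0.
have fx : f x = `|x| ^+ 2 / 2 :> R.
  have -> : f x = `|x| / 2 * nu x x :> R by [].
  by rewrite nuE; ring.
have /andP[_ h] := dual_rotund_bounds f; have := predual_ge f x; rewrite fx.
have : `|f| ^+ 2 <= (`|x| / 2) ^+ 2 by rewrite ler_sqr ?nnegrE// divr_ge0.
lra.
Qed.

Lemma quadratic_predual : quadratic predual.
Proof.
have hq := quadratic_dual_rotund.
have ge0 x : 0 <= predual x.
  by have /andP[h _] := predual_bounds x; apply: le_trans h; rewrite divr_ge0// sqr_ge0.
have leZ (a : R) x : a != 0 -> predual (a *: x) <= a ^+ 2 * predual x.
  move=> a0; apply: predual_le => f.
  have := predual_ge (a^-1 *: f) x; rewrite (quadZ hq).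
  have -> : (a^-1 *: f) x = a^-1 * f x :> R by [].
  rewrite dualZ => /(ler_wpM2l (sqr_ge0 a)); apply: le_trans.
  suff -> : a * f x - dual_rotund f / 2 =
    a ^+ 2 * (a^-1 * f x - a^-1 ^+ 2 * dual_rotund f / 2) :> R by [].
  by field.
split=> // [a x|t x y /andP[t0 t1]].
  have [->|a0] := eqVneq a 0.
    rewrite scale0r expr0n mul0r; apply/eqP; rewrite eq_le ge0 andbT.
    by have /andP[_] := predual_bounds 0; rewrite normr0 expr0n mul0r.
  apply/eqP; rewrite eq_le leZ//=.
  rewrite -ler_pdivlMl ?exprn_even_gt0// -exprVn.
  have := leZ a^-1 (a *: x); rewrite scalerA mulVf// scale1r; apply.
  by rewrite invr_eq0.
apply: predual_le => f; rewrite dualD !dualZ.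
have h : 0 <= 1 - t by lra.
have := ler_wpM2l t0 (predual_ge f x); have := ler_wpM2l h (predual_ge f y); lra.
Qed.

(* The finite quadratic approximation of [dual_rotund] provides an explicit almost   *)
(* maximizer, which replaces weak* compactness in the biconjugation argument.         *)
Lemma predual_conjugate l (eta : R) : 0 < eta ->
  exists z, dual_rotund l / 2 - eta <= l z - predual z.
Proof.
move=> eta0; have [L [L0 LP Ll]] := fin_dual_rotund l eta0.
pose z := \sum_(p <- L) (p.1 * l p.2) *: p.2; exists z.
have zE f : f z = \sum_(p <- L) p.1 * ((l p.2 : R) * f p.2) :> R.
  rewrite /z; elim: (L) => [|p M IH]; first by rewrite !big_nil dual0.
  by rewrite !big_cons dualD dualZ IH mulrA.
have gz : predual z <= (\sum_(p <- L) p.1 * (l p.2 : R) ^+ 2) / 2.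
  apply: predual_le => f; have := LP f; rewrite zE.
  suff : \sum_(p <- L) p.1 * ((l p.2 : R) * f p.2) <=
     (\sum_(p <- L) p.1 * (l p.2 : R) ^+ 2) / 2 + (\sum_(p <- L) p.1 * (f p.2 : R) ^+ 2) / 2 by lra.
  rewrite !mulr_suml -big_split/= big_seq [leRHS]big_seq; apply: ler_sum => p pL.
  have := mulr_ge0 (L0 p pL) (sqr_ge0 ((l p.2 : R) - f p.2)); lra.
rewrite zE; under eq_bigr do rewrite -expr2; lra.
Qed.

(** By duality, two approximate subgradients at one point give near-equality in the convexity of
    [dual_rotund]; its strict convexity then forces subgradients to coincide. *)
Lemma predual_deficit (w : X) (l1 l2 : topdual X) (e : R) :
  (forall z, predual w + l1 (z - w) - e <= predual z) ->
  (forall z, predual w + l2 (z - w) - e <= predual z) ->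
  deficit dual_rotund l1 l2 <= 2 * e.
Proof.
move=> h1 h2; apply/ler_addgt0Pr => eta eta0; have e2 : 0 < eta / 2 by lra.
have [z1 hz1] := predual_conjugate l1 e2; have [z2 hz2] := predual_conjugate l2 e2.
have := h1 z1; have := h2 z2; rewrite !dualB => h3 h4.
have := predual_ge (midpoint l1 l2) w; rewrite dual_midE /deficit; lra.
Qed.

End DualFunction.

(** * Smooth regularization *)

Lemma midpoint_reflect (R : realType) (V : lmodType R) (x v : V) :
  midpoint (x + v) (x - v) = x.
Proof.
have E : x + x = 2 *: x by rewrite scaler_nat mulr2n.
by rewrite /midpoint addrACA subrr addr0 E scalerA mulVf ?pnatr_eq0// scale1r.
Qed.

Section Smoothness.
Context {R : realType} {X : normedModType R}.
Implicit Types (q : X -> R).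

Definition smooth_at q x := forall d (e : R), 0 < e -> exists2 t0 : R, 0 < t0 &
  forall t : R, 0 < t < t0 -> q (x + t *: d) + q (x - t *: d) - 2 * q x <= e * t.

Definition convex_fun q := forall (t : R) x y, 0 <= t <= 1 ->
  q (t *: x + (1 - t) *: y) <= t * q x + (1 - t) * q y.

Lemma smooth_add q r x : smooth_at q x -> smooth_at r x -> smooth_at (fun x => q x + r x) x.
Proof.
move=> hq hr d e e0; have e2 : 0 < e / 2 by lra.
have [t1 t10 h1] := hq d _ e2; have [t2 t20 h2] := hr d _ e2.
exists (Num.min t1 t2); first by rewrite lt_min t10.
move=> t; rewrite lt_min => /and3P[t0 tt1 tt2].
by have := h1 t; have := h2 t; rewrite t0 tt1 tt2 => /(_ isT) ? /(_ isT) ?; lra.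
Qed.

Lemma smooth_scale q (c : R) x : 0 <= c -> smooth_at q x -> smooth_at (fun x => c * q x) x.
Proof.
move=> c0 hq d e e0; have c1 : 0 < c + 1 by lra.
have [t1 t10 h1] := hq d _ (divr_gt0 e0 c1); exists t1 => // t tt.
have /(ler_wpM2l c0) := h1 t tt.
have /andP[tt0 _] := tt; have kE : e / (c + 1) * (c + 1) = e by rewrite divfK// gt_eqF.
have k0 : 0 < e / (c + 1) by rewrite divr_gt0.
set k := e / (c + 1) in kE k0 *; have := mulr_gt0 k0 tt0; rewrite -kE.
lra.
Qed.

Lemma convex_slope q x v (s t : R) : convex_fun q -> 0 < t -> t <= s ->
  (q (x + t *: v) - q x) / t <= (q (x + s *: v) - q x) / s.
Proof.
move=> hq t0 ts; have s0 : 0 < s by exact: lt_le_trans ts.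
rewrite ler_pdivrMr//; have ts01 : 0 <= t / s <= 1.
  by apply/andP; split; [exact: divr_ge0 (ltW t0) (ltW s0)|rewrite ler_pdivrMr// mul1r].
have := hq (t / s) (x + s *: v) x ts01.
have -> : (t / s) *: (x + s *: v) + (1 - t / s) *: x = x + t *: v.
  rewrite scalerDr scalerA divfK ?gt_eqF// scalerBl scale1r.
  by rewrite [LHS]addrC addrA subrK.
move=> h; have -> : (q (x + s *: v) - q x) / s * t = t / s * (q (x + s *: v) - q x) by ring.
lra.
Qed.

Lemma convex_reflect q x v (t : R) : convex_fun q -> 0 < t ->
  q x - q (x - v) <= (q (x + t *: v) - q x) / t.
Proof.
move=> hq t0; have t1 : 0 < 1 + t by lra.
have t01 : 0 <= (1 + t)^-1 <= 1.
  by apply/andP; split; [rewrite invr_ge0 (ltW t1)|rewrite invf_le1//; lra].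
have := hq (1 + t)^-1 (x + t *: v) (x - v) t01.
have t1n : 1 + t != 0 by rewrite gt_eqF.
have -> : (1 + t)^-1 *: (x + t *: v) + (1 - (1 + t)^-1) *: (x - v) = x.
  have -> : 1 - (1 + t)^-1 = (1 + t)^-1 * t by field.
  rewrite -scalerA -scalerDr scalerBr addrACA addrN addr0.
  have -> : x + t *: x = (1 + t) *: x by rewrite scalerDl scale1r.
  by rewrite scalerA mulVf// scale1r.
move=> /(ler_wpM2l (ltW t1)); rewrite ler_pdivlMr//.
have -> : (1 + t) * ((1 + t)^-1 * q (x + t *: v) + (1 - (1 + t)^-1) * q (x - v)) =
  q (x + t *: v) + t * q (x - v) by field.
lra.
Qed.

(** The one-sided derivative [D] at [x] is sublinear, and Hahn-Banach produces subgradients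
    attaining it at [d] and at [- d]. When they coincide, $D(d) + D(-d) = 0$. *)
Lemma smooth_of_unique_subgradient q x (K : R) : convex_fun q ->
  (forall v, `|v| <= 1 -> q (x + v) <= K) ->
  (forall l1 l2 : topdual X, (forall v, q x + l1 v <= q (x + v)) ->
     (forall v, q x + l2 v <= q (x + v)) -> l1 = l2) -> smooth_at q x.
Proof.
move=> hq qK huniq.
pose slope v t := (q (x + t *: v) - q x) / t.
pose D v : R := infr [set t : R | 0 < t] (slope v).
have Dle v t : 0 < t -> D v <= slope v t.
  move=> t0; apply: (@infr_le _ _ [set t : R | 0 < t] (slope v) (q x - q (x - v)) t) => //.
  by move=> s s0; exact: convex_reflect.
have Dadh v e : 0 < e -> exists2 t, 0 < t & slope v t < D v + e.
  move=> e0; apply: (@infr_adh _ _ [set t : R | 0 < t] (slope v) (q x - q (x - v)) 1) => //=.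
  by move=> s s0; exact: convex_reflect.
have Dge v c : (forall t, 0 < t -> c <= slope v t) -> c <= D v.
  by move=> h; apply: (@infr_ge _ _ [set t : R | 0 < t] (slope v) c 1) => //=.
have D0 : D 0 = 0.
  have s0 t : slope 0 t = 0 by rewrite /slope scaler0 addr0 subrr mul0r.
  apply/eqP; rewrite eq_le; apply/andP; split; first by have := Dle 0 1 ltr01; rewrite s0.
  by apply: Dge => t _; rewrite s0.
have hD : sublinear D.
  split=> [v w|c v].
    apply/ler_addgt0Pr => e e0; have e2 : 0 < e / 2 by lra.
    have [s s0 hs] := Dadh v _ e2; have [s' s0' hs'] := Dadh w _ e2.
    pose t := Num.min s s'; have t0 : 0 < t by rewrite lt_min s0.
    have t2 : 0 < t / 2 by lra.
    have ts : t <= s by rewrite ge_min lexx.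
    have ts' : t <= s' by rewrite ge_min lexx orbT.
    have h1 := convex_slope x v hq t0 ts; have h2 := convex_slope x w hq t0 ts'.
    have h12 : 0 <= (2^-1 : R) <= 1 by lra.
    have := hq 2^-1 (x + t *: v) (x + t *: w) h12.
    have -> : 2^-1 *: (x + t *: v) + (1 - 2^-1) *: (x + t *: w) = x + (t / 2) *: (v + w).
      have -> : 1 - 2^-1 = 2^-1 :> R by lra.
      have E : x + t *: v + (x + t *: w) = 2 *: x + t *: (v + w).
        by rewrite addrACA -mulr2n -scaler_nat scalerDr.
      by rewrite -scalerDr E scalerDr !scalerA mulVf ?pnatr_eq0// scale1r [2^-1 * t]mulrC.
    move=> h3; have := Dle (v + w) _ t2; rewrite /slope ler_pdivlMr//.
    move: h1 h2 hs hs'; rewrite /slope => h1 h2 hs hs'.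
    have {}h1 := le_lt_trans h1 hs; have {}h2 := le_lt_trans h2 hs'.
    rewrite ltr_pdivrMr// in h1; rewrite ltr_pdivrMr// in h2.
    move=> h4; have t2p : 0 < t by [].
    rewrite -(ler_pM2r t2); lra.
  have pos (b : R) u : 0 < b -> D (b *: u) <= b * D u.
    move=> b0; rewrite mulrC -ler_pdivrMr//; apply: Dge => t t0.
    rewrite ler_pdivrMr//; have tb : 0 < t / b by rewrite divr_gt0.
    apply: le_trans (Dle (b *: u) _ tb) _; rewrite /slope scalerA divfK ?gt_eqF//.
    rewrite le_eqVlt; apply/orP; left; apply/eqP; field.
    by rewrite !gt_eqF.
  rewrite le_eqVlt => /orP[/eqP<-|c0]; first by rewrite scale0r D0 mul0r.
  apply/eqP; rewrite eq_le pos//= -ler_pdivlMl//.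
  rewrite -{1}(scale1r v) -(mulVf (lt0r_neq0 c0)) -scalerA.
  by apply: pos; rewrite invr_gt0.
have DC v : D v <= (K - q x) * `|v|.
  have [->|v0] := eqVneq v 0; first by rewrite D0 normr0 mulr0.
  have nv : 0 < `|v| by rewrite normr_gt0.
  have -> : D v = `|v| * D (`|v|^-1 *: v).
    by rewrite -hD.2 ?ltW// scalerA divff ?scale1r// gt_eqF.
  rewrite mulrC ler_wpM2r//; apply: le_trans (Dle _ 1 ltr01) _.
  rewrite /slope divr1 scale1r lerD2r; apply: qK.
  by rewrite normrZ normfV normr_id mulVf// gt_eqF.
move=> d e e0.
have [l1 l1D l1d] := dual_dominated d hD DC.
have [l2 l2D l2d] := dual_dominated (- d) hD DC.
have sub l : (forall v, l v <= D v) -> forall v, q x + l v <= q (x + v).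
  move=> h v; have := h v; have := Dle v 1 ltr01; rewrite /slope divr1 scale1r; lra.
have E := huniq l1 l2 (sub _ l1D) (sub _ l2D).
have DD : D d + D (- d) = 0 by rewrite -l1d -l2d -E dualN subrr.
have e2 : 0 < e / 2 by lra.
have [s s0 hs] := Dadh d _ e2; have [s' s0' hs'] := Dadh (- d) _ e2.
exists (Num.min s s'); first by rewrite lt_min s0.
move=> t; rewrite lt_min => /and3P[t0 ts ts'].
have h1 := le_lt_trans (convex_slope x d hq t0 (ltW ts)) hs.
have h2 := le_lt_trans (convex_slope x (- d) hq t0 (ltW ts')) hs'.
rewrite ltr_pdivrMr// in h1; rewrite ltr_pdivrMr// scalerN in h2.
have : (D d + D (- d)) * t = 0 by rewrite DD mul0r.
lra.
Qed.

End Smoothness.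

(** * Infimal convolutions: smoothness and preservation of LUR *)

Section Regularization.
Context {R : realType} {X : normedModType R}.
Variables (p g : X -> R).
Hypothesis hp : quadratic p.
Hypothesis p_bounds : forall x, `|x| ^+ 2 <= p x <= 2 * `|x| ^+ 2.
Hypothesis p_LUR : forall x (e : R), 0 < e -> exists2 eta : R, 0 < eta &
  forall z, deficit p x z <= eta -> `|x - z| <= e.
Hypothesis hg : quadratic g.
Hypothesis g_bounds : forall x, `|x| ^+ 2 / 4 <= g x <= `|x| ^+ 2 / 2.
Hypothesis g_subgradient : forall l1 l2 : topdual X,
  (forall e : R, 0 < e -> exists w, forall z,
     g w + l1 (z - w) - e <= g z /\ g w + l2 (z - w) - e <= g z) -> l1 = l2.

Definition infconv (j : nat) (x : X) : R :=
  infr setT (fun u => p u + j.+1%:R * g (x - u)).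

Let j0 (j : nat) : 0 < (j.+1%:R : R). Proof. by rewrite ltr0n. Qed.

Lemma infconv_le j x u : infconv j x <= p u + j.+1%:R * g (x - u).
Proof.
apply: (@infr_le _ _ setT (fun u => p u + j.+1%:R * g (x - u)) 0 u _ I) => w _.
by rewrite addr_ge0 ?(quad_ge0 hp)// mulr_ge0// (quad_ge0 hg).
Qed.

Lemma infconv_adh j x (e : R) : 0 < e ->
  exists u, p u + j.+1%:R * g (x - u) < infconv j x + e.
Proof.
move=> e0; have [|u _ hu] := @infr_adh _ _ setT (fun u => p u + j.+1%:R * g (x - u)) 0 0 e I _ e0.
  by move=> w _; rewrite addr_ge0 ?(quad_ge0 hp)// mulr_ge0// (quad_ge0 hg).
by exists u.
Qed.

Lemma infconv_ge j x (c : R) : (forall u, c <= p u + j.+1%:R * g (x - u)) -> c <= infconv j x.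
Proof. by move=> h; apply: (@infr_ge _ _ setT _ c 0 I) => u _; exact: h. Qed.

Lemma infconv_p j x : infconv j x <= p x.
Proof. by have := infconv_le j x x; rewrite subrr (quad0 hg) mulr0 addr0. Qed.

Lemma quadratic_infconv j : quadratic (infconv j).
Proof.
have ge0 x : 0 <= infconv j x.
  by apply: infconv_ge => u; rewrite addr_ge0 ?(quad_ge0 hp)// mulr_ge0// (quad_ge0 hg).
have leZ (a : R) x : a != 0 -> infconv j (a *: x) <= a ^+ 2 * infconv j x.
  move=> a0; have a2 : 0 < a ^+ 2 by rewrite exprn_even_gt0.
  rewrite mulrC -ler_pdivrMr//; apply: infconv_ge => u; rewrite ler_pdivrMr//.
  apply: le_trans (infconv_le j (a *: x) (a *: u)) _.
  by rewrite -scalerBr (quadZ hp) (quadZ hg); lra.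
split=> // [a x|t x y t01].
  have [->|a0] := eqVneq a 0.
    rewrite scale0r expr0n mul0r; apply/eqP; rewrite eq_le ge0 andbT.
    by have := infconv_p j 0; rewrite (quad0 hp).
  apply/eqP; rewrite eq_le leZ//= -ler_pdivlMl ?exprn_even_gt0// -exprVn.
  have := leZ a^-1 (a *: x); rewrite scalerA mulVf// scale1r; apply.
  by rewrite invr_eq0.
have /andP[t0 t1] := t01; have {}t1 : 0 <= 1 - t by lra.
apply/ler_addgt0Pr => e e0.
have [u hu] := infconv_adh j x e0; have [v hv] := infconv_adh j y e0.
apply: le_trans (infconv_le j _ (t *: u + (1 - t) *: v)) _.
have -> : t *: x + (1 - t) *: y - (t *: u + (1 - t) *: v) = t *: (x - u) + (1 - t) *: (y - v).
  by rewrite !scalerBr opprD addrACA.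
have := quad_convex hp u v t01.
have /(ler_wpM2l (ltW (j0 j))) := quad_convex hg (x - u) (y - v) t01.
have := ler_wpM2l t0 (ltW hu); have := ler_wpM2l t1 (ltW hv).
lra.
Qed.

(* Splitting x = lambda (u / lambda) + (1 - lambda) ((x - u) / (1 - lambda)) with lambda = (j+1)/(j+9). *)
Lemma p_infconv j x : p x - infconv j x <= 8 / j.+1%:R * p x.
Proof.
have [J JE J0] : exists2 J : R, J = j.+1%:R & 0 < J by exists j.+1%:R.
have J8 : 0 < J + 8 by lra.
have Jn : J != 0 by rewrite gt_eqF.
have J8n : J + 8 != 0 by rewrite gt_eqF.
pose lam := J / (J + 8); pose mu := 8 / (J + 8).
have l0 : 0 < lam by rewrite divr_gt0.
have m0 : 0 < mu by rewrite divr_gt0.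
have muE : 1 - lam = mu by rewrite /lam /mu; field.
have l01 : 0 <= lam <= 1 by lra.
have key : lam * p x <= infconv j x.
  apply: infconv_ge => u.
  have := quad_convex hp (lam^-1 *: u) (mu^-1 *: (x - u)) l01.
  rewrite muE !scalerA !divff ?gt_eqF// !scale1r [u + _]addrC subrK !(quadZ hp).
  move=> /(ler_wpM2l (ltW l0)) h; apply: le_trans h _.
  have /andP[_ h1] := p_bounds (x - u); have /andP[h2 _] := g_bounds (x - u).
  have h3 : p (x - u) <= 8 * g (x - u) by lra.
  have -> : lam * (lam * (lam^-1 ^+ 2 * p u) + mu * (mu^-1 ^+ 2 * p (x - u))) =
      p u + J / 8 * p (x - u).
    by rewrite /lam /mu; field; rewrite Jn J8n.
  by rewrite lerD2l -JE; have := ler_wpM2l (ltW J0) h3; lra.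
have p0 := quad_ge0 hp x.
have h : mu <= 8 / J by rewrite ler_pM2l// lef_pV2 ?posrE//; lra.
have E : lam * p x = p x - mu * p x by rewrite -muE; ring.
by have := ler_wpM2r p0 h; rewrite -JE; lra.
Qed.

Lemma smooth_infconv j x : smooth_at (infconv j) x.
Proof.
have hq := quadratic_infconv j.
apply: (@smooth_of_unique_subgradient _ _ _ _ (2 * (`|x| + 1) ^+ 2)).
- exact: quad_convex hq.
- move=> v v1; apply: le_trans (infconv_p j _) _.
  have /andP[_ h] := p_bounds (x + v); apply: le_trans h _.
  have h2 : `|x + v| <= `|x| + 1 by have := ler_normD x v; lra.
  by rewrite ler_wpM2l// ler_sqr ?nnegrE// addr_ge0.
move=> l1 l2 h1 h2.
have J0 := j0 j; set J : R := j.+1%:R in J0.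
suff E : J^-1 *: l1 = J^-1 *: l2.
  by rewrite -[l1]scale1r -(divff (lt0r_neq0 J0)) -scalerA E scalerA divff ?gt_eqF// scale1r.
(* For a near-minimizer [u], a subgradient of the convolution at [x], divided by [J], is an
   [e]-subgradient of [g] at $x - u$. *)
apply: g_subgradient => e e0; have Je : 0 < J * e by rewrite mulr_gt0.
have [u hu] := infconv_adh j x Je; exists (x - u) => z.
have key l : (forall v, infconv j x + l v <= infconv j (x + v)) ->
    g (x - u) + (J^-1 *: l) (z - (x - u)) - e <= g z.
  move=> hl; have := hl (z - (x - u)); have := infconv_le j (x + (z - (x - u))) u.
  have -> : x + (z - (x - u)) - u = z.
    by rewrite opprB [z + _]addrC [x + _]addrA [x + _]addrC subrK addrAC subrr add0r.
  rewrite -/J in hu *; move=> h3 h4.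
  have -> : (J^-1 *: l) (z - (x - u)) = J^-1 * l (z - (x - u)) :> R by [].
  rewrite -(ler_pM2l J0) mulrBr mulrDr mulVKf ?gt_eqF//; lra.
by split; [exact: (key l1 h1)|exact: (key l2 h2)].
Qed.

Definition regular (x : X) : R := wsum (fun j => infconv j x).

Let infconv_bd x k : 0 <= infconv k x <= p x.
Proof. by rewrite infconv_p (quad_ge0 (quadratic_infconv k)). Qed.

Lemma quadratic_regular : quadratic regular.
Proof. exact: (quadratic_wsum quadratic_infconv infconv_p). Qed.

Lemma regular_bounds x : `|x| ^+ 2 / 18 <= regular x <= 2 * `|x| ^+ 2.
Proof.
have /andP[p1 p2] := p_bounds x.
have /andP[h1 h2] := wsum_bounds (infconv_bd x); rewrite -/(regular x) in h1 h2.
apply/andP; split; last by lra.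
have /andP[h3 _] := wsum_approx (infconv_bd x) 1; rewrite -/(regular x) in h3.
rewrite /partial_sum big_ord1 expr1 in h3.
(* With j = 0 the splitting constant is lambda = 1/9. *)
have h4 : p x / 9 <= infconv 0 x.
  apply: infconv_ge => u; rewrite mul1r.
  have l01 : 0 <= (9^-1 : R) <= 1 by lra.
  have := quad_convex hp (9 *: u) ((9 / 8) *: (x - u)) l01.
  rewrite !scalerA; have -> : 9^-1 * 9 = 1 :> R by lra.
  have -> : (1 - 9^-1) * (9 / 8) = 1 :> R by lra.
  rewrite !scale1r [u + _]addrC subrK !(quadZ hp).
  have /andP[_ h5] := p_bounds (x - u); have /andP[h6 _] := g_bounds (x - u).
  lra.
lra.
Qed.

(** Partial sums are smooth. By convexity the second differences of every term are at most $tK$, so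
    the tail contributes at most $tK$ times a small sum of weights. *)
Lemma smooth_regular x : smooth_at regular x.
Proof.
move=> d e e0; pose K := p (x + d) + p (x - d).
have K0 : 0 <= K by rewrite addr_ge0// (quad_ge0 hp).
have e2 : 0 < e / 2 by lra.
have K1 : 0 < K + 1 by lra.
have [N hN] := half_small (divr_gt0 e2 K1); rewrite ltr_pdivlMr// in hN.
have hs : smooth_at (fun x => partial_sum N (fun j => infconv j x)) x.
  elim: N {hN} => [|N IH].
    move=> d' e' e0'; exists 1 => // t /andP[t0 _].
    by rewrite /partial_sum !big_ord0 mulr0 subr0 addr0 mulr_ge0// ltW.
  have -> : (fun x => partial_sum N.+1 (fun j => infconv j x)) =
      (fun x => partial_sum N (fun j => infconv j x) + 2^-1 ^+ N.+1 * infconv N x).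
    by apply/funext => y; rewrite partial_sumS.
  apply: smooth_add => //; apply: smooth_scale; last exact: smooth_infconv.
  by rewrite exprn_ge0// invr_ge0.
have [t0 t00 ht0] := hs d _ e2.
exists (Num.min t0 1); first by rewrite lt_min t00 ltr01.
move=> t; rewrite lt_min => /and3P[tt0 tt00 tt1].
pose D k := infconv k (x + t *: d) + infconv k (x - t *: d) - 2 * infconv k x.
have DK k : 0 <= D k <= t * K.
  have hc := quad_convex (quadratic_infconv k).
  apply/andP; split.
    have := deficit_ge0 (x + t *: d) (x - t *: d) (quadratic_infconv k).
    by rewrite /deficit midpoint_reflect /D; lra.
  have := convex_slope x d hc tt0 (ltW tt1); have := convex_slope x (- d) hc tt0 (ltW tt1).
  rewrite !ler_pdivrMr// !divr1 !scale1r scalerN /D => h1 h2.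
  have := quad_ge0 (quadratic_infconv k) x => h3.
  have := ler_wpM2l (ltW tt0) (infconv_p k (x + d)).
  have := ler_wpM2l (ltW tt0) (infconv_p k (x - d)).
  have := mulr_ge0 (ltW tt0) h3.
  rewrite /K; lra.
have ED n : partial_sum n D = partial_sum n (fun j => infconv j (x + t *: d)) +
    partial_sum n (fun j => infconv j (x - t *: d)) - 2 * partial_sum n (fun j => infconv j x).
  rewrite /partial_sum mulr_sumr -big_split -sumrB/=; apply: eq_bigr => i _.
  by rewrite /D; ring.
have hNt : partial_sum N D <= e / 2 * t by rewrite ED; apply: ht0; rewrite tt0.
apply: (@half_le _ _ _ (p (x + t *: d) + p (x - t *: d))) => m.
pose n := (m + N)%N.
have /andP[_ hx1] := wsum_approx (infconv_bd (x + t *: d)) n.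
have /andP[_ hx2] := wsum_approx (infconv_bd (x - t *: d)) n.
have /andP[hx3 _] := wsum_approx (infconv_bd x) n.
have /andP[_ htail] := partial_sum_tail DK N m.
rewrite -/(regular _) in hx1 hx2 hx3.
have P0 : 0 <= p (x + t *: d) + p (x - t *: d) by rewrite addr_ge0// (quad_ge0 hp).
have hm : 2^-1 ^+ n <= 2^-1 ^+ m :> R.
  by rewrite /n exprD ler_piMr ?exprn_ge0 ?invr_ge0//; apply: exprn_ile1; lra.
have /(ler_wpM2l P0) := hm.
have n0 : 0 <= 2^-1 ^+ n :> R by rewrite exprn_ge0// invr_ge0.
have hKt : t * K * (2^-1 ^+ N - 2^-1 ^+ (m + N)) <= e / 2 * t.
  apply: (@le_trans _ _ (t * (2^-1 ^+ N * (K + 1)))); last by have := ler_wpM2l (ltW tt0) (ltW hN); lra.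
  rewrite -mulrA ler_wpM2l ?(ltW tt0)// mulrC.
  have N0 : 0 <= 2^-1 ^+ N :> R by rewrite exprn_ge0// invr_ge0.
  by have := mulr_ge0 K0 n0; rewrite /n; lra.
move=> hP; rewrite -/n in hKt htail; rewrite (ED n) in htail.
move: hx1 hx2 hx3 htail hKt hNt hP; rewrite /regular; lra.
Qed.

(** Apply convexity to the midpoint written as $\frac13(\frac32 x) + \frac23(\frac34 z)$. *)
Lemma quad_growth (q : X -> R) x z : quadratic q -> q z <= 8 * deficit q x z + 2 * q x.
Proof.
move=> hq; have h : 0 <= (3^-1 : R) <= 1 by lra.
have := quad_convex hq ((3 / 2) *: x) ((3 / 4) *: z) h.
rewrite !(quadZ hq) !scalerA /deficit /midpoint scalerDr.
have -> : 3^-1 * (3 / 2) = 2^-1 :> R by lra.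
have -> : (1 - 3^-1) * (3 / 4) = 2^-1 :> R by lra.
lra.
Qed.

(** A bounded deficit keeps [z] in a bounded set, on which [infconv j] is uniformly close to [p]; so
    the deficit of [p] becomes small too. *)
Lemma regular_LUR x (e : R) : 0 < e -> exists2 eta : R, 0 < eta &
  forall z, deficit regular x z <= eta -> `|x - z| <= e.
Proof.
move=> e0; have [eta eta0 heta] := p_LUR x e0.
(* This bounds $p(x) + p(z)$, since $p(z) \le 2|z|^2 \le 36\,regular(z)$ and [quad_growth] applies
   with deficit at most $1$. *)
pose B := p x + 36 * (8 + 2 * regular x).
have hr := quadratic_regular.
have B0 : 0 < B.
  by have := quad_ge0 hp x; have := quad_ge0 hr x; rewrite /B; lra.
have c0 : 0 < eta / 2 / (4 * B) by rewrite !divr_gt0// mulr_gt0.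
have [j hj] := ex_invn c0; rewrite ltr_pdivlMr ?mulr_gt0// in hj.
pose w : R := 2^-1 ^+ j.+1; have w0 : 0 < w by rewrite exprn_gt0// invr_gt0.
exists (Num.min 1 (w * (eta / 2))).
  by rewrite lt_min ltr01 mulr_gt0// divr_gt0.
move=> z; rewrite le_min => /andP[hz1 hz2]; apply: heta.
have hd : deficit (infconv j) x z <= eta / 2.
  rewrite -(ler_pM2l w0); apply: le_trans hz2.
  exact: (deficit_wsum quadratic_infconv infconv_p x z j).
have hz := quad_growth x z hr.
have /andP[_ hpz] := p_bounds z; have /andP[hrz _] := regular_bounds z.
have pB : p x + p z <= B by rewrite /B; lra.
have h1 := p_infconv j x; have h2 := p_infconv j z; have h3 := infconv_p j (midpoint x z).
have h4 : 8 / j.+1%:R * (p x + p z) <= eta.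
  have J0 : 0 <= (8 / j.+1%:R : R) by rewrite divr_ge0.
  apply: le_trans (ler_wpM2l J0 pB) _.
  have -> : eta = 2 * (eta / 2) by field.
  have -> : 8 / j.+1%:R * B = 2 * (j.+1%:R^-1 * (4 * B)) by ring.
  by rewrite ler_pM2l//; exact: ltW.
have := lerD h1 h2; rewrite -mulrDr => /le_trans /(_ h4) h12.
move: hd; rewrite /deficit; lra.
Qed.

End Regularization.

(** * Separated null sequences *)

Section NullSequences.
Context {R : realType} {X : normedModType R}.

Lemma dyadic_64 : 64^-1 + 64^-1 <= 32^-1 :> R.
Proof. by lra. Qed.

(** To add a vector [v] outside [V], take [f] vanishing on [V] with $f(v) \ne 0$: the new subspace
    is the preimage of [V] under the bounded map $z \mapsto z - (f(z)/f(v)) v$, hence closed. *)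
Lemma finite_closed_subspace (s : seq X) : exists V : set X,
  [/\ closed_subspace V, forall x, x \in s -> V x
    & forall x, V x -> exists c : nat -> R, x = \sum_(i < size s) c i *: s`_i].
Proof.
elim: s => [|v s [V [hV sV Vs]]].
  exists [set 0]; split=> // [|x ->]; last by exists (fun=> 0); rewrite big_ord0.
  split=> // [a x y -> ->|x hx]; first by rewrite scaler0 addr0.
  apply/eqP; rewrite -normr_le0; apply: (@le0_small _ _ 1) => // e e0.
  by have [_ -> h] := hx _ e0; rewrite subr0 in h; rewrite mul1r ltW.
have [Vv|nVv] := pselect (V v).
  exists V; split=> // [x|x /Vs[c ->]].
    by rewrite inE => /orP[/eqP->|/sV].
  exists (fun i => if i is i'.+1 then c i' else 0).
  by rewrite big_ord_recl/= scale0r add0r.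
have [f fV fv] := separating_functional hV nVv.
have [V0 VD Vcl] := hV.
pose T z := z - (f z / f v) *: v.
have TL (a : R) x y : T (a *: x + y) = a *: T x + T y.
  rewrite /T dualD dualZ mulrDl scalerDl -mulrA -scalerA scalerBr opprD.
  by rewrite addrACA.
exists (T @^-1` V); split.
- split.
  + by rewrite /preimage/= /T dual0 mul0r scale0r subrr.
  + by move=> a x y Tx Ty; rewrite /preimage/= TL; exact: VD.
  + move=> x hx; apply: Vcl => e e0.
    pose K := 1 + `|f| / `|f v : R| * `|v|.
    have K0 : 0 < K.
      by rewrite /K ltr_wpDr// mulr_ge0// divr_ge0.
    have [y Ty xy] := hx _ (divr_gt0 e0 K0); exists (T y) => //.
    have -> : T x - T y = T (x - y) by rewrite addrC -scaleN1r -TL scaleN1r addrC.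
    rewrite ltr_pdivlMr// in xy; apply: le_lt_trans xy.
    apply: le_trans (ler_normB _ _) _; rewrite /K mulrDr mulr1 lerD2l.
    rewrite normrZ normrM normfV mulrA [_ * (`|f| / _)]mulrA ler_wpM2r//.
    by rewrite ler_wpM2r ?invr_ge0// mulrC; exact: dual_normP.
- move=> x; rewrite inE /preimage/= => /orP[/eqP->|xs].
    by rewrite /T divff// scale1r subrr.
  by rewrite /T (fV x (sV _ xs)) mul0r scale0r subr0; exact: sV.
move=> x /Vs[c hc]; exists (fun i => if i is i'.+1 then c i' else f x / f v).
by rewrite big_ord_recl/= -hc addrC subrK.
Qed.

Variable C : nat -> set X.
Hypothesis CX : determining C.
Hypothesis Xinf : infinite_dimensional X.

(** A Josefson-Nissenzweig sequence. Let [P] project onto the closure of a countable set enumerated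
    by [m]. The functional [g n] factors through [P] and kills the first [n] points of [m], so the
    sequence tends to $0$ on that set, by density on the range of [P], and thus everywhere. *)
Lemma null_sequence : exists (g : nat -> topdual X) (y : nat -> X),
  [/\ forall n x, `|g n x : R| <= `|x|, forall n, `|y n| <= 1,
      forall n, 2^-1 <= g n (y n) :> R &
      forall x (e : R), 0 < e -> exists N, forall n, (N <= n)%N -> `|g n x : R| <= e].
Proof.
have /choice[V hV] := finite_closed_subspace.
have /choice[esc hesc] : forall s, exists x, ~ V s x.
  move=> s; apply: contrapT => hn; apply: (Xinf (b := fun i : 'I_(size s) => s`_i)) => x.
  have [_ _ Vs] := hV s; have Vx : V s x by apply: contrapT => nVx; apply: hn; exists x.
  by have [c ->] := Vs x Vx; exists (fun i => c i).
have hT : closed_subspace [set: X] by split.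
have [op [_ opM]] := reflecting_ops C hT.
(* Index [0] is given to [esc], so that [M] is not contained in the span of any finite list of its
   points. *)
pose op' n (s : seq X) := if n is n'.+1 then op n' s else esc s.
pose phi (t : GenTree.tree unit) : X := 0.
pose M := gen op' phi predT.
have hM : reflecting C setT M by apply: opM => // c s hs; exact: (@gen_op _ _ _ op' phi predT c.+1 s hs).
pose m n := gen_eval op' phi (odflt (GenTree.Leaf tt) (choice.unpickle n)).
have leavesT (t : GenTree.tree unit) : leaves_in predT t.
  by elim/tree_induction: t => [//|n ts IH] /=; apply/allP.
have mM n : M (m n) by exact: gen_evalP.
have Mm x : M x -> exists n, m n = x.
  move=> /gen_small[t _ <-]; exists (choice.pickle t).
  by rewrite /m choice.pickleK.
pose P := proj M.
have PL (a : R) x y : P (a *: x + y) = a *: P x + P y by exact: (projL CX _ hT hM).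
have Pn x : `|P x| <= `|x| by exact: (proj_norm CX hM).
have Pid x : adherent M x -> P x = x by exact: (proj_id CX hM).
have Padh x : adherent M (P x) by case: (projP CX hM (I : setT x)).
have key n : exists gy : topdual X * X, [/\ forall x, `|gy.1 x : R| <= `|x|, `|gy.2| <= 1,
    2^-1 <= gy.1 gy.2 :> R, forall x, gy.1 (P x) = gy.1 x &
    forall k, (k < n)%N -> gy.1 (m k) = 0].
  pose s := [seq m k | k <- iota 0 n]; pose v := esc s.
  have [hVs sV _] := hV s.
  have Mv : M v.
    by apply: (@gen_op _ _ _ op' phi predT 0 s) => _ /mapP[k _ ->]; exact: mM.
  have [f fV fv] := separating_functional hVs (hesc s).
  have [||h hE] := @bounded_dual _ _ (fun x => f (P x)) `|f|.
  - by move=> a x y; rewrite PL dualD dualZ.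
  - move=> x; apply: le_trans (dual_normP f _) _.
    exact: (ler_wpM2l (normr_ge0 f) (Pn x)).
  have hv : h v = f v by rewrite hE Pid//; exact: adherent_sub.
  have h0 : 0 < `|h|.
    rewrite normr_gt0; apply: contraNneq fv => h0; rewrite -hv h0.
    by apply/eqP.
  have h2 : 0 < `|h| / 2 by rewrite divr_gt0.
  have [_ [y y1 <-] hy] := sup_adherent h2 (dual_bounded h).
  have {}hy : `|h| / 2 < `|h y : R|.
    have : `|h| - `|h| / 2 < `|h y : R| by exact: hy.
    by have -> : `|h| - `|h| / 2 = `|h| / 2 by field.
  have [g gE] : exists g : topdual X, forall x, g x = `|h|^-1 * h x :> R.
    by exists (`|h|^-1 *: h).
  exists (g, Num.sg (h y : R) *: y); split=> /=.
  - move=> x; rewrite gE normrM gtr0_norm ?invr_gt0// mulrC ler_pdivrMr//.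
    by rewrite mulrC; exact: dual_normP.
  - rewrite normrZ; apply: le_trans y1; rewrite -[leRHS]mul1r ler_wpM2r//.
    by rewrite normr_sg lern1 leq_b1.
  - have h3 : 2^-1 <= `|h|^-1 * `|h y : R|.
      by rewrite ler_pdivlMl// ltW.
    by apply: le_trans h3 _; rewrite le_eqVlt gE dualZ -normrEsg eqxx.
  - by move=> x; rewrite !gE !hE Pid.
  - move=> k kn; rewrite gE hE Pid; last by apply: adherent_sub.
    rewrite fV ?mulr0//; apply: sV; apply: map_f; rewrite mem_iota add0n.
    exact: kn.
have /choice[gy hgy] := key.
exists (fun n => (gy n).1), (fun n => (gy n).2); split.
- by move=> n; have [] := hgy n.
- by move=> n; have [] := hgy n.
- by move=> n; have [] := hgy n.
move=> x e e0; have [a Ma xa] := Padh x _ e0.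
have [k hk] := Mm a Ma; exists k.+1 => n kn.
have [h1 _ _ h4 h5] := hgy n.
rewrite -h4 -[P x](subrK a) dualD -hk h5// addr0 hk.
by apply: le_trans (h1 _) _; exact: ltW.
Qed.

(** After projecting onto the kernel of [f0], take differences of vectors at which every earlier
    functional is close to its limit along an ultrafilter: earlier functionals are then small on
    them. Choosing the new functional far out in the null sequence makes it small on earlier
    vectors. *)
Lemma separated_sequences : exists (x0 : X) (f0 : topdual X) (g : nat -> topdual X) (y : nat -> X),
  [/\ `|x0| = 1 /\ f0 x0 = 1, forall x, `|f0 x : R| <= `|x|,
      forall n, [/\ forall x, `|g n x : R| <= 2 * `|x|, `|y n| <= 4, f0 (y n) = 0, g n x0 = 0
        & 4^-1 <= g n (y n) :> R],
      forall m n, m <> n -> `|g m (y n) : R| <= 32^-1 &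
      forall x (e : R), 0 < e -> exists N, forall n, (N <= n)%N -> `|g n x : R| <= e].
Proof.
have [g [y [g1 y1 gy g0]]] := null_sequence.
have [u u0] : exists u : X, u != 0.
  exists (y 0%N); apply/eqP => y0; have := gy 0%N; rewrite y0 dual0.
  by rewrite leNgt invr_gt0 ltr0n.
pose x0 := `|u|^-1 *: u.
have nx0 : `|x0| = 1 by rewrite normrZ normfV normr_id mulVf ?normr_eq0.
pose f0 := nu x0; have f0x0 : f0 x0 = 1 by rewrite /f0 nuE.
have f0n x : `|f0 x : R| <= `|x| by exact: nu_le.
pose T x := x - f0 x *: x0.
have TL (a : R) x z : T (a *: x + z) = a *: T x + T z.
  by rewrite /T dualD dualZ scalerDl -scalerA scalerBr opprD addrACA.
have Tn x : `|T x| <= 2 * `|x|.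
  apply: le_trans (ler_normB _ _) _; rewrite normrZ nx0 mulr1.
  by have := f0n x; lra.
have Tx0 : T x0 = 0 by rewrite /T f0x0 scale1r subrr.
have f0T x : f0 (T x) = 0 :> R by rewrite /T dualB dualZ f0x0 mulr1 subrr.
(* Starting where $|g_n(x_0)| \le 1/8$ leaves $G_n(z_n) \ge 1/2 - 1/8 = 3/8$ after the
   projection. *)
have [N0 hN0] := g0 x0 8^-1 (ltac:(by rewrite invr_gt0)).
have /choice[G hG] : forall n, exists G : topdual X, forall x, G x = g (n + N0)%N (T x).
  move=> n; apply: (@bounded_dual _ _ (fun x => g (n + N0)%N (T x)) 2) => [a x z|x].
    by rewrite TL dualD dualZ.
  exact: le_trans (g1 _ _) (Tn x).
pose z n := T (y (n + N0)%N).
have TT x : T (T x) = T x by rewrite {1}/T f0T scale0r subr0.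
have Gz n : 8^-1 * 3 <= G n (z n) :> R.
  rewrite hG /z TT /T dualB dualZ.
  have := hN0 (n + N0)%N (leq_addl _ _); have := gy (n + N0)%N.
  have := le_trans (f0n (y (n + N0)%N)) (y1 _).
  set a := f0 _; set b := g _ (y _); set c := g _ x0 => a1 b1 c1.
  have : `|a * c| <= 8^-1 by rewrite normrM -[leRHS]mul1r; exact: ler_pM.
  by rewrite ler_norml => /andP[_ h]; lra.
have G0 x (e : R) : 0 < e -> exists N, forall n, (N <= n)%N -> `|G n x : R| <= e.
  move=> e0; have [N hN] := g0 (T x) e e0; exists N => n Nn.
  by rewrite hG; apply: hN; rewrite ltn_addr// ltnS || exact: leq_trans Nn (leq_addr _ _).
have zn n : `|z n| <= 2.
  by apply: le_trans (Tn _) _; have := y1 (n + N0)%N; lra.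
have Gn n x : `|G n x : R| <= 2 * `|x| by rewrite hG; exact: le_trans (g1 _ _) (Tn x).
have [U [UU FU]] := ultraFilterLemma (eventually_filter : ProperFilter eventually).
have GB m : U [set k | `|(G m (z k) : R)| <= 4].
  apply: (@filterS _ U _ setT); last exact: filterT.
  by move=> k _ /=; apply: le_trans (Gn m _) _; have := zn k; lra.
have /choice[r hr] : forall m, exists r : R, forall e : R, 0 < e -> U [set k | `|(G m (z k) : R) - r| < e].
  by move=> m; have [r hr] := @ultra_limit _ _ U (fun k => G m (z k) : R) 4 UU (GB m); exists r.
pose Y (p : nat * nat) := z p.1 - z p.2.
pose good (L : seq (nat * nat)) (p : nat * nat) := [/\ (size L <= p.1)%N,
  4^-1 <= G p.1 (Y p) :> R &
  forall q, q \in L -> `|G q.1 (Y p) : R| <= 32^-1 /\ `|G p.1 (Y q) : R| <= 32^-1].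
have eps0 : 0 < (64^-1 : R) by rewrite invr_gt0.
have e32 : 0 < (32^-1 : R) by rewrite invr_gt0.
have /choice[next hnext] : forall L, exists p, good L p.
  move=> L.
  have UL : U [set k | forall q, q \in L -> `|(G q.1 (z k) : R) - r q.1| < 64^-1].
    elim: L => [|q L IH]; first by apply: (@filterS _ U _ setT) => //; exact: filterT.
    apply: (@filterS _ U _ _ _ _ (filterI (hr q.1 _ eps0) IH)) => k [h1 h2] q'.
    by rewrite inE => /orP[/eqP->|/h2].
  have [n' hn'] := @filter_ex _ U _ _ UL.
  have [N1 hN1] := G0 (z n') _ eps0.
  have [N2 hN2] : exists N, forall n, (N <= n)%N -> forall q, q \in L -> `|G n (Y q) : R| <= 32^-1.
    elim: L {UL hn'} => [|q L [N IH]]; first by exists 0%N.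
    have [N' hN'] := G0 (Y q) _ e32; exists (maxn N N') => n; rewrite geq_max => /andP[Nn N'n] q'.
    by rewrite inE => /orP[/eqP->|/IH]; [exact: hN'|exact].
  have Uev : U [set k | (maxn (maxn N1 N2) (size L) <= k)%N].
    by apply: FU; exists (maxn (maxn N1 N2) (size L)).
  have [n [hn /=]] := @filter_ex _ U _ _ (filterI UL Uev).
  rewrite !geq_max => /andP[/andP[n1 n2] n3].
  exists (n, n'); split=> //=.
    rewrite /Y dualB/=; have := Gz n; have := hN1 n n1; rewrite ler_norml => /andP[_].
    lra.
  move=> q qL; split; last exact: hN2.
  have h1 : `|r q.1 - G q.1 (z n) : R| < 64^-1 by rewrite distrC; exact: hn.
  have h2 : `|r q.1 - G q.1 (z n') : R| < 64^-1 by rewrite distrC; exact: hn'.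
  rewrite /Y dualB/=; apply: le_trans (ltW (ltr_dist h1 h2)) _.
  exact: dyadic_64.
pose Ls := fix Ls k := if k is k'.+1 then next (Ls k') :: Ls k' else [::].
have sizeL k : size (Ls k) = k by elim: k => //= k ->.
pose p k := next (Ls k).
have pL j k : (j < k)%N -> p j \in Ls k.
  elim: k => //= k IH; rewrite ltnS leq_eqVlt inE => /orP[/eqP->|/IH ->]; last by rewrite orbT.
  by rewrite eqxx.
exists x0, f0, (fun k => G (p k).1), (fun k => Y (p k)); split=> //.
- move=> n; have [_ h _] := hnext (Ls n); split=> //.
  + by apply: le_trans (ler_normB _ _) _; have := zn (p n).1; have := zn (p n).2; lra.
  + by rewrite /Y dualB !f0T subrr.
  + by rewrite hG Tx0 dual0.
- move=> m n mn; have [mn'|] := ltnP m n.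
    by have [_ _ h] := hnext (Ls n); have [] := h _ (pL _ _ mn').
  rewrite leq_eqVlt => /orP[/eqP nm|nm]; first by case: mn.
  by have [_ _ h] := hnext (Ls m); have [] := h _ (pL _ _ nm).
- move=> x e e0; have [N hN] := G0 x e e0; exists N => n Nn; apply: hN.
  by have [h _ _] := hnext (Ls n); rewrite sizeL in h; exact: leq_trans Nn h.
Qed.

End NullSequences.

(** * Smooth suprema of null sequences *)

Section FlatSum.
Context {R : realType} {X : normedModType R}.

Lemma small_forall (N : nat) (P : nat -> R -> Prop) :
  (forall n, (n < N)%N -> exists2 t0 : R, 0 < t0 & forall t, 0 < t < t0 -> P n t) ->
  exists2 t0 : R, 0 < t0 & forall n t, (n < N)%N -> 0 < t < t0 -> P n t.
Proof.
elim: N => [_|N IH h]; first by exists 1.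
have [n nN|t1 t10 h1] := IH; first by apply: h; exact: ltnW.
have [t2 t20 h2] := h N (leqnn _); exists (Num.min t1 t2); first by rewrite lt_min t10.
move=> n t; rewrite ltnS leq_eqVlt lt_min => /orP[/eqP->|nN] /and3P[t0 tt1 tt2].
  by apply: h2; rewrite t0.
by apply: h1; rewrite ?t0.
Qed.

Lemma ler_sum_ord N (f g : nat -> R) : (forall n, f n <= g n) ->
  \sum_(n < N) f n <= \sum_(n < N) g n.
Proof. by move=> fg; apply: ler_sum. Qed.

Lemma sum_widen (N M : nat) (f : nat -> R) : (N <= M)%N ->
  \sum_(n < M) (if (n < N)%N then f n else 0) = \sum_(n < N) f n.
Proof. by move=> NM; rewrite (big_ord_widen M f NM) [RHS]big_mkcond. Qed.

Lemma sum_at (N k : nat) (c : R) : (k < N)%N ->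
  \sum_(n < N) (if n == k :> nat then c else 0) = c.
Proof.
move=> kN; rewrite (bigD1 (Ordinal kN))//= eqxx big1 ?addr0// => i.
by rewrite -val_eqE/= => /negbTE ->.
Qed.

Lemma half01 : 0 <= (2^-1 : R) <= 1.
Proof. by lra. Qed.

Lemma convex_lip (q : X -> R) x d (t : R) : convex_fun q -> (forall x, 0 <= q x) ->
  0 <= t <= 1 -> `|q (x + t *: d) - q x| <= t * (q (x + d) + q (x - d)).
Proof.
move=> hq q0 t01; have [t0 t1] := andP t01.
have up v : q (x + t *: v) <= t * q (x + v) + (1 - t) * q x.
  have := hq t (x + v) x t01; rewrite [t *: _ + _](_ : _ = x + t *: v)//.
  by rewrite scalerDr scalerBl scale1r [LHS]addrC addrA subrK.
have mid := hq 2^-1 (x + t *: d) (x + t *: - d) half01.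
rewrite scalerN -midpointE midpoint_reflect in mid.
have h1 := up d; have h2 := up (- d); rewrite scalerN in h2.
have h3 := mulr_ge0 t0 (q0 x); have h4 := mulr_ge0 t0 (q0 (x + d)).
have h5 := mulr_ge0 t0 (q0 (x - d)).
by rewrite ler_norml; apply/andP; split; lra.
Qed.

Variable lam : nat -> X -> R.
Variable B : X -> R.
Hypothesis lam_ge0 : forall n x, 0 <= lam n x.
Hypothesis lam_le : forall n x, lam n x <= B x.
Hypothesis lam_convex : forall n, convex_fun (lam n).
Hypothesis lam_smooth : forall n x, smooth_at (lam n) x.
Hypothesis lam_null : forall x (e : R), 0 < e ->
  exists N, forall n, (N <= n)%N -> lam n x <= e.

(** The quadratic term makes the set of weights strictly convex. As $cost(2) = 3$, the budget $3$
    permits weight exactly $2$ on a single index. *)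
Definition cost (r : R) : R := r + r ^+ 2 / 4.

Definition weights (p : nat * (nat -> R)) :=
  (forall n, 0 <= p.2 n) /\ \sum_(n < p.1) cost (p.2 n) <= 3.

Definition weighted (x : X) (p : nat * (nat -> R)) : R := \sum_(n < p.1) p.2 n * lam n x.

Definition flat (x : X) : R := supr weights (weighted x).

Lemma cost_ge (r : R) : r <= cost r. Proof. by rewrite /cost; have := sqr_ge0 r; lra. Qed.

Lemma weights_sum N w : weights (N, w) -> \sum_(n < N) w n <= 3.
Proof. by move=> [_ h]; apply: le_trans h; apply: ler_sum => i _; exact: cost_ge. Qed.

Lemma weights_le N w n : weights (N, w) -> (n < N)%N -> w n <= 3.
Proof.
move=> hw nN; apply: le_trans (weights_sum hw); rewrite (bigD1 (Ordinal nN))//= lerDl.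
by apply: sumr_ge0 => i _; exact: hw.1.
Qed.

Lemma weights0 : weights (0%N, fun=> 0).
Proof. by split=> //=; rewrite big_ord0. Qed.

Lemma weighted_le x p (c : R) : weights p -> (forall n, lam n x <= c) -> weighted x p <= 3 * c.
Proof.
case: p => N w hw hc; have c0 : 0 <= c by exact: le_trans (hc 0%N).
have h := ler_wpM2r c0 (weights_sum hw); apply: le_trans h.
by rewrite mulr_suml; apply: ler_sum => i _; apply: ler_wpM2l => //; exact: hw.1.
Qed.

Lemma flat_ge x p : weights p -> weighted x p <= flat x.
Proof.
move=> hp; apply: (@supr_ge _ _ weights (weighted x) (3 * B x) p _ hp) => q hq.
exact: weighted_le.
Qed.

Lemma flat_le x (c : R) : (forall p, weights p -> weighted x p <= c) -> flat x <= c.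
Proof. exact: (supr_le weights0). Qed.

Lemma flat_adh x (e : R) : 0 < e -> exists2 p, weights p & flat x - e < weighted x p.
Proof.
move=> e0; apply: (@supr_adh _ _ weights (weighted x) (3 * B x) _ e weights0) => // q hq.
exact: weighted_le.
Qed.

Lemma flat_le3 x (c : R) : (forall n, lam n x <= c) -> flat x <= 3 * c.
Proof. by move=> hc; apply: flat_le => p hp; exact: weighted_le. Qed.

Lemma flat_ge2 n x : 2 * lam n x <= flat x.
Proof.
pose w i : R := if i == n then 2 else 0.
have hw : weights (n.+1, w).
  split=> [i|]/=; first by rewrite /w; case: ifP.
  have -> : \sum_(i < n.+1) cost (w i) = \sum_(i < n.+1) (if i == n :> nat then 3 else 0).
    by apply: eq_bigr => i _; rewrite /w /cost; case: ifP => _; lra.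
  by rewrite sum_at.
apply: le_trans (flat_ge x hw); rewrite /weighted/=.
have -> : \sum_(i < n.+1) w i * lam i x =
  \sum_(i < n.+1) (if i == n :> nat then 2 * lam n x else 0).
  by apply: eq_bigr => i _; rewrite /w; case: eqP => [->//|_]; rewrite mul0r.
by rewrite sum_at.
Qed.

Lemma flat_ge0 x : 0 <= flat x.
Proof. by have := flat_ge2 0 x; have := lam_ge0 0 x; lra. Qed.

Lemma flat_convex : convex_fun flat.
Proof.
move=> t x y t01; have [t0 t1] := andP t01; have t1' : 0 <= 1 - t by lra.
apply: flat_le => p hp; have := flat_ge x hp; have := flat_ge y hp.
move=> /(ler_wpM2l t1') h1 /(ler_wpM2l t0) h2.
apply: le_trans (lerD h2 h1); rewrite /weighted !mulr_sumr -big_split/=.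
apply: ler_sum => i _; have h := ler_wpM2l (hp.1 i) (lam_convex i x y t01).
by apply: le_trans h _; rewrite le_eqVlt; apply/orP; left; apply/eqP; ring.
Qed.

Lemma flat_eq x y : (forall n, lam n x = lam n y) -> flat x = flat y.
Proof.
move=> h; suff E : weighted x = weighted y by rewrite /flat E.
by apply/funext => p; apply: eq_bigr => i _; rewrite h.
Qed.

(* Weight off [A] is moved onto [k]: a quarter of it fits into the budget, and [l k] is *)
(* at least four times larger.                                                          *)
Lemma concentrate (A : pred nat) k N w (l : nat -> R) : weights (N, w) -> A k -> (k < N)%N ->
  (forall n, 0 <= l n) -> (forall n, ~~ A n -> 4 * l n <= l k) ->
  exists w', [/\ weights (N, w'), forall n, ~~ A n -> w' n = 0
    & \sum_(n < N) w n * l n <= \sum_(n < N) w' n * l n].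
Proof.
move=> hw Ak kN l0 lA; pose off n := if A n then 0 else w n.
have off0 n : 0 <= off n by rewrite /off; case: ifP => // _; exact: hw.1.
pose tau := \sum_(n < N) off n; have tau0 : 0 <= tau by exact: sumr_ge0.
have tau3 : tau <= 3.
  apply: le_trans (weights_sum hw); apply: ler_sum => i _; rewrite /off; case: ifP => // _.
  exact: hw.1.
have wk3 := weights_le hw kN; have wk0 := hw.1 k; rewrite /= in wk0.
pose w' n := if A n then w n + (if n == k then tau / 4 else 0) else 0.
exists w'; split.
- split=> [n|]/=.
    by rewrite /w'; case: ifP => // _; rewrite addr_ge0 ?hw.1//; case: ifP => // _; lra.
  apply: le_trans hw.2 => /=.
  have h n : cost (w' n) <= cost (w n) - off n + (if n == k then tau else 0).
    rewrite /w' /off; case: ifPn => [An|nA]; last first.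
      have -> : (n == k) = false by apply/eqP => nk; rewrite nk Ak in nA.
      by have := cost_ge (w n); rewrite /cost expr0n/=; lra.
    case: eqP => [->|_]; last by rewrite !addr0 subr0.
    have h1 : 0 <= tau * (3 - w k) by rewrite mulr_ge0// subr_ge0.
    have h2 : 0 <= tau * (3 - tau) by rewrite mulr_ge0// subr_ge0.
    by rewrite /cost; lra.
  apply: le_trans (ler_sum_ord N h) _.
  by rewrite big_split/= sumrB sum_at// subrK.
- by move=> n nA; rewrite /w' (negbTE nA).
have h n : w n * l n <= w' n * l n + off n * l k / 4 - (if n == k then tau / 4 * l k else 0).
  rewrite /w' /off; case: ifPn => [An|nA].
    by case: eqP => [->|_]; lra.
  have -> : (n == k) = false by apply/eqP => nk; rewrite nk Ak in nA.
  by have := ler_wpM2l (hw.1 n) (lA n nA); rewrite /=; lra.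
apply: le_trans (ler_sum_ord N h) _.
rewrite sumrB sum_at// big_split/=.
have -> : \sum_(i < N) off i * l k / 4 = tau * l k / 4.
  by rewrite /tau !mulr_suml.
lra.
Qed.

Lemma weighted_truncate N k x p : weights p -> (k < N)%N ->
  (forall n, (N <= n)%N -> 4 * lam n x <= lam k x) ->
  exists2 w, weights (N, w) & weighted x p <= weighted x (N, w).
Proof.
case: p => N' w hw kN hN; pose M := maxn N N'.
have NM : (N <= M)%N by rewrite leq_maxl.
have N'M : (N' <= M)%N by rewrite leq_maxr.
pose w1 n := if (n < N')%N then w n else 0.
have hw1 : weights (M, w1).
  split=> [n|]/=; first by rewrite /w1; case: ifP => // _; exact: hw.1.
  have -> : \sum_(n < M) cost (w1 n) = \sum_(n < M) (if (n < N')%N then cost (w n) else 0).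
    apply: eq_bigr => i _; rewrite /w1; case: ifP => // _.
    by rewrite /cost expr0n/= mul0r addr0.
  by rewrite (sum_widen (fun n => cost (w n)) N'M); exact: hw.2.
have l0 n : 0 <= lam n x by [].
have lN n : ~~ (n < N)%N -> 4 * lam n x <= lam k x by rewrite -leqNgt; exact: hN.
have [w' [hw' w'0 h]] := @concentrate (fun n => n < N)%N k M w1 (fun n => lam n x) hw1 kN
  (leq_trans kN NM) l0 lN.
have E (f : nat -> R) : (forall n, (N <= n)%N -> f n = 0) -> \sum_(n < M) f n = \sum_(n < N) f n.
  move=> f0; rewrite -(sum_widen f NM); apply: eq_bigr => i _; case: ltnP => // Ni.
  exact: f0.
exists w'.
  split; first exact: hw'.1.
  rewrite /= -(E (fun n => cost (w' n))); first exact: hw'.2.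
  by move=> n Nn; rewrite /cost w'0 -?leqNgt// expr0n/= mul0r addr0.
rewrite /weighted/= -(E (fun n => w' n * lam n x)); last first.
  by move=> n Nn; rewrite w'0 -?leqNgt// mul0r.
apply: le_trans h; rewrite le_eqVlt; apply/orP; left; apply/eqP.
rewrite -(sum_widen (fun n => w n * lam n x) N'M); apply: eq_bigr => i _; rewrite /w1.
by case: ifP => // _; rewrite mul0r.
Qed.

(** When one value dominates, all weight may be moved onto it by [concentrate], and the budget caps
    it at $2$. *)
Lemma flat_single k x : (forall n, n != k -> 4 * lam n x <= lam k x) -> flat x = 2 * lam k x.
Proof.
move=> hk; apply/eqP; rewrite eq_le flat_ge2 andbT; apply: flat_le => p hp.
have [|w hw hle] := weighted_truncate (N := k.+1) (k := k) (x := x) hp (leqnn _).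
  by move=> n kn; apply: hk; rewrite gtn_eqF.
apply: le_trans hle _; have l0 n : 0 <= lam n x by [].
have lN n : ~~ (n == k) -> 4 * lam n x <= lam k x by exact: hk.
have [w' [hw' w'0 h]] := @concentrate (pred1 k) k k.+1 w (fun n => lam n x) hw (eqxx k)
  (leqnn _) l0 lN.
apply: le_trans h _.
have w'k : w' k <= 2.
  have := hw'.2; rewrite /= (bigD1 ord_max)//= => h.
  have {}h : cost (w' k) <= 3.
    apply: le_trans h; rewrite lerDl; apply: sumr_ge0 => i _.
    by apply: le_trans (cost_ge _); exact: hw'.1.
  have := hw'.1 k; rewrite /= => w0; rewrite leNgt; apply/negP => h2.
  by move: h; rewrite /cost; nra.
rewrite (bigD1 ord_max)//= big1 ?addr0; first by rewrite ler_wpM2r.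
move=> i ik; rewrite w'0 ?mul0r//=; apply: contra ik => /eqP ik.
Qed.

(** Here $flat(x) \ge 2a$, while the indices from [N] on contribute at most $3 \cdot a/12$. Weights
    nearly optimal at the midpoint must therefore exceed [c] at some $n < N$, which bounds the
    deficit of that [lam n]. It is essential for [ridges_LUR] that [N] is chosen before [eta]. *)
Lemma flat_deficit k x : 0 < lam k x -> exists N, forall eta : R, 0 < eta ->
  exists2 eta' : R, 0 < eta' & forall z, deficit flat x z <= eta' ->
    exists2 n, (n < N)%N & deficit (lam n) x z <= eta.
Proof.
set a := lam k x => a0.
have a12 : 0 < a / 12 by lra.
have [N hN] := lam_null x a12; exists N => eta eta0.
pose K : R := N%:R * B x + 1.
have NB0 : 0 <= N%:R * B x by rewrite mulr_ge0// (le_trans (lam_ge0 0 x)).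
have K0 : 0 < K by rewrite /K; lra.
pose c : R := a / 4 / K; have c0 : 0 < c by rewrite divr_gt0//; lra.
have cK : c * (N%:R * B x) <= a / 4.
  have -> : a / 4 = c * K by rewrite /c divfK// gt_eqF.
  by rewrite ler_pM2l// /K; lra.
exists (Num.min (a / 8) (c * eta / 2)).
  by rewrite lt_min; apply/andP; split; [lra|rewrite divr_gt0// mulr_gt0].
set eta' := Num.min _ _ => z hz.
have e1 : eta' <= a / 8 by rewrite ge_min lexx.
have e2 : eta' <= c * eta / 2 by rewrite ge_min lexx orbT.
have eta'0 : 0 < eta' by rewrite lt_min; apply/andP; split; [lra|rewrite divr_gt0// mulr_gt0].
have [[N' w] hw hwm] := flat_adh (midpoint x z) eta'0.
have hx := flat_ge x hw; have hz' := flat_ge z hw.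
have def0 n : 0 <= deficit (lam n) x z.
  rewrite /deficit midpointE; have := lam_convex n x z half01; lra.
have sumE : \sum_(n < N') w n * deficit (lam n) x z =
  (weighted x (N', w) + weighted z (N', w)) / 2 - weighted (midpoint x z) (N', w).
  rewrite /weighted/= -big_split/= mulr_suml -sumrB; apply: eq_bigr => i _.
  by rewrite /deficit; ring.
have wd n : (n < N')%N -> w n * deficit (lam n) x z <= \sum_(n < N') w n * deficit (lam n) x z.
  move=> nN; rewrite (bigD1 (Ordinal nN))//= lerDl; apply: sumr_ge0 => i _.
  by rewrite mulr_ge0// hw.1.
have sum0 : 0 <= \sum_(n < N') w n * deficit (lam n) x z.
  by apply: sumr_ge0 => i _; rewrite mulr_ge0// hw.1.
have hz2 : (flat x + flat z) / 2 - flat (midpoint x z) <= eta' by exact: hz.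
apply: contrapT => hn.
have small n : (n < N')%N -> (n < N)%N -> w n <= c.
  move=> nN' nN; rewrite leNgt; apply/negP => cw; apply: hn; exists n => //.
  rewrite -(ler_pM2l c0); apply: le_trans (ler_wpM2r (def0 n) (ltW cw)) _.
  by apply: le_trans (wd n nN') _; lra.
have Bx0 : 0 <= B x by exact: le_trans (lam_le 0 x).
have : weighted x (N', w) <= \sum_(n < N') ((if (n < N)%N then c * B x else 0) + w n * (a / 12)).
  apply: ler_sum => i _ /=; have wi := hw.1 i; rewrite /= in wi; case: ltnP => iN.
    apply: ler_wpDr; first by rewrite mulr_ge0// ltW.
    by apply: ler_pM => //; exact: small.
  by rewrite add0r ler_wpM2l// hN.
rewrite big_split/= -mulr_suml.
have h1 : \sum_(n < N') (if (n < N)%N then c * B x else 0) <= c * (N%:R * B x).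
  apply: (@le_trans _ _ (\sum_(n < maxn N N') (if (n < N)%N then c * B x else 0))).
    rewrite (big_ord_widen (maxn N N') (fun n => if (n < N)%N then c * B x else 0)) ?leq_maxr//.
    rewrite big_mkcond; apply: ler_sum => i _; case: ifP => // _.
    by case: ifP => // _; rewrite mulr_ge0// ltW.
  rewrite (sum_widen (fun=> c * B x)) ?leq_maxl// sumr_const card_ord -[leLHS]mulr_natl.
  by rewrite le_eqVlt; apply/orP; left; apply/eqP; ring.
have h2 := ler_wpM2r (ltW a12) (weights_sum hw).
have h3 := flat_ge2 k x; rewrite -/a in h3.
lra.
Qed.

(** For large [n] convexity replaces smoothness: as [lam n] vanishes at [x], its value at $x + td$
    is at most $t$ times its small value at $x + d$. *)
Lemma flat_smooth0 x : (forall n, lam n x = 0) -> smooth_at flat x.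
Proof.
move=> x0 d e e0; have e6 : 0 < e / 6 by lra.
have [N1 hN1] := lam_null (x + d) e6; have [N2 hN2] := lam_null (x - d) e6.
pose N := maxn N1 N2.
have [n nN|t1 t10 ht1] := @small_forall N
  (fun n t => lam n (x + t *: d) + lam n (x - t *: d) <= e / 6 * t).
  have [t1 t10 h] := lam_smooth n x d e6; exists t1 => // t tt.
  by have := h t tt; rewrite x0; lra.
exists (Num.min 1 t1); first by rewrite lt_min ltr01.
move=> t; rewrite lt_min => /and3P[t0 t1' tt1].
have t01 : 0 <= t <= 1 by rewrite (ltW t0) (ltW t1').
have up n v : lam n (x + t *: v) <= t * lam n (x + v).
  have := lam_convex n (x + v) x t01; rewrite x0 mulr0 addr0 [t *: _ + _](_ : _ = x + t *: v)//.
  by rewrite scalerDr scalerBl scale1r [LHS]addrC addrA subrK.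
have h n : lam n (x + t *: d) <= e / 6 * t /\ lam n (x - t *: d) <= e / 6 * t.
  have [nN|Nn] := ltnP n N.
    have := ht1 n t nN; rewrite t0 tt1 => /(_ isT).
    by have := lam_ge0 n (x + t *: d); have := lam_ge0 n (x - t *: d); split; lra.
  have := Nn; rewrite geq_max => /andP[/hN1 h1 /hN2 h2]; split.
    by apply: le_trans (up n d) _; rewrite mulrC ler_wpM2r// ltW.
  by rewrite -scalerN; apply: le_trans (up n (- d)) _; rewrite mulrC ler_wpM2r// ltW.
have h1 := flat_le3 (fun n => (h n).1); have h2 := flat_le3 (fun n => (h n).2).
by have := flat_ge0 x; lra.
Qed.

Lemma flat_truncate N k x (e : R) : 0 < e -> (k < N)%N ->
  (forall n, (N <= n)%N -> 4 * lam n x <= lam k x) ->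
  exists2 w, weights (N, w) & flat x <= weighted x (N, w) + e.
Proof.
move=> e0 kN hN; have [p hp h] := flat_adh x e0.
have [w hw h'] := weighted_truncate hp kN hN; exists w => //.
lra.
Qed.

Lemma young (a u v : R) : 0 < a -> u * v <= a * u ^+ 2 + v ^+ 2 / (4 * a).
Proof.
move=> a0; have -> : a * u ^+ 2 + v ^+ 2 / (4 * a) = u * v + a * (u - v / (2 * a)) ^+ 2.
  by field; rewrite !gt_eqF.
by rewrite lerDl mulr_ge0 ?sqr_ge0// ltW.
Qed.

(* Strict convexity of [cost]: the midpoint leaves room to spare, which is given to [k]. *)
Lemma weights_midpoint N k w1 w2 : weights (N, w1) -> weights (N, w2) -> (k < N)%N ->
  weights (N, fun n => (w1 n + w2 n) / 2 +
    (if n == k then (\sum_(n < N) (w1 n - w2 n) ^+ 2) / 64 else 0)).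
Proof.
move=> h1 h2 kN; set D := \sum_(n < N) _.
have D0 : 0 <= D by apply: sumr_ge0 => i _; exact: sqr_ge0.
have D9 : D <= 18.
  have : D <= \sum_(n < N) (3 * w1 n + 3 * w2 n).
    rewrite /D; apply: ler_sum => i _; have := weights_le h1 (ltn_ord i).
    have := weights_le h2 (ltn_ord i); have := h1.1 i; have := h2.1 i => /=.
    by nra.
  by rewrite big_split/= -!mulr_sumr; have := weights_sum h1; have := weights_sum h2; lra.
split=> [n|]/=.
  by rewrite addr_ge0 ?divr_ge0 ?addr_ge0 ?h1.1 ?h2.1//; case: ifP => // _; rewrite divr_ge0.
have k1 := weights_le h1 kN; have k2 := weights_le h2 kN.
have h n : cost ((w1 n + w2 n) / 2 + (if n == k then D / 64 else 0)) <=
    (cost (w1 n) + cost (w2 n)) / 2 - (w1 n - w2 n) ^+ 2 / 16 + (if n == k then D / 16 else 0).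
  rewrite /cost; case: eqP => [->|_]; last by rewrite !addr0; lra.
  have p1 : 0 <= D * (3 - w1 k) by rewrite mulr_ge0// subr_ge0.
  have p2 : 0 <= D * (3 - w2 k) by rewrite mulr_ge0// subr_ge0.
  have p3 : 0 <= D * (18 - D) by rewrite mulr_ge0// subr_ge0.
  lra.
apply: le_trans (ler_sum_ord N h) _; rewrite big_split/= sum_at// sumrB -!mulr_suml big_split/=.
by have := h1.2; have := h2.2; rewrite /= -/D; lra.
Qed.

(** Take near-optimal weights [w1] and [w2] at $x + td$ and $x - td$. Their average, with the bonus
    of [weights_midpoint] at [k], competes at [x]. The bonus is proportional to $\sum (w_1 - w_2)^2$
    and absorbs the cross term $\sum (w_1 - w_2) u_n$, where $u_n = O(t)$, up to $O(t^2)$. *)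
Lemma flat_smooth x : smooth_at flat x.
Proof.
have [|/existsNP[k /eqP lk0]] := pselect (forall n, lam n x = 0); first exact: flat_smooth0.
set a := lam k x in lk0.
have a0 : 0 < a by rewrite lt_def lk0; exact: lam_ge0.
move=> d e e0.
pose C n := lam n (x + d) + lam n (x - d).
have C0 n : 0 <= C n by rewrite addr_ge0.
have a32 : 0 < a / 32 by lra.
have [N1 hN1] := lam_null x a32.
have [N2 hN2] := lam_null (x + d) a32; have [N3 hN3] := lam_null (x - d) a32.
pose N := maxn k.+1 (maxn N1 (maxn N2 N3)).
have kN : (k < N)%N by rewrite leq_maxl.
have hN n : (N <= n)%N -> [/\ lam n x <= a / 32, lam n (x + d) <= a / 32
    & lam n (x - d) <= a / 32].
  by rewrite !geq_max => /and4P[_ /hN1 ? /hN2 ? /hN3 ?].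
have NR0 : 0 < (N%:R : R) by rewrite ltr0n; exact: leq_trans kN.
pose e' := e / (12 * N%:R); have e'0 : 0 < e' by rewrite divr_gt0// mulr_gt0.
have [n nN|t1 t10 ht1] := @small_forall N
  (fun n t => lam n (x + t *: d) + lam n (x - t *: d) - 2 * lam n x <= e' * t).
  exact: (lam_smooth n x d e'0).
pose S := \sum_(n < N) C n ^+ 2.
have S0 : 0 <= S by apply: sumr_ge0 => i _; exact: sqr_ge0.
pose t2 := e * a / (64 * (S + 1)).
have t20 : 0 < t2 by rewrite divr_gt0 ?mulr_gt0//; lra.
pose t3 := a / (2 * (C k + 1)).
have t30 : 0 < t3 by rewrite divr_gt0// mulr_gt0// ltr_wpDl.
exists (Num.min (Num.min 1 t1) (Num.min t2 t3)); first by rewrite !lt_min ltr01 t10 t20.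
move=> t; rewrite !lt_min => /andP[t0 /andP[/andP[tlt1 tt1] /andP[tt2 tt3]]].
have t01 : 0 <= t <= 1 by rewrite (ltW t0) (ltW tlt1).
have lip n : `|lam n (x + t *: d) - lam n x| <= t * C n.
  exact: (convex_lip x d (lam_convex n) (lam_ge0 n) t01).
have lip' n : `|lam n (x - t *: d) - lam n x| <= t * C n.
  have := convex_lip x (- d) (lam_convex n) (lam_ge0 n) t01.
  by rewrite scalerN opprK [lam n (x - d) + _]addrC.
have tC : t * C k <= a / 2.
  have h : t * (2 * (C k + 1)) < a by rewrite -ltr_pdivlMr// mulr_gt0// ltr_wpDl.
  lra.
have tail n : (N <= n)%N -> 4 * lam n (x + t *: d) <= lam k (x + t *: d) /\
    4 * lam n (x - t *: d) <= lam k (x - t *: d).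
  move=> /hN[n1 n2 n3]; have := lip k; have := lip' k; have := lip n; have := lip' n.
  rewrite !ler_norml -/a => /andP[_ q1] /andP[_ q2] /andP[q3 _] /andP[q4 _].
  have tCn : t * C n <= a / 16.
    by apply: le_trans (ler_piMl (C0 n) (ltW tlt1)) _; rewrite /C; lra.
  by split; lra.
have et : 0 < e * t / 8 by rewrite divr_gt0// mulr_gt0.
have [w1 hw1 f1] := flat_truncate et kN (fun n Nn => (tail n Nn).1).
have [w2 hw2 f2] := flat_truncate et kN (fun n Nn => (tail n Nn).2).
have hm := flat_ge x (weights_midpoint hw1 hw2 kN).
move: hm; set D := \sum_(n < N) (w1 n - w2 n) ^+ 2 => hm.
(* Matched to the bonus: twice $D/64$ at [k], where the value is [a], is worth $aD/32 = bD$. *)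
pose b := a / 32.
have key (n : 'I_N) (_ : true) : w1 n * lam n (x + t *: d) + w2 n * lam n (x - t *: d)
    - (w1 n + w2 n) * lam n x <= 3 * (e' * t) + (b * (w1 n - w2 n) ^+ 2 + (t * C n) ^+ 2 / (4 * b)).
  have s1 := ht1 n t (ltn_ord n); rewrite t0 tt1 in s1; have {}s1 := s1 isT.
  have l1 := lip n; have l2 := lip' n.
  pose u := (lam n (x + t *: d) - lam n (x - t *: d)) / 2.
  have hu : `|u| <= t * C n.
    move: l1 l2; rewrite /u !ler_norml => /andP[? ?] /andP[? ?].
    by apply/andP; split; lra.
  have u2 : u ^+ 2 <= (t * C n) ^+ 2.
    by rewrite -(real_normK (num_real u)) lerXn2r// nnegrE// mulr_ge0// ltW.
  have y := @young b (w1 n - w2 n) u (ltac:(rewrite /b; lra)).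
  have b4 : 0 < 4 * b by rewrite /b; lra.
  have y2 : u ^+ 2 / (4 * b) <= (t * C n) ^+ 2 / (4 * b) by rewrite ler_pM2r// invr_gt0.
  have sd : 0 <= lam n (x + t *: d) + lam n (x - t *: d) - 2 * lam n x.
    have := lam_convex n (x + t *: d) (x - t *: d) half01.
    by rewrite -midpointE midpoint_reflect; lra.
  have m3 := weights_le hw1 (ltn_ord n); have m4 := weights_le hw2 (ltn_ord n).
  have m1 := hw1.1 n; have m2 := hw2.1 n; rewrite /= in m1 m2.
  have -> : w1 n * lam n (x + t *: d) + w2 n * lam n (x - t *: d) - (w1 n + w2 n) * lam n x =
    (w1 n + w2 n) / 2 * (lam n (x + t *: d) + lam n (x - t *: d) - 2 * lam n x) +
    (w1 n - w2 n) * u by rewrite /u; field.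
  apply: lerD; last by apply: le_trans y _; rewrite lerD2l.
  by apply: ler_pM => //; lra.
have := @ler_sum _ _ (index_enum 'I_N) xpredT _ _ key.
have E1 : \sum_(n < N) (w1 n * lam n (x + t *: d) + w2 n * lam n (x - t *: d)
    - (w1 n + w2 n) * lam n x) = weighted (x + t *: d) (N, w1) + weighted (x - t *: d) (N, w2)
    - 2 * (weighted x (N, fun n => (w1 n + w2 n) / 2 + (if n == k then D / 64 else 0)) - D / 64 * a).
  rewrite sumrB big_split/=; congr (_ - _).
  have -> : weighted x (N, fun n => (w1 n + w2 n) / 2 + (if n == k then D / 64 else 0)) =
      \sum_(n < N) ((w1 n + w2 n) / 2 * lam n x) + \sum_(n < N) (if n == k :> nat then D / 64 * a else 0).
    rewrite /weighted/= -big_split/=; apply: eq_bigr => i _; rewrite mulrDl; congr (_ + _).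
    by case: eqP => [->//|_]; rewrite mul0r.
  rewrite sum_at// addrK mulr_sumr; apply: eq_bigr => i _.
  by field.
have E2 : \sum_(n < N) (3 * (e' * t) + (b * (w1 n - w2 n) ^+ 2 + (t * C n) ^+ 2 / (4 * b))) =
    e / 4 * t + (a * D / 32 + 8 * t ^+ 2 * S / a).
  rewrite big_split/= sumr_const card_ord -[_ *+ N]mulr_natl big_split/= -mulr_sumr -mulr_suml.
  rewrite -/D; congr (_ + (_ + _)).
  - by rewrite /e'; field; rewrite gt_eqF.
  - by rewrite /b; field.
  - have -> : \sum_(n < N) (t * C n) ^+ 2 = t ^+ 2 * S.
      by rewrite /S mulr_sumr; apply: eq_bigr => i _; rewrite exprMn.
    by rewrite /b; field; rewrite gt_eqF.
rewrite E1 E2 => {E1 E2 key}.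
have tS : 8 * t ^+ 2 * S / a <= e / 8 * t.
  have S1 : 0 < 64 * (S + 1) by lra.
  move: tt2; rewrite /t2 ltr_pdivlMr// => h.
  rewrite ler_pdivrMr//.
  have h' : t * (t * (64 * (S + 1))) <= t * (e * a) by rewrite ler_pM2l// ltW.
  by have t20' := sqr_ge0 t; rewrite expr2 in t20' *; lra.
lra.
Qed.

End FlatSum.

(** * Huber functions *)

Section Huber.
Context {R : realType}.
Implicit Types (s t h : R).

Definition huber t : R := if `|t| <= 2^-1 then t ^+ 2 else `|t| - 4^-1.

Lemma huberN t : huber (- t) = huber t.
Proof. by rewrite /huber normrN sqrrN. Qed.

Lemma huber_cases t : [\/ - 2^-1 <= t <= 2^-1 /\ huber t = t ^+ 2,
  2^-1 <= t /\ huber t = t - 4^-1 | t <= - 2^-1 /\ huber t = - t - 4^-1].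
Proof.
rewrite /huber; case: ifPn => [|]; first by rewrite ler_norml => h; apply: Or31.
rewrite -ltNge; have [t0|t0] := lerP 0 t.
  by rewrite ger0_norm// => h; apply: Or32; split=> //; exact: ltW.
rewrite ltr0_norm// => h; apply: Or33; split=> //; lra.
Qed.

(** The slopes are $2t$, $1$ and $-1$ on the three pieces. The two bounds contain convexity and a
    quadratic modulus of smoothness. *)
Lemma huber_tangent t : exists v : R, forall s,
  huber t + v * (s - t) <= huber s <= huber t + v * (s - t) + (s - t) ^+ 2.
Proof.
have [[/andP[t1 t2] ->]|[t1 ->]|[t1 ->]] := huber_cases t.
- exists (2 * t) => s.
  have q1 : 0 <= (2^-1 - t) * (2^-1 + t) by rewrite mulr_ge0//; lra.
  have q2 : 0 <= (s - t) ^+ 2 by exact: sqr_ge0.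
  have [[_ ->]|[s1 ->]|[s1 ->]] := huber_cases s.
  + by apply/andP; split; lra.
  + have q3 : 0 <= (2^-1 - t) * (s - 2^-1) by rewrite mulr_ge0//; lra.
    by have q4 := sqr_ge0 (s - 2^-1); have q5 := sqr_ge0 (t - 2^-1); apply/andP; split; lra.
  + have q3 : 0 <= (2^-1 + t) * (- s - 2^-1) by rewrite mulr_ge0//; lra.
    by have q4 := sqr_ge0 (s + 2^-1); have q5 := sqr_ge0 (t + 2^-1); apply/andP; split; lra.
- exists 1 => s; have q0 := sqr_ge0 (t - 2^-1); have q2 := sqr_ge0 (s - t).
  have [[/andP[s1 s2] ->]|[s1 ->]|[s1 ->]] := huber_cases s.
  + have q3 : 0 <= (t - 2^-1) * (2^-1 - s) by rewrite mulr_ge0//; lra.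
    by have q4 := sqr_ge0 (s - 2^-1); apply/andP; split; lra.
  + by apply/andP; split; lra.
  + have q3 : 0 <= (t - 2^-1) * (- 2^-1 - s) by rewrite mulr_ge0//; lra.
    by have q4 := sqr_ge0 (s + 2^-1); apply/andP; split; lra.
- exists (-1) => s; have q0 := sqr_ge0 (t + 2^-1); have q2 := sqr_ge0 (s - t).
  have [[/andP[s1 s2] ->]|[s1 ->]|[s1 ->]] := huber_cases s.
  + have q3 : 0 <= (- 2^-1 - t) * (2^-1 + s) by rewrite mulr_ge0//; lra.
    by have q4 := sqr_ge0 (s + 2^-1); apply/andP; split; lra.
  + have q3 : 0 <= (- t - 2^-1) * (s - 2^-1) by rewrite mulr_ge0//; lra.
    by have q4 := sqr_ge0 (s - 2^-1); apply/andP; split; lra.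
  + by apply/andP; split; lra.
Qed.

Lemma huber_convex (a : R) s t : 0 <= a <= 1 ->
  huber (a * s + (1 - a) * t) <= a * huber s + (1 - a) * huber t.
Proof.
move=> /andP[a0 a1]; have [v hv] := huber_tangent (a * s + (1 - a) * t).
have /andP[h1 _] := hv s; have /andP[h2 _] := hv t.
have a1' : 0 <= 1 - a by lra.
have := ler_wpM2l a0 h1; have := ler_wpM2l a1' h2.
set c := huber _; lra.
Qed.

Lemma huber_smooth t h : huber (t + h) + huber (t - h) - 2 * huber t <= 2 * h ^+ 2.
Proof.
have [v hv] := huber_tangent t.
have /andP[_ h1] := hv (t + h); have /andP[_ h2] := hv (t - h).
by lra.
Qed.

Lemma huber_ge t : `|t| - 4^-1 <= huber t.
Proof.
rewrite /huber; case: ifP => // _; rewrite -(real_normK (num_real t)).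
by have := sqr_ge0 (`|t| - 2^-1); lra.
Qed.

Lemma huber_le t : huber t <= `|t|.
Proof.
rewrite /huber; case: ifP => h; last by lra.
by rewrite -(real_normK (num_real t)) expr2 ler_piMl//; lra.
Qed.

Lemma huber_ge0 t : 0 <= huber t.
Proof.
by rewrite /huber; case: ifPn => h; [exact: sqr_ge0|rewrite -ltNge in h; lra].
Qed.

Lemma huber0 : huber 0 = 0.
Proof. by rewrite /huber normr0 invr_ge0 ler0n expr0n. Qed.

Lemma huber1 t : 2^-1 <= t -> huber t = t - 4^-1.
Proof. by move=> h; have [[? ->]|[? ->]|[? ->]] := huber_cases t; nra. Qed.


Lemma huber_level t : huber t = 3 / 4 -> `|t| = 1.
Proof.
rewrite /huber; case: ifP => [h E|_ E]; last by lra.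
have : `|t| ^+ 2 <= 2^-1 ^+ 2 by rewrite lerXn2r ?nnegrE ?invr_ge0.
by rewrite real_normK ?num_real// E; lra.
Qed.

Lemma huber_small t (e : R) : huber t <= e -> e < 4^-1 -> t ^+ 2 <= e.
Proof.
move=> h e4; have [[_ E]|[t1 E]|[t1 E]] := huber_cases t; first by rewrite -E.
  by rewrite E in h; lra.
by rewrite E in h; lra.
Qed.

Lemma huber_abs t : huber `|t| = huber t.
Proof. by have [_|_] := ger0P t => //; exact: huberN. Qed.

Lemma huber_super (a c : R) : 0 <= c <= a -> huber (a - c) + huber c <= huber a.
Proof.
move=> /andP[c0 ca]; have [a0|a0] := ltrP 0 a; last first.
  have -> : a = 0 by lra.
  have -> : c = 0 by lra.
  by rewrite subr0 huber0 addr0.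
have s01 : 0 <= c / a <= 1.
  by apply/andP; split; [exact: divr_ge0 c0 (ltW a0)|rewrite ler_pdivrMr// mul1r].
have s01' : 0 <= 1 - c / a <= 1 by lra.
have := huber_convex a 0 s01; have := huber_convex a 0 s01'; rewrite huber0 !mulr0 !addr0.
have -> : c / a * a = c by rewrite divfK// gt_eqF.
have -> : (1 - c / a) * a = a - c by rewrite mulrBl mul1r divfK// gt_eqF.
lra.
Qed.

Lemma huber_le_sqr t : huber t <= t ^+ 2.
Proof.
have [[_ ->]|[t1 ->]|[t1 ->]] := huber_cases t => //.
  by have := sqr_ge0 (t - 2^-1); lra.
by have := sqr_ge0 (t + 2^-1); lra.
Qed.

(* Convexity and the values of [huber] alone determine [|t|]; the midpoint condition *)
(* recovers the sign. *)
Lemma huber_separates s (e : R) : 0 < e -> exists2 eta : R, 0 < eta & forall t,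
  `|huber t - huber s| <= eta -> (huber s + huber t) / 2 - huber (2^-1 * (s + t)) <= eta -> `|s - t| <= e.
Proof.
move=> e0; pose eta := Num.min 32^-1 (e ^+ 2 / 16).
have eta0 : 0 < eta by rewrite lt_min invr_gt0 ltr0n divr_gt0// exprn_gt0.
have eta1 : eta <= 32^-1 by rewrite ge_min lexx.
have eta2 : eta <= e ^+ 2 / 16 by rewrite ge_min lexx orbT.
exists eta => // t hst hmid.
have abs : (`|s| - `|t|) ^+ 2 <= eta.
  rewrite -(huber_abs s) -(huber_abs t) ler_norml in hst; move/andP: hst => [h1 h2].
  have [st|st] := lerP `|s| `|t|.
    rewrite -sqrrN opprB; apply: huber_small; last by lra.
    have := @huber_super `|t| `|s|; rewrite st normr_ge0 => /(_ isT).
    by have := huber_ge0 `|s|; lra.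
  apply: huber_small; last by lra.
  have := @huber_super `|s| `|t|; rewrite (ltW st) normr_ge0 => /(_ isT).
  by have := huber_ge0 `|t|; lra.
have e2 : `|s - t| ^+ 2 <= e ^+ 2 -> `|s - t| <= e.
  by rewrite ler_pXn2r ?nnegrE// ltW.
apply: e2; rewrite real_normK ?num_real//.
have [p|p] := lerP 0 (s * t).
  apply: le_trans (_ : eta <= _); last by have := sqr_ge0 e; lra.
  apply: le_trans abs; rewrite !sqrrB !real_normK ?num_real// -normrM ger0_norm//.
have sum : (s + t) ^+ 2 <= eta.
  apply: le_trans abs; rewrite sqrrB sqrrD !real_normK ?num_real// -normrM ltr0_norm//.
  by lra.
have h1 := huber_le_sqr (2^-1 * (s + t)).
have hs0 := huber_ge0 s; have ht0 := huber_ge0 t.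
have hs : s ^+ 2 <= 4 * eta by apply: huber_small; lra.
have ht : t ^+ 2 <= 4 * eta by apply: huber_small; lra.
have := sqr_ge0 (s + t); lra.
Qed.

End Huber.

Section HuberFunctional.
Context {R : realType} {X : normedModType R}.
Variables (f : topdual X) (c : R).
Hypothesis c0 : 0 < c.

(** A smooth approximation of $|f|$ from below with error at most $c/4$. *)
Definition huber_fun (x : X) : R := c * huber ((f x : R) / c).

Lemma huber_fun_ge0 x : 0 <= huber_fun x.
Proof. by rewrite mulr_ge0 ?huber_ge0// ltW. Qed.

Lemma huber_fun_bounds x : `|f x : R| - c / 4 <= huber_fun x <= `|f x : R|.
Proof.
have E : `|f x : R| = c * `|(f x : R) / c|.
  by rewrite normrM normfV (gtr0_norm c0) mulrC divfK// gt_eqF.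
rewrite E /huber_fun; set t := (f x : R) / c.
have := ler_wpM2l (ltW c0) (huber_ge t); have := ler_wpM2l (ltW c0) (huber_le t).
by move=> h1 h2; apply/andP; split=> //; lra.
Qed.

Lemma huber_fun_convex : convex_fun huber_fun.
Proof.
move=> t x y t01; pose u : R := f x; pose v : R := f y.
have E : f (t *: x + (1 - t) *: y) = t * u + (1 - t) * v :> R by rewrite dualD !dualZ.
rewrite /huber_fun E -/u -/v.
have := ler_wpM2l (ltW c0) (huber_convex (u / c) (v / c) t01).
have -> : t * (u / c) + (1 - t) * (v / c) = (t * u + (1 - t) * v) / c by ring.
set a := huber _; set b := huber _; set d := huber _.
by move=> h; apply: le_trans h _; rewrite le_eqVlt; apply/orP; left; apply/eqP; ring.
Qed.

Lemma huber_fun_smooth x : smooth_at huber_fun x.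
Proof.
move=> d e e0; pose u : R := f d; pose w : R := f x; pose K := 2 * u ^+ 2 / c + 1.
have K0 : 0 < K by rewrite ltr_wpDl// divr_ge0 ?(ltW c0)// mulr_ge0// sqr_ge0.
exists (e / K); first exact: divr_gt0.
move=> t /andP[t0]; rewrite ltr_pdivlMr// => tK.
have E1 : f (x + t *: d) = w + t * u :> R by rewrite dualD dualZ.
have E2 : f (x - t *: d) = w - t * u :> R by rewrite dualB dualZ.
rewrite /huber_fun E1 E2 -/w.
have := ler_wpM2l (ltW c0) (huber_smooth (w / c) (t * u / c)).
have -> : w / c + t * u / c = (w + t * u) / c by ring.
have -> : w / c - t * u / c = (w - t * u) / c by ring.
have -> : c * (2 * (t * u / c) ^+ 2) = t * (K - 1) * t.
  by rewrite /K; field; rewrite gt_eqF.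
have tK' : t * (K - 1) * t <= e * t by rewrite ler_pM2r//; lra.
set a := huber _; set b := huber _; set d' := huber _.
lra.
Qed.

Lemma huber_funN x : huber_fun (- x) = huber_fun x.
Proof. by rewrite /huber_fun dualN mulNr huberN. Qed.

End HuberFunctional.

(** * Gauges *)

(** The level $3/4$ is the value of [huber] at $1$, so that the body of the renorming meets the axis
    exactly at $\pm x_0$. *)
Record convex_body (R : realType) (X : normedModType R) (H : X -> R) (r b M : R) : Prop :=
  ConvexBody {
    cb_convex : convex_fun H;
    cb_zero : H 0 = 0;
    cb_even : forall x, H (- x) = H x;
    cb_ge0 : forall x, 0 <= H x;
    cb_r0 : 0 < r;
    cb_b0 : 0 < b;
    cb_small : forall x, `|x| <= r -> H x <= 3 / 4;
    cb_coercive : forall x, H x <= 3 / 4 -> `|x| <= b;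
    cb_bounded : forall x, `|x| <= 2 * b -> H x <= M }.

Section Gauge.
Context {R : realType} {X : normedModType R}.
Variables (H : X -> R) (r b M : R).
Hypothesis hH : convex_body H r b M.

Let H_convex := cb_convex hH.
Let H_zero := cb_zero hH.
Let H_even := cb_even hH.
Let H_ge0 := cb_ge0 hH.
Let r0 := cb_r0 hH.
Let b0 := cb_b0 hH.
Let H_small := cb_small hH.
Let H_coercive := cb_coercive hH.
Let H_bounded := cb_bounded hH.

Definition sublevel (x : X) : set R := [set v | 0 < v /\ H (v^-1 *: x) <= 3 / 4].

Definition gauge (x : X) : R := infr (sublevel x) id.

Lemma convex_scale x (s : R) : 0 <= s <= 1 -> H (s *: x) <= s * H x.
Proof. by move=> s01; have := H_convex x 0 s01; rewrite scaler0 !addr0 H_zero mulr0 addr0. Qed.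

Lemma convex_extend x (s : R) : 0 <= s <= 1 -> H ((1 + s) *: x) <= H x + s * H (2 *: x).
Proof.
move=> s01; have := H_convex (2 *: x) x s01; rewrite scalerA -scalerDl.
have -> : s * 2 + (1 - s) = 1 + s by ring.
have /andP[s0 _] := s01; have := mulr_ge0 s0 (H_ge0 x); lra.
Qed.

Lemma level_large x (v : R) : 0 < v -> `|x| <= r * v -> sublevel x v.
Proof.
move=> v0 h; split=> //; apply: H_small.
by rewrite normrZ gtr0_norm ?invr_gt0// mulrC ler_pdivrMr.
Qed.

Lemma level_ex x : sublevel x (`|x| / r + 1).
Proof.
apply: level_large; first by rewrite ltr_wpDl// divr_ge0// ltW.
by rewrite mulrDr mulr1 mulrC divfK ?gt_eqF// lerDl ltW.
Qed.

Lemma gauge_le x (v : R) : sublevel x v -> gauge x <= v.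
Proof. by apply: (@infr_le _ _ (sublevel x) id 0) => w [w0 _]; exact: ltW. Qed.

Lemma gauge_ge_norm x : `|x| / b <= gauge x.
Proof.
apply: (@infr_ge _ _ (sublevel x) id _ _ (level_ex x)) => v [v0 /H_coercive].
by rewrite normrZ gtr0_norm ?invr_gt0// mulrC !ler_pdivrMr// mulrC.
Qed.

Lemma gauge_ge0 x : 0 <= gauge x.
Proof. by apply: le_trans (gauge_ge_norm x); rewrite divr_ge0// ltW. Qed.

Lemma gauge_adh x (e : R) : 0 < e -> exists2 v, sublevel x v & v < gauge x + e.
Proof.
apply: (@infr_adh _ _ (sublevel x) id 0 _ e (level_ex x)) => w [w0 _]; exact: ltW.
Qed.

Lemma gauge_le_norm x : gauge x <= r^-1 * `|x|.
Proof.
apply/ler_addgt0Pr => e e0; apply: gauge_le; apply: level_large.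
  by rewrite ltr_wpDl// mulr_ge0// invr_ge0 ltW.
by rewrite mulrDr mulrA divff ?gt_eqF// mul1r lerDl mulr_ge0// ltW.
Qed.

Lemma gauge0 : gauge 0 = 0.
Proof.
by apply/eqP; rewrite eq_le gauge_ge0 andbT; have := gauge_le_norm 0; rewrite normr0 mulr0.
Qed.

Lemma gaugeD x z : gauge (x + z) <= gauge x + gauge z.
Proof.
apply/ler_addgt0Pr => e e0; have e2 : 0 < e / 2 by lra.
have [v [v0 hv] vx] := gauge_adh x e2; have [w [w0 hw] wz] := gauge_adh z e2.
have vw : 0 < v + w by exact: addr_gt0.
have : gauge (x + z) <= v + w.
  apply: gauge_le; split=> //.
  have t01 : 0 <= v / (v + w) <= 1.
    by rewrite divr_ge0 ?(ltW v0) ?(ltW vw)// ler_pdivrMr// mul1r lerDl ltW.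
  have := H_convex (v^-1 *: x) (w^-1 *: z) t01.
  have -> : 1 - v / (v + w) = w / (v + w) by field; rewrite gt_eqF.
  have -> : (v / (v + w)) *: (v^-1 *: x) + (w / (v + w)) *: (w^-1 *: z) = (v + w)^-1 *: (x + z).
    have E (u : R) : 0 < u -> u / (v + w) * u^-1 = (v + w)^-1.
      by move=> u0; rewrite mulrAC divff ?mul1r// gt_eqF.
    by rewrite !scalerA !E// scalerDr.
  have k0 : 0 <= (v + w)^-1 by rewrite invr_ge0 ltW.
  have h1 := ler_wpM2l (mulr_ge0 (ltW v0) k0) hv; have h2 := ler_wpM2l (mulr_ge0 (ltW w0) k0) hw.
  move=> h; apply: le_trans h _; apply: le_trans (lerD h1 h2) _.
  by rewrite -mulrDl -mulrDl divff ?mul1r// gt_eqF.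
lra.
Qed.

Lemma gaugeZ_gt0 (a : R) x : 0 < a -> gauge (a *: x) = a * gauge x.
Proof.
have le (c : R) z : 0 < c -> gauge (c *: z) <= c * gauge z.
  move=> c0; rewrite mulrC -ler_pdivrMr//.
  apply: (@infr_ge _ _ (sublevel z) id _ _ (level_ex z)) => v [v0 hv].
  rewrite ler_pdivrMr//; apply: gauge_le; split; first exact: mulr_gt0.
  by rewrite scalerA invfM mulrVK ?unitfE ?gt_eqF.
move=> a0; apply/eqP; rewrite eq_le le//= -ler_pdivlMl//.
rewrite -{1}(scale1r x) -(mulVf (lt0r_neq0 a0)) -scalerA.
by apply: le; rewrite invr_gt0.
Qed.

Lemma gaugeN x : gauge (- x) = gauge x.
Proof.
suff E : sublevel (- x) = sublevel x by rewrite /gauge E.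
by apply/seteqP; split=> v [v0 hv]; split=> //; rewrite -1?H_even -scalerN// ?opprK.
Qed.

Lemma gaugeZ (a : R) x : gauge (a *: x) = `|a| * gauge x.
Proof.
have [a0|a0|->] := ltrgtP a 0; last by rewrite scale0r gauge0 normr0 mul0r.
  by rewrite -gaugeN -scaleNr gaugeZ_gt0 ?oppr_gt0// ltr0_norm.
by rewrite gaugeZ_gt0// gtr0_norm.
Qed.

Lemma gauge_equiv : exists c C : R, [/\ 0 < c, 0 < C &
  forall x, c * `|x| <= gauge x <= C * `|x|].
Proof.
exists b^-1, r^-1; rewrite !invr_gt0; split=> // x; rewrite gauge_le_norm andbT.
by rewrite mulrC gauge_ge_norm.
Qed.

Definition gauge_norm : equivalent_norm X := EquivalentNorm gaugeD gaugeZ gauge_equiv.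

Lemma gauge_sublinear : sublinear gauge.
Proof. by split=> [|a x a0]; [exact: gaugeD|rewrite gaugeZ ger0_norm]. Qed.

Lemma gauge_le1 x : gauge x <= 1 <-> H x <= 3 / 4.
Proof.
split=> [gx|hx]; last first.
  by apply: gauge_le; split=> //; rewrite invr1 scale1r.
have hv (v : R) : 1 < v -> H (v^-1 *: x) <= 3 / 4.
  move=> v1; have v10 : 0 < v - 1 by lra.
  have [w [w0 hw] wv] := gauge_adh x v10.
  have v0 : 0 < v by lra.
  have wv01 : 0 <= w / v <= 1.
    by apply/andP; split; [exact: divr_ge0 (ltW w0) (ltW v0)|rewrite ler_pdivrMr//; lra].
  have -> : v^-1 *: x = (w / v) *: (w^-1 *: x).
    by rewrite scalerA mulrAC divff ?gt_eqF// mul1r.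
  apply: le_trans (convex_scale _ wv01) _; apply: le_trans hw.
  by case/andP: wv01 => _ h; rewrite ler_piMl.
rewrite -subr_le0; apply: (le0_small (H_ge0 (2 *: x))) => e e0.
pose s := Num.min e 1; have s0 : 0 < s by rewrite lt_min e0 ltr01.
have s1 : s <= 1 by rewrite ge_min lexx orbT.
have se : s <= e by rewrite ge_min lexx.
have s1' : 0 < 1 + s by lra.
have := @convex_extend ((1 + s)^-1 *: x) s; rewrite (ltW s0) s1 => /(_ isT).
rewrite scalerA divff ?gt_eqF// scale1r scalerA => h.
have h1 := hv (1 + s) (ltac:(lra)).
have k01 : 0 <= (1 + s)^-1 <= 1 by rewrite invr_ge0 (ltW s1') invf_le1//; lra.
have h2 := convex_scale (2 *: x) k01; rewrite scalerA [_ * 2]mulrC in h2.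
have h3 : H ((2 / (1 + s)) *: x) <= H (2 *: x).
  by apply: le_trans h2 _; rewrite ler_piMl//; case/andP: k01.
have h4 := ler_wpM2l (ltW s0) h3; have h5 := ler_wpM2r (H_ge0 (2 *: x)) se.
rewrite [H (2 *: x) * e]mulrC; lra.
Qed.

Lemma gauge_lt x (v : R) : 0 < v -> H (v^-1 *: x) < 3 / 4 -> gauge x < v.
Proof.
move=> v0 hv; set z := v^-1 *: x in hv.
pose K := H (2 *: z) + 1; have K0 : 0 < K by rewrite ltr_wpDl.
pose s := Num.min 1 ((3 / 4 - H z) / K).
have s0 : 0 < s by rewrite lt_min ltr01 divr_gt0// subr_gt0.
have s1 : s <= 1 by rewrite ge_min lexx.
have sK : s * K <= 3 / 4 - H z by rewrite -ler_pdivlMr// ge_min lexx orbT.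
have s1' : 0 < 1 + s by lra.
apply: (@le_lt_trans _ _ (v / (1 + s))); last first.
  by rewrite ltr_pdivrMr// -[ltLHS]mulr1 ltr_pM2l//; lra.
apply: gauge_le; split; first exact: divr_gt0.
rewrite invf_div -scalerA -/z.
have := @convex_extend z s; rewrite (ltW s0) s1 => /(_ isT).
by move: sK; rewrite /K; lra.
Qed.

Lemma gauge_level x : gauge x = 1 -> H x = 3 / 4.
Proof.
move=> gx; apply/eqP; rewrite eq_le (gauge_le1 x).1 ?gx//= leNgt; apply/negP => h.
by have := @gauge_lt x 1 ltr01; rewrite invr1 scale1r gx ltxx => /(_ h).
Qed.

Lemma gauge_normalize x : 0 < gauge x -> H ((gauge x)^-1 *: x) = 3 / 4.
Proof.
move=> g0; apply: gauge_level; rewrite gaugeZ_gt0 ?invr_gt0// mulVf// gt_eqF//.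
Qed.

Lemma gauge_ge1 x : 1 <= gauge x -> 3 / 4 * gauge x <= H x.
Proof.
move=> g1; have g0 : 0 < gauge x by lra.
rewrite -(gauge_normalize g0) -ler_pdivlMr// mulrC; apply: convex_scale.
by rewrite invr_ge0 (ltW g0) invf_le1.
Qed.

Lemma gauge_le1_scale x : gauge x <= 1 -> H x <= 3 / 4 * gauge x.
Proof.
move=> g1; have [g0|g0] := ltrP 0 (gauge x); last first.
  have nx : `|x| <= 0.
    by have := le_trans (gauge_ge_norm x) g0; rewrite ler_pdivrMr// mul0r.
  have -> : x = 0 by apply/eqP; rewrite -normr_le0.
  by rewrite H_zero gauge0 mulr0.
rewrite -(gauge_normalize g0) [leRHS]mulrC.
have {1}-> : x = gauge x *: ((gauge x)^-1 *: x).
  by rewrite scalerA divff ?scale1r// gt_eqF.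
by apply: convex_scale; rewrite (ltW g0).
Qed.

Lemma gauge_support x : exists2 f : topdual X, forall z, f z <= gauge z & f x = gauge x :> R.
Proof. exact: (dual_dominated x gauge_sublinear gauge_le_norm). Qed.

(** The midpoint [m] has gauge above $1 - a/2$, so stretching it by some $1 + s$ with $s \le a$
    brings it to the level $3/4$. The stretch raises [H] by at most $M a$, hence $H(m) \ge 3/4 - M
    a$, while both endpoints have $H \le 3/4$. *)
Lemma gauge_slice x z (f : topdual X) (a : R) : gauge x = 1 -> (forall z, f z <= gauge z) ->
  f x = 1 :> R -> gauge z <= 1 -> 0 < a <= 1 -> 1 - a < f z ->
  deficit H x z <= M * a /\ 3 / 4 - 2 * (M * a) <= H z.
Proof.
move=> gx fg fx gz /andP[a0 a1] fz; pose m := midpoint x z.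
have Hx := gauge_level gx; have Hz := (gauge_le1 z).1 gz.
have fm : f m = 2^-1 * (1 + (f z : R)) :> R by rewrite dualZ dualD fx.
have gm1 : 1 - a / 2 < gauge m.
  apply: lt_le_trans (fg m); have -> : (f m : R) = 2^-1 * (1 + (f z : R)) by exact: fm.
  by move: fz; set c : R := f z; lra.
have gm0 : 0 < gauge m by lra.
have gmle : gauge m <= 1.
  have : gauge m <= 2^-1 * (gauge x + gauge z).
    rewrite /m /midpoint gaugeZ_gt0 ?invr_gt0// ler_pM2l ?invr_gt0//; exact: gaugeD.
  by rewrite gx; lra.
have Hm := gauge_normalize gm0.
pose s := (gauge m)^-1 - 1.
have s0 : 0 <= s by rewrite subr_ge0 invf_ge1.
have sa : s <= a.
  rewrite /s lerBlDr -[_^-1]div1r ler_pdivrMr//.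
  have a10 : 0 <= a + 1 by lra.
  have k1 := ler_wpM2l a10 (ltW gm1); have k2 : 0 <= a * (1 - a) by rewrite mulr_ge0; lra.
  by lra.
have nm : `|2 *: m| <= 2 * b.
  rewrite normrZ ger0_norm// ler_pM2l//; apply: H_coercive.
  exact: (gauge_le1 m).1.
have := @convex_extend m s; rewrite s0 (le_trans sa a1) => /(_ isT).
have -> : 1 + s = (gauge m)^-1 by rewrite /s addrC subrK.
rewrite Hm => h.
have h1 := ler_wpM2l s0 (H_bounded nm).
have M0 : 0 <= M by exact: le_trans (H_ge0 _) (H_bounded nm).
have h2 := ler_wpM2l M0 sa; rewrite /deficit -/m Hx.
have h3 := H_convex x z half01; rewrite -midpointE -/m Hx in h3.
by split; lra.
Qed.

(* Tilting [d] into the kernel of a support functional makes both increments of the gauge *)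
(* nonnegative, so that they are controlled by the sum of the increments of [H].          *)
Lemma gauge_smooth x : (forall z, smooth_at H z) -> gauge x = 1 -> smooth_at gauge x.
Proof.
move=> hs gx d e e0; have Hx := gauge_level gx.
have [f fg] := gauge_support x; rewrite gx => fx.
pose c : R := f d; pose d' := d - c *: x.
have e3 : 0 < 3 / 8 * e by lra.
have [t1 t10 h1] := hs x d' _ e3.
have c1 : 0 < 2 * (`|c| + 1) by rewrite mulr_gt0// ltr_wpDl.
exists (Num.min (t1 / 2) (2 * (`|c| + 1))^-1); first by rewrite lt_min divr_gt0//= invr_gt0.
move=> t; rewrite lt_min => /and3P[t0 tt1 tc].
have tc2 : `|t * c| <= 2^-1.
  have h : t * (2 * (`|c| + 1)) < 1 by rewrite -ltr_pdivlMr// div1r.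
  by rewrite normrM (gtr0_norm t0); lra.
have half_bound (s : R) : 0 < s -> s < t1 ->
    gauge (x + s *: d') <= 1 + e / 2 * s /\ gauge (x - s *: d') <= 1 + e / 2 * s.
  move=> s0 st; have := h1 s; rewrite s0 st => /(_ isT) h.
  have fd' : f d' = 0 :> R by rewrite dualB dualZ fx mulr1 subrr.
  have g1 : 1 <= gauge (x + s *: d').
    by apply: le_trans (fg _); rewrite dualD dualZ fx fd' mulr0 addr0.
  have g2 : 1 <= gauge (x - s *: d').
    by apply: le_trans (fg _); rewrite dualB dualZ fx fd' mulr0 subr0.
  have k1 := gauge_ge1 g1; have k2 := gauge_ge1 g2; rewrite Hx in h.
  move: g1 g2 k1 k2 h; set p := gauge _; set q := gauge _ => g1 g2 k1 k2 h.
  by split; lra.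
have tc1 : - 2^-1 <= t * c <= 2^-1 by rewrite -ler_norml.
(* Homogeneity turns an increment along [d] into one along the tilted direction: $x + ud = k(x +
   (u/k) d')$ with $k = 1 + uc$. *)
have key (u : R) : `|u| = t -> `|t * c| = `|u * c| -> - 2^-1 <= u * c <= 2^-1 ->
    gauge (x + u *: d) <= 1 + u * c + e / 2 * t.
  move=> ut _ /andP[u1 u2]; pose k := 1 + u * c; have k0 : 0 < k by rewrite /k; lra.
  have -> : x + u *: d = k *: (x + (u / k) *: d').
    rewrite scalerDr scalerA mulrCA divff ?gt_eqF// mulr1 /d' scalerBr scalerA.
    by rewrite /k scalerDl scale1r addrACA addrN addr0.
  rewrite gaugeZ_gt0//; pose s := t / k.
  have s0 : 0 < s by exact: divr_gt0.
  have st : s < t1.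
    rewrite /s ltr_pdivrMr//; apply: lt_le_trans tt1 _.
    by rewrite ler_pM2l// /k; lra.
  have [p1 p2] := half_bound s s0 st.
  have sk : k * s = t by rewrite /s mulrC divfK// gt_eqF.
  have gs : gauge (x + (u / k) *: d') <= 1 + e / 2 * s.
    have [u0|u0] := lerP 0 u; first by rewrite -(ger0_norm u0) ut.
    by rewrite -[u]opprK -(ltr0_norm u0) ut mulNr scaleNr.
  have := ler_wpM2l (ltW k0) gs; rewrite mulrDr mulr1 mulrCA sk.
  by rewrite -/k.
have h3 := key t (gtr0_norm t0) erefl tc1.
have nt : `|- t| = t by rewrite normrN gtr0_norm.
have tcN : - 2^-1 <= - t * c <= 2^-1 by rewrite mulNr; lra.
have h4 := key (- t) nt (ltac:(by rewrite mulNr normrN)) tcN.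
rewrite scaleNr in h4; lra.
Qed.

End Gauge.

(** * The renorming *)

Section Estimates.
Context {R : realType}.
Implicit Types (a c d e p q u v : R).

Lemma midpoint_avg p q : 2^-1 * p + (1 - 2^-1) * q = 2^-1 * (p + q).
Proof. by field. Qed.

Lemma min3_le p q u (w := Num.min p (Num.min q u)) : [/\ w <= p, w <= q & w <= u].
Proof. by rewrite /w; split; rewrite !ge_min lexx ?orbT. Qed.

Lemma min3_gt0 p q u : 0 < p -> 0 < q -> 0 < u -> 0 < Num.min p (Num.min q u).
Proof. by rewrite !lt_min => -> -> ->. Qed.

Lemma shrink e : 0 < e -> e / 12000 <= e / 3000.
Proof. lra. Qed.

Lemma avg_ge0 c p q : c <= 2^-1 * p + (1 - 2^-1) * q -> 0 <= (p + q) / 2 - c.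
Proof. lra. Qed.

Lemma le_summand K a u v e : u + v <= K * a -> 0 <= u -> 0 < K -> a <= e / K -> v <= e.
Proof.
move=> h u0 K0; rewrite ler_pdivlMr// [a * K]mulrC => h'.
by apply: le_trans (le_trans h h'); rewrite lerDr.
Qed.

Lemma growth_le c d : c <= d -> c ^+ 2 <= d ^+ 2 ->
  6 * c + c ^+ 2 / 32 <= (2 * (6 * d + d ^+ 2 / 32)) / 2.
Proof. lra. Qed.

Lemma add_halves p q c : p <= c / 2 -> q <= c / 2 -> p + q <= c.
Proof. lra. Qed.

Lemma value_close a e p p' q q' d : p + q <= 3 / 4 -> 3 / 4 - 2 * (3000 * a) <= p + q ->
  p' + q' = 3 / 4 -> `|q - q'| <= d -> d <= e / 2 -> a <= e / 12000 -> `|p - p'| <= e.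
Proof.
rewrite !ler_norml => h1 h2 h3 /andP[h4 h5] h6 h7.
by apply/andP; split; lra.
Qed.

Lemma gap_le a p q u : 1 - a < p -> p <= q -> q - 4^-1 + u <= 3 / 4 -> u <= a.
Proof. lra. Qed.

Lemma norm_close e p q d : p <= d -> d <= e / 32 -> q <= e / 32 -> 16 * (p + q) <= e.
Proof. lra. Qed.

Lemma sup_close d p : 1 - d ^+ 2 / 9216 < p -> 0 < d -> d <= 1 -> 2^-1 <= p /\ 1 - p <= d.
Proof.
move=> h d0 d1; have : d ^+ 2 <= d by rewrite expr2 ler_piMl// ltW.
by split; lra.
Qed.

End Estimates.

(** * The convex body and its gauge *)

Section RidgeFunction.
Context {R : realType} {X : normedModType R}.
Variables (G : X -> R) (x0 : X) (f0 : topdual X) (g : nat -> topdual X) (y : nat -> X).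
Hypothesis hG : quadratic G.
Hypothesis G_bounds : forall x, `|x| ^+ 2 / 18 <= G x <= 2 * `|x| ^+ 2.
Hypothesis G_smooth : forall x, smooth_at G x.
Hypothesis G_LUR : forall x (e : R), 0 < e -> exists2 eta : R, 0 < eta &
  forall z, deficit G x z <= eta -> `|x - z| <= e.
Hypothesis x0_norm : `|x0| = 1.
Hypothesis f0_x0 : f0 x0 = 1 :> R.
Hypothesis f0_le : forall x, `|f0 x : R| <= `|x|.
Hypothesis g_le : forall n x, `|g n x : R| <= 2 * `|x|.
Hypothesis y_le : forall n, `|y n| <= 4.
Hypothesis f0_y : forall n, f0 (y n) = 0 :> R.
Hypothesis g_x0 : forall n, g n x0 = 0 :> R.
Hypothesis g_y : forall n, 4^-1 <= g n (y n) :> R.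
Hypothesis g_off : forall m n, m <> n -> `|g m (y n) : R| <= 32^-1.
Hypothesis g_null : forall x (e : R), 0 < e ->
  exists N, forall n, (N <= n)%N -> `|g n x : R| <= e.

Definition flat_part (x : X) : X := x - (f0 x : R) *: x0.
Local Notation P := flat_part.

Lemma flat_partL (a : R) x z : P (a *: x + z) = a *: P x + P z.
Proof. by rewrite /P dualD dualZ scalerDl -scalerA scalerBr opprD addrACA. Qed.

Lemma flat_partZ (a : R) x : P (a *: x) = a *: P x.
Proof. by rewrite -[a *: x]addr0 flat_partL /P dual0 scale0r subr0 addr0. Qed.

Lemma flat_partD x z : P (x + z) = P x + P z.
Proof. by have := flat_partL 1 x z; rewrite !scale1r. Qed.

Lemma flat_partB x z : P (x - z) = P x - P z.
Proof. by rewrite flat_partD -scaleN1r flat_partZ scaleN1r. Qed.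

Lemma flat_part_le x : `|P x| <= 2 * `|x|.
Proof.
apply: le_trans (ler_normB _ _) _; rewrite normrZ x0_norm mulr1.
by rewrite [leRHS](_ : _ = `|x| + `|x|) ?lerD2l ?f0_le//; ring.
Qed.

Lemma flat_part_x0 (a : R) x : P (x + a *: x0) = P x.
Proof. by rewrite flat_partD flat_partZ /P f0_x0 scale1r subrr scaler0 addr0. Qed.

Definition eps (n : nat) : R := 1024^-1 / n.+1%:R.

Lemma eps_gt0 n : 0 < eps n.
Proof. by rewrite divr_gt0 ?invr_gt0. Qed.

Lemma eps_mono m n : (m <= n)%N -> eps n <= eps m.
Proof. by move=> mn; rewrite ler_pM2l ?invr_gt0// lef_pV2 ?posrE// ler_nat. Qed.

Lemma eps_le n : eps n <= 1024^-1.
Proof. by have := eps_mono (leq0n n); rewrite {2}/eps divr1. Qed.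

Lemma eps_small (e : R) : 0 < e -> exists N, forall n, (N <= n)%N -> eps n <= e.
Proof.
move=> e0; have [N hN] := ex_invn e0; exists N => n Nn.
apply: le_trans (eps_mono Nn) _; rewrite /eps.
have h : 0 < (N.+1%:R : R)^-1 by rewrite invr_gt0.
by move: hN h; set b := _^-1 => hN h; lra.
Qed.

(** Close to $|g_n|$, with errors of order [eps n] on bounded sets; the second term provides LUR in
    the component off the axis. *)
Definition ridge (n : nat) (x : X) : R := huber_fun (g n) (eps n) x + eps n * G (P x).

Lemma ridge_ge0 n x : 0 <= ridge n x.
Proof.
by rewrite addr_ge0 ?huber_fun_ge0 ?eps_gt0// mulr_ge0 ?(quad_ge0 hG)// ltW// eps_gt0.
Qed.

Lemma G_flat_part x : G (P x) <= 8 * `|x| ^+ 2.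
Proof.
have /andP[_ h] := G_bounds (P x); apply: le_trans h _.
rewrite [leRHS](_ : _ = 2 * (2 * `|x|) ^+ 2); last by ring.
by rewrite ler_pM2l// lerXn2r ?nnegrE ?mulr_ge0// flat_part_le.
Qed.

Lemma ridge_le n x : ridge n x <= `|g n x : R| + eps n * (8 * `|x| ^+ 2).
Proof.
apply: lerD; first by case/andP: (huber_fun_bounds (g n) (eps_gt0 n) x).
by rewrite ler_pM2l ?eps_gt0// G_flat_part.
Qed.

Lemma ridge_bound n x : ridge n x <= 2 * `|x| + `|x| ^+ 2 / 128.
Proof.
apply: le_trans (ridge_le n x) _; apply: lerD => //.
have h := ler_wpM2r (sqr_ge0 `|x|) (eps_le n).
by rewrite [leLHS](_ : _ = 8 * (eps n * `|x| ^+ 2)); [lra|ring].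
Qed.

Lemma ridge_convex n : convex_fun (ridge n).
Proof.
move=> t x z t01; have h1 := huber_fun_convex (g n) (eps_gt0 n) x z t01.
have h2 := ler_wpM2l (ltW (eps_gt0 n)) (quad_convex hG (P x) (P z) t01).
rewrite /ridge flat_partL flat_partZ.
by apply: le_trans (lerD h1 h2) _; rewrite le_eqVlt; apply/orP; left; apply/eqP; ring.
Qed.

Lemma ridge_smooth n x : smooth_at (ridge n) x.
Proof.
apply: smooth_add; first exact: huber_fun_smooth (eps_gt0 n) x.
apply: smooth_scale; first exact: ltW (eps_gt0 n).
move=> d e e0; have [t0 t00 h] := G_smooth (P x) (P d) e0; exists t0 => // t tt.
by rewrite flat_partD flat_partB flat_partZ; exact: h.
Qed.

Lemma ridge_null x (e : R) : 0 < e -> exists N, forall n, (N <= n)%N -> ridge n x <= e.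
Proof.
move=> e0; have e2 : 0 < e / 2 by lra.
have [N1 h1] := g_null x e2.
pose K := 8 * `|x| ^+ 2 + 1; have K0 : 0 < K by rewrite ltr_wpDl// mulr_ge0// sqr_ge0.
have [N2 h2] := eps_small (divr_gt0 e2 K0); exists (maxn N1 N2) => n.
rewrite geq_max => /andP[/h1 {}h1 /h2 {}h2]; apply: le_trans (ridge_le n x) _.
rewrite ler_pdivlMr// in h2.
have h3 : eps n * (8 * `|x| ^+ 2) <= eps n * K by rewrite ler_pM2l ?eps_gt0// /K; lra.
by have := lerD h1 (le_trans h3 h2); rewrite -splitr.
Qed.

Definition ridges : X -> R := flat ridge.

Lemma ridges_convex : convex_fun ridges.
Proof. exact: (flat_convex ridge_ge0 ridge_bound ridge_convex). Qed.

Lemma ridges_smooth x : smooth_at ridges x.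
Proof.
exact: (flat_smooth ridge_ge0 ridge_bound ridge_convex ridge_smooth ridge_null).
Qed.

Lemma ridges_ge0 x : 0 <= ridges x.
Proof. exact: (flat_ge0 ridge_ge0 ridge_bound). Qed.

Lemma ridgesN x : ridges (- x) = ridges x.
Proof.
apply: flat_eq => n; rewrite /ridge huber_funN; congr (_ + _ * _).
by rewrite -scaleN1r flat_partZ scaleN1r (quadN _ hG).
Qed.

Lemma ridges_flat_part x : ridges (P x) = ridges x.
Proof.
have PP : P (P x) = P x by rewrite {2}/P -scaleNr flat_part_x0.
apply: flat_eq => n; rewrite /ridge PP; congr (_ + _).
by rewrite /huber_fun {1}/P dualB dualZ g_x0 mulr0 subr0.
Qed.

Lemma ridges_x0 (a : R) x : ridges (x + a *: x0) = ridges x.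
Proof. by rewrite -ridges_flat_part flat_part_x0 ridges_flat_part. Qed.

Lemma ridges_le x : ridges x <= 6 * `|x| + `|x| ^+ 2 / 32.
Proof.
have := flat_le3 ridge_ge0 (fun n => ridge_bound n x); rewrite -/(ridges x).
by have := sqr_ge0 `|x|; lra.
Qed.

Lemma ridges_ge x : `|P x| ^+ 2 <= 9216 * ridges x.
Proof.
have E : eps 0 = 1024^-1 by rewrite /eps divr1.
have := flat_ge2 ridge_ge0 ridge_bound 0 x; rewrite -/(ridges x) /ridge.
have := huber_fun_ge0 (g 0%N) (eps_gt0 0) x; rewrite E; set a := huber_fun _ _ _.
by have /andP[h _] := G_bounds (P x); lra.
Qed.

(** [flat_deficit] yields an index below an [N] fixed in advance. Hence the factor [eps n] in front
    of [G] is at least [eps N], and the deficit of [G] is small although [eps] tends to $0$. *)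
Lemma ridges_LUR x (e : R) : P x != 0 -> 0 < e -> exists2 eta : R, 0 < eta &
  forall z, deficit ridges x z <= eta -> `|P x - P z| <= e.
Proof.
move=> Px e0; have r0 : 0 < ridge 0 x.
  apply: ltr_wpDl; first exact: huber_fun_ge0 (eps_gt0 0) x.
  rewrite mulr_gt0 ?eps_gt0//; case/andP: (G_bounds (P x)) => h _.
  by apply: lt_le_trans h; rewrite divr_gt0// exprn_gt0// normr_gt0.
have [N hN] := flat_deficit ridge_ge0 ridge_bound ridge_convex ridge_null r0.
have [eta eta0 heta] := G_LUR (P x) e0.
have [eta' eta'0 h] := hN _ (mulr_gt0 (eps_gt0 N) eta0); exists eta' => // z hz.
have [n nN hn] := h z hz; apply: heta.
have en := eps_gt0 n; rewrite -(ler_pM2l en).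
have E : deficit (ridge n) x z =
    deficit (huber_fun (g n) (eps n)) x z + eps n * deficit G (P x) (P z).
  by rewrite /deficit /ridge /midpoint flat_partZ flat_partD; ring.
have h1 : 0 <= deficit (huber_fun (g n) (eps n)) x z.
  have := huber_fun_convex (g n) en x z half01; rewrite /deficit midpointE.
  set a := huber_fun _ _ _; set b := huber_fun _ _ _; set c := huber_fun _ _ _; lra.
have h2 : eps N * eta <= eps n * eta by rewrite ler_pM2r//; apply: eps_mono; exact: ltnW.
by move: hn; rewrite E => hn; lra.
Qed.

Lemma ridge_scaled_y n k (t : R) : 0 <= t <= 64^-1 ->
  `|g n (t *: y k) : R| - eps n / 4 <= ridge n (t *: y k)
    <= `|g n (t *: y k) : R| + eps n / 32.
Proof.
move=> /andP[t0 t1]; have en := eps_gt0 n.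
have /andP[h1 h2] := huber_fun_bounds (g n) en (t *: y k).
have nt : `|t *: y k| <= 16^-1.
  rewrite normrZ ger0_norm//; apply: le_trans (ler_pM t0 _ t1 (y_le k)) _ => //.
  by lra.
have h3 := ler_wpM2l (ltW en) (G_flat_part (t *: y k)).
have h4 : `|t *: y k| ^+ 2 <= 256^-1.
  have -> : 256^-1 = 16^-1 ^+ 2 :> R by field.
  by rewrite lerXn2r ?nnegrE ?invr_ge0.
have h5 := ler_wpM2l (ltW en) h4.
have h6 : 0 <= eps n * G (P (t *: y k)) by rewrite mulr_ge0 ?(quad_ge0 hG)// ltW.
rewrite /ridge; set a := huber_fun _ _ _ in h1 h2 *.
set b := `|g n (t *: y k) : R| in h1 h2 *.
apply/andP; split; lra.
Qed.

Lemma g_scaled n k (t : R) : 0 <= t -> `|g n (t *: y k) : R| = t * `|g n (y k) : R|.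
Proof. by move=> t0; rewrite dualZ normrM ger0_norm. Qed.

(** By almost biorthogonality the other ridges at $y_k/64$ are at most a quarter of the [k]-th, so
    [flat_single] applies. *)
Lemma ridges_y k : ridges (64^-1 *: y k) = 2 * ridge k (64^-1 *: y k).
Proof.
have t64 : 0 <= (64^-1 : R) <= 64^-1 by rewrite lexx invr_ge0 ler0n.
apply: (flat_single ridge_ge0 ridge_bound) => n /eqP nk.
have /andP[_ h1] := ridge_scaled_y n k t64; have /andP[h2 _] := ridge_scaled_y k k t64.
have t0 : 0 <= (64^-1 : R) by lra.
rewrite g_scaled// in h1; rewrite g_scaled// in h2.
have h3 := g_off nk; have h4 := le_trans (g_y k) (ler_norm _).
have e1 := eps_le n; have e2 := eps_le k.
move: h1 h2 h3 h4; set a := `|_|; set b := `|_| => h1 h2 h3 h4.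
lra.
Qed.

Lemma ridges_y_le k : ridges (64^-1 *: y k) <= 2^-1.
Proof.
have t64 : 0 <= (64^-1 : R) <= 64^-1 by rewrite lexx invr_ge0 ler0n.
have t0 : 0 <= (64^-1 : R) by lra.
rewrite ridges_y; have /andP[_ h1] := ridge_scaled_y k k t64; rewrite g_scaled// in h1.
have h2 := g_le k (y k); have h3 := y_le k; have e2 := eps_le k.
move: h1 h2; set a := `|_| => h1 h2; lra.
Qed.

(** Along the ray of [y k], [ridge k] agrees with the linear function $|g_k|$ up to order
    [eps k]. *)
Lemma ridges_y_affine k :
  ridges (64^-1 *: y k) - 2 * ridges (128^-1 *: y k) <= 2 * eps k.
Proof.
have t64 : 0 <= (64^-1 : R) <= 64^-1 by rewrite lexx invr_ge0 ler0n.
have t128 : 0 <= (128^-1 : R) <= 64^-1 by lra.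
have t0 : 0 <= (64^-1 : R) by lra.
have t0' : 0 <= (128^-1 : R) by lra.
have h3 := flat_ge2 ridge_ge0 ridge_bound k (128^-1 *: y k); rewrite -/(ridges _) in h3.
rewrite ridges_y; have /andP[_ h1] := ridge_scaled_y k k t64; rewrite g_scaled// in h1.
have /andP[h2 _] := ridge_scaled_y k k t128; rewrite g_scaled// in h2.
have e0 := eps_gt0 k; move: h1 h2; set a := `|_| => h1 h2; lra.
Qed.

Definition body_fun (x : X) : R := huber (f0 x : R) + ridges x.
Local Notation H := body_fun.

Lemma body_convex : convex_fun H.
Proof.
move=> t x z t01; have h1 := huber_convex (f0 x : R) (f0 z : R) t01.
have h2 := ridges_convex x z t01; rewrite /H dualD !dualZ.
by apply: le_trans (lerD h1 h2) _; rewrite le_eqVlt; apply/orP; left; apply/eqP; ring.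
Qed.

Lemma ridges0 : ridges 0 = 0.
Proof.
apply/eqP; rewrite eq_le ridges_ge0 andbT.
by have := ridges_le 0; rewrite normr0 expr0n/= mulr0 mul0r addr0.
Qed.

Lemma body0 : H 0 = 0.
Proof. by rewrite /H ridges0 dual0 huber0 addr0. Qed.

Lemma bodyN x : H (- x) = H x.
Proof. by rewrite /H ridgesN dualN huberN. Qed.

Lemma body_ge0 x : 0 <= H x.
Proof. by rewrite addr_ge0 ?huber_ge0 ?ridges_ge0. Qed.

Lemma body_le x : H x <= 7 * `|x| + `|x| ^+ 2 / 32.
Proof.
have h1 := le_trans (huber_le (f0 x)) (f0_le x); have h2 := ridges_le x.
rewrite /H; move: h1 h2; set a := huber _; set c := `|x| => h1 h2; lra.
Qed.

Lemma body_small x : `|x| <= 16^-1 -> H x <= 3 / 4.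
Proof.
move=> h; apply: le_trans (body_le x) _.
have : `|x| ^+ 2 <= 16^-1 ^+ 2 by rewrite lerXn2r ?nnegrE ?invr_ge0.
move: h; set c := `|x| => h1 h2; lra.
Qed.

Lemma f0_body x : H x <= 3 / 4 -> `|f0 x : R| <= 1.
Proof.
rewrite /H => h; have := huber_ge (f0 x); have := ridges_ge0 x.
by move: h; set a := huber _; set c := `|_|; lra.
Qed.

Lemma le_of_sqr (u v : R) : 0 <= u -> 0 <= v -> u ^+ 2 <= v ^+ 2 -> u <= v.
Proof. by move=> u0 v0; rewrite ler_pXn2r ?nnegrE. Qed.

Lemma norm_split x : `|x| <= `|P x| + `|f0 x : R|.
Proof.
have -> : `|x| = `|P x + (f0 x : R) *: x0| by rewrite /P subrK.
by apply: le_trans (ler_normD _ _) _; rewrite normrZ x0_norm mulr1.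
Qed.

Lemma body_coercive x : H x <= 3 / 4 -> `|x| <= 100.
Proof.
move=> h; have h1 := f0_body h; have h2 := ridges_ge x.
have h3 : `|P x| <= 99.
  apply: le_of_sqr => //; apply: le_trans h2 _.
  by have := huber_ge0 (f0 x); move: h; rewrite /H; set a := huber _; lra.
apply: le_trans (norm_split x) _; move: h1 h3; set a := `|_|; set c := `|_|; lra.
Qed.

Lemma body_bounded x : `|x| <= 2 * 100 -> H x <= 3000.
Proof.
move=> h; apply: le_trans (body_le x) _.
have : `|x| ^+ 2 <= (2 * 100) ^+ 2 by rewrite lerXn2r ?nnegrE ?mulr_ge0.
move: h; set c := `|x| => h1 h2; lra.
Qed.

Lemma body_smooth x : smooth_at H x.
Proof.
apply: smooth_add; last exact: ridges_smooth.
have -> : (fun x => huber (f0 x : R)) = huber_fun f0 1.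
  by apply/funext => z; rewrite /huber_fun mul1r divr1.
exact: huber_fun_smooth ltr01 x.
Qed.

Lemma body_convex_body : convex_body H 16^-1 100 3000.
Proof.
split; [exact: body_convex|exact: body0|exact: bodyN|exact: body_ge0|by rewrite invr_gt0|by []|
  exact: body_small|exact: body_coercive|exact: body_bounded].
Qed.

Let hH := body_convex_body.

Definition renorming : equivalent_norm X := gauge_norm hH.
Local Notation N := (gauge H).

Lemma renorming_smooth x : N x = 1 -> smooth_at N x.
Proof. by move=> Nx; apply: (gauge_smooth hH) => //; exact: body_smooth. Qed.

Lemma f0_renorming x : `|f0 x : R| <= N x.
Proof.
have [N0|N0] := ltrP 0 (N x).
  have h : H ((N x)^-1 *: x) <= 3 / 4 by rewrite (gauge_normalize hH).
  have := f0_body h; rewrite dualZ normrM gtr0_norm ?invr_gt0// mulrC.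
  by rewrite ler_pdivrMr// mul1r.
have -> : x = 0.
  apply/eqP; rewrite -normr_le0; have := le_trans (gauge_ge_norm hH x) N0.
  by rewrite ler_pdivrMr// mul0r.
by rewrite dual0 normr0 (gauge_ge0 hH).
Qed.

Lemma renorming_le_split x : N x <= 16 * (`|P x| + `|f0 x : R|).
Proof.
apply: le_trans (gauge_le_norm hH x) _; rewrite invrK ler_pM2l//.
exact: norm_split.
Qed.

Lemma renorming_axis x : P x = 0 -> N x = 1 -> `|f0 x : R| = 1.
Proof.
move=> Px Nx; have := gauge_level hH Nx; rewrite /H -ridges_flat_part Px ridges0 addr0.
exact: huber_level.
Qed.

(** On a slice of $\pm f_0$ the term [huber] nearly exhausts the level $3/4$, so [ridges z] is
    small, and with it the distance to the axis by [ridges_ge]. *)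
Lemma exposed_axis x (e : R) : P x = 0 -> N x = 1 -> 0 < e ->
  exists f : topdual X, [/\ forall z, f z <= N z, f x = 1 :> R &
    exists2 a : R, 0 < a & forall z, N z <= 1 -> 1 - a < f z -> N (x - z) <= e].
Proof.
move=> Px Nx e0; have fx := renorming_axis Px Nx; pose s : R := f0 x.
have ss : s * s = 1.
  by rewrite -expr2 -(real_normK (num_real s)) fx expr1n.
exists (s *: f0); split.
- move=> z; apply: le_trans (f0_renorming z).
  apply: le_trans (ler_norm _) _.
  have -> : `|(s *: f0) z : R| = `|s| * `|f0 z : R| by rewrite -normrM.
  by rewrite fx mul1r.
- exact: ss.
pose d := Num.min 1 (e / 32); have d0 : 0 < d by rewrite lt_min ltr01 divr_gt0.
have d1 : d <= 1 by rewrite ge_min lexx.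
have d2 : d <= e / 32 by rewrite ge_min lexx orbT.
exists (d ^+ 2 / 9216); first by rewrite divr_gt0// exprn_gt0.
move=> z Nz fz; set a := d ^+ 2 / 9216 in fz *.
pose t : R := f0 z; have {}fz : 1 - a < s * t by exact: fz.
have [st2 std] := sup_close fz d0 d1.
have Hz := (gauge_le1 hH z).1 Nz; have nst : `|s * t| = `|t| by rewrite normrM fx mul1r.
have st1 : s * t <= 1 by apply: le_trans (ler_norm _) _; rewrite nst; exact: f0_body.
have stt : s * t <= `|t| by rewrite -nst ler_norm.
have ht : huber t = `|t| - 4^-1 by rewrite -huber_abs huber1// (le_trans st2).
have rz : ridges z <= a.
  have h : `|t| - 4^-1 + ridges z <= 3 / 4 by rewrite -ht; exact: Hz.
  exact: gap_le fz stt h.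
have Pz : `|P z| <= d.
  apply: le_of_sqr => //; first exact: ltW.
  apply: le_trans (ridges_ge z) _; have -> : d ^+ 2 = 9216 * a by rewrite /a; field.
  by rewrite ler_pM2l.
have fxz : `|f0 (x - z) : R| <= e / 32.
  have -> : (f0 (x - z) : R) = s * (1 - s * t).
    by rewrite dualB mulrBr mulr1 mulrA ss mul1r.
  by rewrite normrM fx mul1r ger0_norm ?subr_ge0// (le_trans std).
apply: le_trans (renorming_le_split _) _.
rewrite flat_partB Px sub0r normrN; exact: norm_close Pz d2 fxz.
Qed.

(** On a slice of a support functional the deficit of [H] is small, hence so are those of [ridges]
    and [huber]. The first gives $P z$ close to $P x$, so [ridges z] is close to [ridges x]. Since
    $H(z)$ is nearly $3/4$, the values of [huber] are close too, and [huber_separates] compares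
    $f_0$ at the two points. *)
Lemma exposed_off_axis x (e : R) : P x != 0 -> N x = 1 -> 0 < e ->
  exists f : topdual X, [/\ forall z, f z <= N z, f x = 1 :> R &
    exists2 a : R, 0 < a & forall z, N z <= 1 -> 1 - a < f z -> N (x - z) <= e].
Proof.
move=> Px Nx e0; have [f fN] := gauge_support hH x; rewrite Nx => fx.
exists f; split=> //; have Hx := gauge_level hH Nx; pose s : R := f0 x.
have e32 : 0 < e / 32 by rewrite divr_gt0.
have [eta eta0 heta] := huber_separates s e32.
pose K := 2 * (6 * (`|x| + 1) + (`|x| + 1) ^+ 2 / 32).
have nx1 : 0 < `|x| + 1 by rewrite ltr_wpDl.
have K0 : 0 < K by rewrite /K; have := exprn_gt0 2 nx1; lra.
pose d := Num.min 1 (Num.min (e / 32) (eta / (2 * K))).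
have K2 : 0 < 2 * K by rewrite mulr_gt0.
have d0 : 0 < d by apply: min3_gt0 => //; exact: divr_gt0.
have [d1 d2 d3'] := min3_le 1 (e / 32) (eta / (2 * K)); rewrite -/d in d1 d2 d3'.
have d3 : d * K <= eta / 2.
  by rewrite (ler_pdivlMr _ _ K2) in d3'; lra.
have [theta theta0 htheta] := ridges_LUR Px d0.
pose a := Num.min 1 (Num.min (theta / 3000) (eta / 12000)).
have K3000 : 0 < (3000 : R) by rewrite ltr0n.
have a0 : 0 < a by apply: min3_gt0 => //; apply: divr_gt0 => //; rewrite ltr0n.
have [a1 a2 a3] := min3_le 1 (theta / 3000) (eta / 12000); rewrite -/a in a1 a2 a3.
exists a => // z Nz fz; pose t : R := f0 z.
have a01 : 0 < a <= 1 by rewrite a0.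
have [h1 h2] := gauge_slice hH Nx fN fx Nz a01 fz.
have Hz := (gauge_le1 hH z).1 Nz.
have hub : 0 <= (huber s + huber t) / 2 - huber (2^-1 * (s + t)).
  apply: avg_ge0; have := huber_convex s t half01.
  by rewrite (midpoint_avg s t).
have E : deficit H x z =
    ((huber s + huber t) / 2 - huber (2^-1 * (s + t))) + deficit ridges x z.
  have fm : f0 (midpoint x z) = 2^-1 * (s + t) :> R by rewrite dualZ dualD.
  by rewrite /deficit /H fm -/s -/t; ring.
rewrite E in h1.
have rdef : 0 <= deficit ridges x z.
  by rewrite /deficit midpointE; apply: avg_ge0; exact: ridges_convex half01.
have Pxz : `|P x - P z| <= d by apply: htheta; exact: le_summand h1 hub K3000 a2.
(* Convexity makes [ridges] Lipschitz near [x]; [K] bounds the sum of its values at distance at most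
   $1$ on either side. *)
have rxz : `|ridges z - ridges x| <= d * K.
  pose v := d^-1 *: (P z - P x).
  have nv : `|v| <= 1.
    by rewrite normrZ gtr0_norm ?invr_gt0// mulrC ler_pdivrMr// mul1r distrC.
  have d01 : 0 <= d <= 1 by rewrite (ltW d0).
  have h := convex_lip (P x) v ridges_convex ridges_ge0 d01.
  have EE : P x + d *: v = P z by rewrite scalerA divff ?gt_eqF// scale1r addrC subrK.
  rewrite EE !ridges_flat_part in h; apply: le_trans h _; rewrite ler_pM2l//.
  have PxE w : ridges (P x + w) = ridges (x + w).
    by rewrite /P -addrA [- _ + w]addrC addrA -scaleNr ridges_x0.
  rewrite !PxE.
  have bd w : `|w| <= 1 -> ridges (x + w) <= K / 2.
    move=> w1; have nxw : `|x + w| <= `|x| + 1.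
      by apply: le_trans (ler_normD _ _) _; rewrite lerD2l.
    have sq : `|x + w| ^+ 2 <= (`|x| + 1) ^+ 2 by rewrite lerXn2r ?nnegrE// ltW.
    by apply: le_trans (ridges_le _) _; exact: growth_le.
  by apply: add_halves; apply: bd; rewrite ?normrN.
have st : `|s - t| <= e / 32.
  apply: heta; first exact: value_close Hz h2 Hx rxz d3 a3.
  have a4 : a <= eta / 3000 by exact: le_trans a3 (shrink eta0).
  by rewrite addrC in h1; exact: le_summand h1 rdef K3000 a4.
apply: le_trans (renorming_le_split _) _.
have -> : (f0 (x - z) : R) = s - t by rewrite dualB.
rewrite flat_partB; exact: norm_close Pxz d2 st.
Qed.

Lemma renorming_exposed x (e : R) : N x = 1 -> 0 < e ->
  exists f : topdual X, [/\ forall z, f z <= N z, f x = 1 :> R &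
    exists2 a : R, 0 < a & forall z, N z <= 1 -> 1 - a < f z -> N (x - z) <= e].
Proof. by have [Px|Px] := eqVneq (P x) 0; [exact: exposed_axis|exact: exposed_off_axis]. Qed.

Lemma renorming_x0 : N x0 = 1.
Proof.
apply/eqP; rewrite eq_le; apply/andP; split.
  apply/(gauge_le1 hH); rewrite /H f0_x0 -[x0]add0r -[x0 in 0 + x0]scale1r ridges_x0 ridges0.
  by rewrite huber1; lra.
by apply: le_trans (f0_renorming x0); rewrite f0_x0 normr1.
Qed.

(* The unit sphere contains almost segments: near [x0] it follows the graph of [ridges], *)
(* which is nearly affine on the segment from [0] to [y k / 64]. *)
Lemma renorming_not_LUR : exists w : nat -> X, [/\ forall k, N (w k) <= 1,
  forall k, 1 - 2 * eps k <= N (midpoint x0 (w k)) & forall k, 512^-1 / 100 <= N (x0 - w k)].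
Proof.
pose c k := ridges (64^-1 *: y k).
have c0 k : 0 <= c k by exact: ridges_ge0.
have c2 k : c k <= 2^-1 by exact: ridges_y_le.
(* The height is chosen so that $H(w_k) = 3/4$: for $c_k \le 1/2$ one has $huber(1 - c_k) = 3/4 -
   c_k$. *)
pose w k := 64^-1 *: y k + (1 - c k) *: x0; exists w.
have fw k : f0 (w k) = 1 - c k :> R.
  by rewrite dualD !dualZ f0_y f0_x0 mulr0 add0r mulr1.
have Nw k : N (w k) <= 1.
  apply/(gauge_le1 hH); rewrite /H fw ridges_x0 -/(c k) huber1; last by have := c2 k; lra.
  by lra.
split=> // k.
  have mE : midpoint x0 (w k) = 128^-1 *: y k + (1 - c k / 2) *: x0.
    rewrite /midpoint /w addrCA scalerDr scalerA -{1}(scale1r x0) -scalerDl scalerA.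
    by congr (_ *: _ + _ *: _); field.
  have Nm : N (midpoint x0 (w k)) <= 1.
    rewrite /midpoint (gaugeZ_gt0 hH) ?invr_gt0//.
    have := gaugeD hH x0 (w k); rewrite renorming_x0; have := Nw k.
    by set p := N _; set q := N _ => h1 h2; lra.
  have := gauge_le1_scale hH Nm.
  have fm : f0 (midpoint x0 (w k)) = 1 - c k / 2 :> R.
    by rewrite mE dualD !dualZ f0_y f0_x0 mulr0 add0r mulr1.
  rewrite /H fm huber1; last by have := c2 k; lra.
  rewrite {1}mE ridges_x0; have := ridges_y_affine k; rewrite -/(c k).
  have := eps_gt0 k; set p := N _; set q := ridges _; lra.
have h1 : 256^-1 <= 64^-1 * (g k (y k) : R).
  by apply: le_trans (ler_wpM2l _ (g_y k)); [lra|rewrite invr_ge0].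
have h2 : `|g k (x0 - w k) : R| = 64^-1 * (g k (y k) : R).
  rewrite dualB dualD !dualZ g_x0 mulr0 addr0 sub0r normrN ger0_norm//.
  by apply: le_trans h1; rewrite invr_ge0.
have h3 := g_le k (x0 - w k); rewrite h2 in h3.
apply: le_trans (gauge_ge_norm hH _); rewrite ler_pdivlMr//.
by move: h3 h1; set p := _ * _; set q := `|_|; lra.
Qed.

End RidgeFunction.

(** * Assembly of the smooth LUR function and transfer to the renormed space *)

Section Renorming.
Context {R : realType} {X : normedModType R}.

Lemma smooth_rotund_quadratic (C : nat -> set X) : determining C ->
  exists G : X -> R, [/\ quadratic G, forall x, `|x| ^+ 2 / 18 <= G x <= 2 * `|x| ^+ 2,
    forall x, smooth_at G x &
    forall x (e : R), 0 < e -> exists2 eta : R, 0 < eta &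
      forall z, deficit G x z <= eta -> `|x - z| <= e].
Proof.
move=> CX; have [A [d [f [d_le f_le fd0 d_fund f_total]]]] := coordinates_ex CX.
pose a (g : A * nat) : topdual X := f g.1 g.2.
have a_le g x : `|a g x : R| <= `|x| by exact: (coord_le f_le).
have a_total x : (forall g, a g x = 0) -> x = 0 by exact: (coord_total f_total).
have v_dense (x : X) (t0 e : R) : 0 < t0 -> 0 < e ->
  exists (t u : R) (F : {fset A * nat}), [/\ t <= t0, 0 <= u < t,
    forall g, (g \in F) = (t <= `|a g x : R|),
    forall g, g \notin F -> `|a g x : R| <= u &
    exists j, `|x - combination C f F j| < e].
  move=> t00 e0; have [t [F [tt0 hF hj]]] := witness_dense CX d_le f_le fd0 d_fund f_total x t00 e0.
  have [u u1 u2] := top_set_gap d_le f_le fd0 d_fund hF; exists t, u, F; split=> //.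
  by case: hF.
have d_split := splitting CX d_le fd0 f_total.
have hp := quadratic_rotund (combination C f) a_le.
have pb := rotund_bounds (combination C f) a_le.
have pL := rotund_LUR a_le a_total v_dense.
have hg := quadratic_predual C d_le.
have gb := predual_bounds C d_le.
have gs (l1 l2 : topdual X) : (forall e : R, 0 < e -> exists w, forall z,
    predual C d w + l1 (z - w) - e <= predual C d z /\
    predual C d w + l2 (z - w) - e <= predual C d z) -> l1 = l2.
  move=> h; apply: (dual_rotund_strict d_le d_fund d_split).
  apply/ler_addgt0Pr => e e0; have e2 : 0 < e / 2 by rewrite divr_gt0.
  have [w hw] := h _ e2; rewrite add0r.
  have -> : e = 2 * (e / 2) by field.
  have hd := predual_deficit d_le (fun z => (hw z).1) (fun z => (hw z).2).
  exact: hd.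
exists (regular (rotund a (combination C f)) (predual C d)); split.
- exact: quadratic_regular hp hg.
- exact: regular_bounds hp pb hg gb.
- exact: smooth_regular hp pb hg gs.
- exact: regular_LUR hp pb pL hg gb.
Qed.

Lemma LUR_gap (p m s e : R) : 0 <= p -> p <= 1 -> 1 - s <= m -> s <= e / 8 -> 0 <= m ->
  2 * m <= 1 + p -> `|2 * 1 ^+ 2 + 2 * p ^+ 2 - (2 * m) ^+ 2| <= e.
Proof.
move=> p0 p1 sm se m0 mp; have h1 := sqr_ge0 (m - 1); have h2 := sqr_ge0 (p - 1).
have h3 : (2 * m) ^+ 2 <= (1 + p) ^+ 2 by rewrite lerXn2r ?nnegrE ?mulr_ge0 ?addr_ge0.
have h4 : p ^+ 2 <= 1 by rewrite expr_le1.
by rewrite expr1n ger0_norm; lra.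
Qed.

Variable N : equivalent_norm X.

Definition renormed_exposed := forall x (e : R), N x = 1 -> 0 < e ->
  exists f : topdual X, [/\ forall z, f z <= N z, f x = 1 :> R &
    exists2 a : R, 0 < a & forall z, N z <= 1 -> 1 - a < f z -> N (x - z) <= e].

Lemma eqnormN x : N (- x) = N x.
Proof. by rewrite -scaleN1r eqnormZ normrN1 mul1r. Qed.

Lemma eqnorm_ge0 x : 0 <= N x.
Proof.
have [c [K [c0 _ /(_ x)/andP[h _]]]] := eqnorm_equiv N.
by apply: le_trans h; rewrite mulr_ge0// ltW.
Qed.

Lemma renormed_dual (f : topdual X) : (forall z, f z <= N z) ->
  exists F : topdual (renormed N), forall z, F z = f z :> R.
Proof.
move=> fN; apply: (@bounded_dual _ (renormed N) (fun z => f z) 1) => [a x y|x].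
  by rewrite dualD dualZ.
rewrite mul1r; have h1 : - N x <= f x by rewrite lerNl -dualN -eqnormN; exact: fN.
have : `|f x : R| <= N x by rewrite ler_norml h1; exact: fN.
by [].
Qed.

(** The functional attains its supremum $1$ over the new ball at [x], so [x] lies in all its slices.
    Strongly exposed points are denting. *)
Lemma exposed_ALUR : renormed_exposed -> ALUR (renormed N).
Proof.
move=> hN x Sx; split=> // V /nbhs_ballP[e /= e0 eV].
have Nx : N x = 1 by exact: Sx.
have Bx : unit_ball (renormed N) x by have : N x <= 1 by rewrite Nx.
have e2 : 0 < e / 2 by rewrite divr_gt0.
have [f [fN fx [a a0 ha]]] := hN x _ Nx e2.
have [F FE] := renormed_dual fN.
have sup1 : sup (F @` unit_ball (renormed N)) = 1.
  apply/eqP; rewrite eq_le; apply/andP; split.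
    apply: ge_sup; first by exists (F 0), 0 => //; rewrite /unit_ball/= normr0.
    by move=> _ [z z1 <-]; rewrite FE; apply: le_trans (fN z) _.
  apply: ub_le_sup; last by exists x; [exact: Bx|rewrite FE].
  by exists 1 => _ [z z1 <-]; rewrite FE; apply: le_trans (fN z) _.
exists [set z | unit_ball (renormed N) z /\ F z > sup (F @` unit_ball (renormed N)) - a].
split.
- exists F, a; split=> //.
    by move=> F0; have := FE x; rewrite F0 fx => /esym/eqP; rewrite oner_eq0.
  by exists 1 => _ [z z1 <-]; rewrite FE; apply: le_trans (fN z) _.
- split; first exact: Bx.
  by rewrite sup1 FE fx ltrBlDr ltrDl.
move=> z [z1]; rewrite sup1 FE => fz; apply: eV; rewrite -ball_normE /ball_/=.
apply: le_lt_trans (ha z z1 fz) _; lra.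
Qed.

Lemma smooth_gateaux : (forall x, N x = 1 -> smooth_at N x) -> gateaux_smooth (renormed N).
Proof.
move=> hN x y Sx _; have Nx : N x = 1 by exact: Sx.
apply/cvgrPdist_le => e e0.
have [t0 t00 ht] := hN x Nx y e e0.
near=> h.
have h0 : h != 0 by near: h; exact: nbhs_dnbhs_neq.
have ht0 : `|h| < t0.
  near: h; apply: dnbhs0_lt => //.
have key (t : R) : 0 < t -> t < t0 -> `|N (x + t *: y) + N (x - t *: y) - 2| <= e * t.
  move=> t1 t2; have := ht t; rewrite t1 t2 Nx mulr1 => /(_ isT) h1.
  have h2 : 2 <= N (x + t *: y) + N (x - t *: y).
    apply: le_trans (eqnormD N (x + t *: y) (x - t *: y)).
    have -> : x + t *: y + (x - t *: y) = 2 *: x by rewrite addrACA subrr addr0 scaler_nat mulr2n.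
    by rewrite eqnormZ Nx mulr1 ger0_norm.
  by rewrite ger0_norm ?subr_ge0.
rewrite sub0r normrN normrM normfV ler_pdivrMr ?normr_gt0//.
have hh : 0 < `|h| by rewrite normr_gt0.
have [hp|hn] := lerP 0 h.
  by have := key `|h| hh ht0; rewrite (ger0_norm hp).
have := key `|h| hh ht0; rewrite (ltr0_norm hn) scaleNr opprK.
by rewrite [N (x - h *: y) + _]addrC.
Unshelve. all: by end_near.
Qed.

(** Midpoints with [x0] approach the sphere, so the LUR expression tends to $0$ by [LUR_gap], while
    [w k] keeps the distance [r] from [x0]. *)
Lemma not_LUR (x0 : X) (w : nat -> X) (eps : nat -> R) (r : R) : N x0 = 1 -> 0 < r ->
  (forall e : R, 0 < e -> exists n0, forall n, (n0 <= n)%N -> eps n <= e) ->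
  (forall k, N (w k) <= 1) -> (forall k, 1 - eps k <= N (midpoint x0 (w k))) ->
  (forall k, r <= N (x0 - w k)) -> ~ LUR (renormed N).
Proof.
move=> N0 r0 heps w1 wm wr hL.
have : (w n : renormed N) @[n --> \oo] --> (x0 : renormed N).
  apply: hL => //; apply/cvgrPdist_le => e e0; have e8 : 0 < e / 8 by rewrite divr_gt0.
  have [n0 hn0] := heps _ e8; exists n0 => // n /hn0 {}hn0.
  have E : N (x0 + w n) = 2 * N (midpoint x0 (w n)).
    by rewrite /midpoint eqnormZ gtr0_norm ?invr_gt0 ?ltr0n// mulrA divff ?mul1r ?pnatr_eq0.
  have tri : 2 * N (midpoint x0 (w n)) <= 1 + N (w n) by rewrite -E -N0; exact: eqnormD.
  have := LUR_gap (eqnorm_ge0 (w n)) (w1 n) (wm n) hn0 (eqnorm_ge0 _) tri.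
  by rewrite -E -N0 sub0r normrN.
move=> /cvgrPdist_lt /(_ _ r0)[n0 _ /(_ n0 (leqnn _))].
by move=> /=; rewrite ltNge => /negP; apply; exact: wr.
Qed.

End Renorming.

Theorem mainTheorem3 (R : realType) (X : completeNormedModType R) :
  infinite_dimensional X -> weakly_countably_determined X ->
  exists N : equivalent_norm X,
    ALUR (renormed N) /\ gateaux_smooth (renormed N) /\ ~ LUR (renormed N).
Proof.
move=> Xinf /wcd_determining[C CX].
have [G [hG G_bounds G_smooth G_LUR]] := smooth_rotund_quadratic CX.
have [x0 [f0 [g [y [[x0n f0x0] f0n hgy goff gnull]]]]] := separated_sequences CX Xinf.
have gle n x : `|g n x : R| <= 2 * `|x| by have [h _ _ _ _] := hgy n; exact: h.
have yle n : `|y n| <= 4 by have [_ h _ _ _] := hgy n.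
have f0y n : f0 (y n) = 0 :> R by have [_ _ h _ _] := hgy n.
have gx0 n : g n x0 = 0 :> R by have [_ _ _ h _] := hgy n.
have gy n : 4^-1 <= g n (y n) :> R by have [_ _ _ _ h] := hgy n.
pose N := renorming hG G_bounds x0n f0n gle; exists N; split; [|split].
- apply: exposed_ALUR => x e.
  exact: (renorming_exposed hG G_bounds G_LUR x0n f0x0 f0n gle gx0 gnull).
- apply: smooth_gateaux => x.
  exact: (renorming_smooth hG G_bounds G_smooth x0n f0n gle gnull).
have [w [w1 wm wr]] := renorming_not_LUR hG G_bounds x0n f0x0 f0n gle yle f0y gx0 gy goff.
have r0 : 0 < 512^-1 / 100 :> R by rewrite divr_gt0 ?invr_gt0 ?ltr0n.
have N0 : N x0 = 1 := renorming_x0 hG G_bounds x0n f0x0 f0n gle gx0.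
refine (not_LUR (N := N) (eps := fun k => 2 * eps k) N0 r0 _ w1 wm wr).
move=> e e0; have e2 : 0 < e / 2 by rewrite divr_gt0.
have [n0 hn0] := eps_small e2; exists n0 => n /hn0.
by rewrite ler_pdivlMr// mulrC.
Qed.
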